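(* Consider the initial value problem for the incompressible Navier–Stokes equations $$u_t-\nu\Delta u+(u\cdot\nabla)u+\nabla P=0,\qquad \nabla\cdot u=0,\qquad u|_{t=0}=u_0,$$ with $x=(x_1,x_2)\in\mathbb{R}^2$, where the velocity vectors $u$ and $u_0$ have the (1,1)-symplectic representations $$u(t,x)=\big(-\partial_2\phi(t,x),\partial_1\phi(t,x),0\big),\qquad u_0(x)=\big(-\partial_2\phi_0(x),\partial_1\phi_0(x),0\big).$$ Assume that the initial datum $\phi_0(x)$ is a radially symmetric function and is regular enough. Then there exists a unique global solution $u$ of this problem such that $u(t,x)=\big(-\partial_2\phi(t,x),\partial_1\phi(t,x),0\big)$ with $$\phi(t,x)=\frac{1}{4\pi\nu t}\int_{\mathbb{R}^2}\exp\Big\{-\frac{|y|^2}{4\nu t}\Big\}\,\phi_0(x-y)\,dy .$$ Moreover, $\phi$ is a radially symmetric function (of $x$).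
   Context: Here $\nu>0$ is the constant viscosity coefficient, $u=u(t,x)$ is the unknown velocity vector field, $P=P(t,x)$ is the unknown scalar pressure, and $u_0$ is the given initial velocity with $\nabla\cdot u_0=0$. All functions depend on the two space variables $x=(x_1,x_2)$ only, $\partial_j=\partial_{x_j}$, and $\Delta=\partial_1^2+\partial_2^2$. The scalar functions $\phi,\phi_0$ are real-valued. A function of $x$ is radially symmetric if it depends on $x$ only through $r=|x|=(x_1^2+x_2^2)^{1/2}$. ''Regular enough'' means that $\phi_0$ has as much regularity as is needed; the paper does not specify it further.
   Formalization: Uniqueness is false with no condition at infinity (u=(t,0,0), P=-x_1, zero datum), so solutions have velocity, pressure and kinetic energy bounded on each [0,T]; ''regular enough'' means phi_0 is C^3 with bounded derivatives of orders 1 to 3 and u_0 of finite energy. *)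

(* Defs.v *)
From mathcomp Require Import all_boot all_order all_algebra.
From mathcomp Require Import all_classical all_reals all_analysis.

Set Implicit Arguments.
Unset Strict Implicit.
Unset Printing Implicit Defensive.

Import Order.TTheory GRing.Theory Num.Theory.
Import numFieldNormedType.Exports.

Local Open Scope classical_set_scope.
Local Open Scope ring_scope.

Definition plane_measure (R : realType) :=
  ((@lebesgue_measure R) \x (@lebesgue_measure R))%E.

(* The library norm on R * R is the sup norm, hence this separate notion. *)
Definition eucl (R : realType) (x : R * R) : R :=
  Num.sqrt (x.1 ^+ 2 + x.2 ^+ 2).

Definition radially_symmetric (R : realType) (f : R * R -> R) : Prop :=
  exists g : R -> R, forall x, f x = g (eucl x).

(* Vectors have three components but functions depend on (x_1, x_2) only.
   [dir j] is the projection onto the (x_1, x_2)-plane of the j-th basis vector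
   of R^3, so that [pd 2] is the derivative in x_3 of a function that does not
   depend on x_3, i.e. 0. *)
Definition dir (R : realType) (j : 'I_3) : R * R :=
  ((j == 0%N :> nat)%:R, (j == 1%N :> nat)%:R).

Definition pd (R : realType) (j : 'I_3) (f : R * R -> R) : R * R -> R :=
  fun x => 'D_(dir R j) f x.

Definition pds (R : realType) (s : seq 'I_3) (f : R * R -> R) : R * R -> R :=
  foldr (@pd R) f s.

Definition Ck (R : realType) (k : nat) (f : R * R -> R) : Prop :=
  forall s : seq 'I_3, (size s <= k)%N ->
    continuous (pds s f) /\
    ((size s < k)%N -> forall j x, derivable (pds s f) x (dir R j)).

Definition laplacian (R : realType) (f : R * R -> R) (x : R * R) : R :=
  pd 0 (pd 0 f) x + pd 1 (pd 1 f) x.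

Definition symplectic_field (R : realType) (phi : R * R -> R) (x : R * R) :
    'rV[R]_3 :=
  \row_(i < 3) [:: - pd 1 phi x; pd 0 phi x; 0]`_i.

Definition symplectic_rep (R : realType) (v : R * R -> 'rV[R]_3)
    (phi : R * R -> R) : Prop :=
  Ck 1 phi /\ forall x, v x = symplectic_field phi x.

(* Twice the kinetic energy. *)
Definition energy (R : realType) (v : R * R -> 'rV[R]_3) : \bar R :=
  (\int[@plane_measure R]_x (\sum_(i < 3) (v x 0 i) ^+ 2)%:E)%E.

(* "Regular enough": the initial velocity is C^2, bounded together with its
   derivatives of order at most 2, and of finite energy.  The potential itself
   is not required to be bounded. *)
Definition regular_enough (R : realType) (phi0 : R * R -> R) : Prop :=
  [/\ Ck 3 phi0,
      (forall s : seq 'I_3, (1 <= size s <= 3)%N ->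
         exists C : R, forall x, `|pds s phi0 x| <= C)
    & (energy (symplectic_field phi0) < +oo)%E].

Section Solutions.
Context {R : realType}.
Implicit Types (u : R -> R * R -> 'rV[R]_3) (P : R -> R * R -> R).

Definition cpt u (i : 'I_3) (t : R) (x : R * R) : R := u t x 0 i.

Definition dt u (i : 'I_3) (t : R) (x : R * R) : R :=
  'D_1 (fun s => cpt u i s x) t.

Definition classical_velocity u : Prop :=
  forall i : 'I_3,
    {within [set z : R * (R * R) | 0 <= z.1],
       continuous (fun z : R * (R * R) => cpt u i z.1 z.2)} /\
    forall (t : R) (x : R * R), 0 < t ->
      [/\ derivable (fun s => cpt u i s x) t 1,
          forall j, derivable (cpt u i t) x (dir R j),
          forall j k, derivable (pd j (cpt u i t)) x (dir R k)
        & [/\ {for (t, x), continuous (fun z : R * (R * R) => dt u i z.1 z.2)},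
              forall j, {for (t, x), continuous
                (fun z : R * (R * R) => pd j (cpt u i z.1) z.2)}
            & forall j k, {for (t, x), continuous
                (fun z : R * (R * R) => pd k (pd j (cpt u i z.1)) z.2)}]].

Definition momentum_eq (nu : R) u P : Prop :=
  forall (t : R) (x : R * R) (i : 'I_3), 0 < t ->
    dt u i t x - nu * laplacian (cpt u i t) x
    + (\sum_(j < 3) cpt u j t x * pd j (cpt u i t) x)
    + pd i (P t) x = 0.

Definition divergence_free u : Prop :=
  forall (t : R) (x : R * R), 0 < t -> \sum_(j < 3) pd j (cpt u j t) x = 0.

(* Some condition at infinity is needed for uniqueness: if a(0) = 0, the pair
   u = a(t), P = - a'(t) . x solves the equations with zero initial datum. *)
Definition finite_energy_class u P : Prop :=
  forall T : R, exists C : R,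
    forall t : R, 0 <= t <= T ->
      [/\ (energy (u t) <= C%:E)%E,
          forall x i, `|cpt u i t x| <= C
        & 0 < t -> forall x, `|P t x| <= C].

Definition global_solution (nu : R) (u0 : R * R -> 'rV[R]_3) u : Prop :=
  (exists phi : R -> R * R -> R,
     forall t : R, 0 <= t -> symplectic_rep (u t) (phi t)) /\
  classical_velocity u /\
  (forall x, u 0 x = u0 x) /\
  divergence_free u /\
  exists P : R -> R * R -> R,
    [/\ forall t : R, 0 < t -> Ck 1 (P t),
        momentum_eq nu u P
      & finite_energy_class u P].

Definition heat_potential (nu : R) (phi0 : R * R -> R) (t : R) (x : R * R) : R :=
  (4 * pi * nu * t)^-1 *
  \int[@plane_measure R]_y
     (expR (- ((eucl y) ^+ 2 / (4 * nu * t))) * phi0 (x - y)).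

End Solutions.

(* Main.v *)
(* Existence: the heat flow psi(t) of a radial potential is radial, so that (u . grad) u for
   u = (- d_2 psi, d_1 psi) is the centripetal field - (psi_r^2 / r) x / r.  It is a gradient:
   the heat flow solves the equations with P(t, x) = int_0^|x| psi_r(t, s)^2 / s ds.  Near the
   origin psi_r(s)^2 / s is bounded by a multiple of s, and far away the integral is bounded by
   the energy, so P is bounded.

   Uniqueness: the squared difference of two solutions, weighted by the square of a cutoff,
   satisfies a Gronwall inequality because the heat flow has a bounded gradient.  As the
   difference of the pressures is only bounded, a cutoff at scale A would leave an error
   which does not tend to 0; the logarithmic cutoff max (1 - ln (1 + |x|^2) / M) 0 has a Dirichlet
   energy of order 1 / M in the plane, which lets the error vanish as M tends to infinity. *)

(* The two solutions compared are known very unequally, and this shapes the uniqueness proof. The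
   heat flow [u] has a bounded gradient, whereas of a competitor [v], apart from its being
   classical, only velocity, energy and pressure are bounded on bounded time intervals; its
   derivatives may be unbounded in space and as t tends to 0. The difference w of the velocities is
   therefore convected as (v . grad) w + (w . grad) u: the first term contributes a divergence
   because div v = 0, the second is absorbed by Gronwall. Energies are differentiated for t > 0
   only, and the initial time enters by continuity. For existence, the potential may be unbounded
   and its flow is never differentiated in time: the heat equation is used for the components d_j
   phi_0, bounded together with two derivatives, which costs three derivatives of phi_0. The
   convolution is an average of f (x - s z) against a fixed probability density in z, with s = sqrt
   (4 nu t); maximum principle, L^2 contraction, radial symmetry and initial value are properties of
   this average that include s = 0. *)
From HB Require Import structures.
Require Import Defs.
From mathcomp Require Import all_boot all_order all_algebra.
From mathcomp Require Import all_classical all_reals all_analysis.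
From mathcomp Require Import measurable_realfun ring lra.

Import Order.TTheory GRing.Theory Num.Theory.
Import numFieldNormedType.Exports.

Local Open Scope classical_set_scope.
Local Open Scope ring_scope.

(** * Measurability, changes of variables and Fubini on the plane *)

Section plane.
Context {R : realType}.
Implicit Types f : R * R -> R.
Local Notation mu := (@lebesgue_measure R).
Local Notation mu2 := (mu \x mu)%E.
Local Notation plane := (measurableTypeR R * measurableTypeR R)%type.

(** The sigma-algebra on the product is generated by measurable boxes, not by the topology. Second
    countability joins the two: an open set is the union of the boxes with rational centre and
    radius [1 / (n + 1)] that it contains. *)
Lemma open_measurable_plane (O : set (R * R)) :
  open O -> measurable (O : set plane).
Proof.
move=> oO.
pose box (q : rat * rat * nat) : set plane :=
  ball (ratr q.1.1 : R) (q.2.+1%:R^-1 : R) `*` ball (ratr q.1.2 : R) (q.2.+1%:R^-1 : R).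
(* Boxes that leave [O] are replaced by the empty set, so that the union runs over a whole countable
   type. *)
pose F q := if `[< box q `<=` O >] then box q else set0.
have -> : O = \bigcup_q F q.
  apply/seteqP; split=> [x Ox|x [q _]]; last first.
    by rewrite /F; case: asboolP => // h /h.
  have /nbhs_ballP[e /= e0 be] : nbhs x O by exact: open_nbhs_nbhs.
  (* Twice the radius is at most [e]: a point of the box is reached from [x] through the rational
     centre. *)
  pose n := Num.truncn (2 / e).
  have n0 : 0 < n.+1%:R^-1 :> R by rewrite invr_gt0 ltr0n.
  have ne : n.+1%:R^-1 + n.+1%:R^-1 <= e.
    have : 2 / e < n.+1%:R by rewrite truncnS_gt.
    rewrite ltr_pdivrMr// => h.
    rewrite -mulr2n -(mulr_natl _ 2) ler_pdivrMr ?ltr0n// mulrC; exact: ltW.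
  have [a [/= xa [p _ pa]]] : ball x.1 (n.+1%:R^-1) `&` (@ratr R @` setT) !=set0.
    by apply: dense_rat; [exists x.1; exact: ballxx|exact: ball_open].
  have [b [/= xb [q _ qb]]] : ball x.2 (n.+1%:R^-1) `&` (@ratr R @` setT) !=set0.
    by apply: dense_rat; [exists x.2; exact: ballxx|exact: ball_open].
  exists (p, q, n) => //; rewrite /F; case: asboolP => [_|].
    by split => /=; rewrite ?pa ?qb; exact: ball_sym.
  case=> y [/= y1 y2]; apply: be; split; apply: (le_ball ne).
    by apply: (ball_triangle xa); rewrite -pa.
  by apply: (ball_triangle xb); rewrite -qb.
apply: countable_bigcupT_measurable => [|q]; first exact: countableP.
rewrite /F; case: ifP => // _; apply: measurableX; exact: measurable_ball.
Qed.

Lemma continuous_measurable_plane f :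
  continuous f -> measurable_fun [set: plane] (f : plane -> R).
Proof.
move=> /continuousP cf; apply: (measurability _ (RGenOpens.measurableE R)).
move=> _ [_ [a [b ->] <-]]; rewrite setTI; apply: open_measurable_plane.
exact/cf/interval_open.
Qed.

Lemma ge0_integral_affine (g : R -> R) (a b : R) : 0 < a -> continuous g ->
  (forall x, 0 <= g x) ->
  (\int[mu]_x (g x)%:E = \int[mu]_x (a * g (a * x + b))%:E)%E.
Proof.
move=> a0 cg g0; pose F x := a * x + b.
have dF x : is_derive (x : R) (1 : R) F a.
  by apply: is_derive_eq; rewrite -[_ *: _]/(_ * _) mulr1 addr0.
have F'E : derive1 F = cst a by apply/funext => x; rewrite derive1E; apply: derive_val.
rewrite (@increasing_ge0_integration_by_substitutionT _ F)//.
- by apply: eq_integral => x _; rewrite F'E /= mulrC.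
- by move=> x y xy; rewrite /F ltrD2r ltr_pM2l.
- by rewrite F'E; exact: cst_continuous.
- by rewrite F'E; exact: is_cvg_cst.
- by rewrite F'E; exact: is_cvg_cst.
- apply/cvgrNyPle => A; near=> x.
  rewrite /F -lerBrDr mulrC -ler_pdivlMr//; near: x; exact: nbhs_ninfty_le.
- apply/cvgryPge => A; near=> x.
  rewrite /F -lerBlDr mulrC -ler_pdivrMr//; near: x; exact: nbhs_pinfty_ge.
Unshelve. all: end_near. Qed.

Lemma continuous_comp2 (T : topologicalType) f (u v : T -> R) (x : T) :
  {for (u x, v x), continuous f} -> {for x, continuous u} ->
  {for x, continuous v} -> {for x, continuous (fun x => f (u x, v x))}.
Proof.
move=> cf cu cv; apply: (@continuous_comp _ _ _ (fun x => (u x, v x)) f x _ cf).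
exact: (cvg_pair cu cv).
Qed.

Lemma measurable_EFin_plane f : continuous f ->
  measurable_fun [set: plane] (fun z : plane => (f z)%:E).
Proof. by move=> cf; apply/measurable_EFinP; exact: continuous_measurable_plane. Qed.

(** On each horizontal slice [g z.2] is a constant, so Tonelli reduces this to the line. A shift
    depending on the other coordinate covers translations, dilations and shears at once; rotations
    are later composed of shears. *)
Lemma ge0_integral_plane_affine1 f (a : R) (g : R -> R) : 0 < a ->
  continuous g -> continuous f -> (forall x, 0 <= f x) ->
  (\int[mu2]_z (f z)%:E = \int[mu2]_z (a * f (a * z.1 + g z.2, z.2))%:E)%E.
Proof.
move=> a0 cg cf f0.
have cF : continuous (fun z : R * R => a * f (a * z.1 + g z.2, z.2)).
  move=> z; apply: continuousM; first exact: cst_continuous.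
  apply: continuous_comp2; [exact: cf| |exact: cvg_snd].
  apply: continuousD; last by apply: continuous_comp; [exact: cvg_snd|exact: cg].
  by apply: continuousM; [exact: cst_continuous|exact: cvg_fst].
rewrite (fubini_tonelli2 _ (measurable_EFin_plane _ cf))//=.
rewrite [RHS](fubini_tonelli2 _ (measurable_EFin_plane _ cF))//=; last first.
  by move=> x; rewrite lee_fin mulr_ge0// ltW.
apply: eq_integral => y _; rewrite /fubini_G /=.
rewrite (ge0_integral_affine _ _ (g y) a0)// => x.
by apply: continuous_comp2; [exact: cf|exact: cvg_id|exact: cst_continuous].
Qed.

Lemma ge0_integral_plane_affine2 f (a : R) (g : R -> R) : 0 < a ->
  continuous g -> continuous f -> (forall x, 0 <= f x) ->
  (\int[mu2]_z (f z)%:E = \int[mu2]_z (a * f (z.1, a * z.2 + g z.1))%:E)%E.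
Proof.
move=> a0 cg cf f0.
have cF : continuous (fun z : R * R => a * f (z.1, a * z.2 + g z.1)).
  move=> z; apply: continuousM; first exact: cst_continuous.
  apply: continuous_comp2; [exact: cf|exact: cvg_fst|].
  apply: continuousD; last by apply: continuous_comp; [exact: cvg_fst|exact: cg].
  by apply: continuousM; [exact: cst_continuous|exact: cvg_snd].
rewrite (fubini_tonelli1 _ (measurable_EFin_plane _ cf))//=.
rewrite [RHS](fubini_tonelli1 _ (measurable_EFin_plane _ cF))//=; last first.
  by move=> x; rewrite lee_fin mulr_ge0// ltW.
apply: eq_integral => y _; rewrite /fubini_F /=.
rewrite (ge0_integral_affine _ _ (g y) a0)// => x.
by apply: continuous_comp2; [exact: cf|exact: cst_continuous|exact: cvg_id].
Qed.

Lemma continuous_maxr0 (T : topologicalType) (h : T -> R) :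
  continuous h -> continuous (fun x => Num.max (h x) 0).
Proof.
by move=> ch x; apply: (@continuous_max _ _ h (cst 0)); [exact: ch|exact: cst_continuous].
Qed.

Lemma integral_maxr (h : R * R -> R) : (\int[mu2]_z (h z)%:E =
  \int[mu2]_z (Num.max (h z) 0)%:E - \int[mu2]_z (Num.max (- h z) 0)%:E)%E.
Proof.
rewrite integralE; congr (_ - _)%E; apply: eq_integral => z _.
  by rewrite funeposE EFin_max.
by rewrite funenegE EFin_max EFinN.
Qed.

(** Positive and negative parts are transformed separately. Both sides are the same difference of
    extended reals, so integrability never has to be discussed. *)
Lemma integral_plane_affine1 f (a : R) (g : R -> R) : 0 < a ->
  continuous g -> continuous f ->
  (\int[mu2]_z (f z)%:E = \int[mu2]_z (a * f (a * z.1 + g z.2, z.2))%:E)%E.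
Proof.
move=> a0 cg cf; rewrite integral_maxr [RHS]integral_maxr; congr (_ - _)%E.
- rewrite (ge0_integral_plane_affine1 _ a g)//=; last 2 first.
  + exact: continuous_maxr0.
  + by move=> x; rewrite le_max lexx orbT.
  by apply: eq_integral => z _; rewrite maxr_pMr ?ltW// mulr0.
- rewrite (ge0_integral_plane_affine1 _ a g)//=; last 2 first.
  + by apply: continuous_maxr0 => x; apply: continuousN; exact: cf.
  + by move=> x; rewrite le_max lexx orbT.
  by apply: eq_integral => z _; rewrite maxr_pMr ?ltW// mulr0 mulrN.
Qed.

Lemma integral_plane_affine2 f (a : R) (g : R -> R) : 0 < a ->
  continuous g -> continuous f ->
  (\int[mu2]_z (f z)%:E = \int[mu2]_z (a * f (z.1, a * z.2 + g z.1))%:E)%E.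
Proof.
move=> a0 cg cf; rewrite integral_maxr [RHS]integral_maxr; congr (_ - _)%E.
- rewrite (ge0_integral_plane_affine2 _ a g)//=; last 2 first.
  + exact: continuous_maxr0.
  + by move=> x; rewrite le_max lexx orbT.
  by apply: eq_integral => z _; rewrite maxr_pMr ?ltW// mulr0.
- rewrite (ge0_integral_plane_affine2 _ a g)//=; last 2 first.
  + by apply: continuous_maxr0 => x; apply: continuousN; exact: cf.
  + by move=> x; rewrite le_max lexx orbT.
  by apply: eq_integral => z _; rewrite maxr_pMr ?ltW// mulr0 mulrN.
Qed.

Definition rect (a b c d : R) : set plane := `[a, b] `*` `[c, d].

Lemma measurable_rect a b c d : measurable (rect a b c d).
Proof. exact: measurableX. Qed.

Lemma rect_lty a b c d : (mu2 (rect a b c d) < +oo)%E.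
Proof.
rewrite /rect product_measure1E//= lte_mul_pinfty//.
- by rewrite lebesgue_measure_itv/=; case: ifP => // _; rewrite -EFinB.
- by rewrite lebesgue_measure_itv/=; case: ifP => // _; rewrite -EFinB ltry.
Qed.

Lemma compact_rect a b c d : compact (rect a b c d : set (R * R)).
Proof. by apply: compact_setX; exact: segment_compact. Qed.

Lemma integrable_rect f a b c d : continuous f ->
  mu2.-integrable (rect a b c d) (EFin \o f).
Proof.
move=> cf; apply: measurable_bounded_integrable.
- exact: measurable_rect.
- exact: rect_lty.
- by apply: measurable_funTS; exact: continuous_measurable_plane.
- have : compact (f @` rect a b c d).
    apply: continuous_compact; last exact: compact_rect.
    exact: continuous_subspaceT.
  move=> /(@compact_bounded _ R^o)[M [_ mrt]].
  by exists M; split; rewrite ?num_real // => ? ? ? ?; exact: mrt.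
Qed.

Lemma integral_rect21 f a b c d : continuous f ->
  (\int[mu2]_(z in rect a b c d) (f z)%:E =
   \int[mu]_(y in `[c, d]) \int[mu]_(x in `[a, b]) (f (x, y))%:E)%E.
Proof.
move=> cf; have mr := measurable_rect a b c d.
have /(integrable_mkcond _ mr) fi := integrable_rect f a b c d cf.
rewrite integral_mkcond -(integral21_prod_meas1 fi).
rewrite [RHS]integral_mkcond/=; apply: eq_integral => y _.
rewrite patchE; case: ifPn => /=.
  rewrite inE/= => yI; rewrite [RHS]integral_mkcond; apply: eq_integral => x _.
  rewrite !patchE; congr (if _ then _ else _).
  by apply/idP/idP; rewrite !inE /rect /=; [case|split].
rewrite notin_setE/= => yI; apply: integral0_eq => x _.
by rewrite patchE; case: ifPn => //; rewrite inE /rect/= => -[].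
Qed.

Lemma integral_rect12 f a b c d : continuous f ->
  (\int[mu2]_(z in rect a b c d) (f z)%:E =
   \int[mu]_(x in `[a, b]) \int[mu]_(y in `[c, d]) (f (x, y))%:E)%E.
Proof.
move=> cf; have mr := measurable_rect a b c d.
have /(integrable_mkcond _ mr) fi := integrable_rect f a b c d cf.
rewrite integral_mkcond -(integral12_prod_meas1 fi).
rewrite [RHS]integral_mkcond/=; apply: eq_integral => x _.
rewrite patchE; case: ifPn => /=.
  rewrite inE/= => yI; rewrite [RHS]integral_mkcond; apply: eq_integral => y _.
  rewrite !patchE; congr (if _ then _ else _).
  by apply/idP/idP; rewrite !inE /rect /=; [case|split].
rewrite notin_setE/= => yI; apply: integral0_eq => y _.
by rewrite patchE; case: ifPn => //; rewrite inE /rect/= => -[].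
Qed.

End plane.

(** * Partial derivatives as derivatives of slices; mean values, Schwarz, chain rule along a line *)

Section partials.
Context {R : realType}.
Implicit Types f : R * R -> R.
Local Notation mu := (@lebesgue_measure R).
Local Notation mu2 := (mu \x mu)%E.

Lemma is_derive_derivable (V W : normedModType R) (f : V -> W) x v d :
  is_derive x v f d -> derivable f x v.
Proof. by case. Qed.

Lemma is_derive_val (V W : normedModType R) (f : V -> W) x v d :
  is_derive x v f d -> 'D_v f x = d.
Proof. by case. Qed.

Lemma ord3_ind (P : 'I_3 -> Prop) : P 0 -> P 1 -> P 2 -> forall j, P j.
Proof.
move=> P0 P1 P2 [[|[|[|//]]] i]; [have -> : Ordinal i = 0|have -> : Ordinal i = 1|
  have -> : Ordinal i = 2] => //; exact: val_inj.
Qed.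

Lemma dir2 : dir R 2 = 0. Proof. by []. Qed.

Lemma pd2 f x : pd 2 f x = 0. Proof. by rewrite /pd dir2 derive0. Qed.

(** The two difference quotients agree as functions of [h], so existence and value of the derivative
    transfer together, in both directions. *)
Lemma quotient_slice1 f x y :
  (fun h : R => h^-1 *: (f (h *: dir R 0 + (x, y)) - f (x, y))) =
  (fun h : R => h^-1 *: ((fun s => f (s, y)) (h *: (1 : R) + x) - f (x, y))).
Proof.
apply/funext => h; congr (_ *: (f _ - _)).
by rewrite /dir/=; congr pair => /=; rewrite scaler0 add0r.
Qed.

Lemma quotient_slice2 f x y :
  (fun h : R => h^-1 *: (f (h *: dir R 1 + (x, y)) - f (x, y))) =
  (fun h : R => h^-1 *: ((fun s => f (x, s)) (h *: (1 : R) + y) - f (x, y))).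
Proof.
apply/funext => h; congr (_ *: (f _ - _)).
by rewrite /dir/=; congr pair => /=; rewrite scaler0 add0r.
Qed.

Lemma is_derive_slice1 f x y : derivable f (x, y) (dir R 0) ->
  is_derive x (1 : R) (fun s => f (s, y)) (pd 0 f (x, y)).
Proof.
move=> df; split; first by rewrite /derivable -quotient_slice1.
by rewrite /derive -quotient_slice1.
Qed.

Lemma is_derive_slice2 f x y : derivable f (x, y) (dir R 1) ->
  is_derive y (1 : R) (fun s => f (x, s)) (pd 1 f (x, y)).
Proof.
move=> df; split; first by rewrite /derivable -quotient_slice2.
by rewrite /derive -quotient_slice2.
Qed.

Arguments is_derive_slice1 {f x y}.
Arguments is_derive_slice2 {f x y}.
Lemma is_derive_of_slice1 f x y d : is_derive x (1 : R) (fun s => f (s, y)) d ->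
  is_derive (x, y) (dir R 0) f d.
Proof.
move=> -[df fd]; split; first by rewrite /derivable quotient_slice1.
by rewrite /derive quotient_slice1.
Qed.

Lemma is_derive_of_slice2 f x y d : is_derive y (1 : R) (fun s => f (x, s)) d ->
  is_derive (x, y) (dir R 1) f d.
Proof.
move=> -[df fd]; split; first by rewrite /derivable quotient_slice2.
by rewrite /derive quotient_slice2.
Qed.

Lemma is_derive_pd f (j : 'I_3) x : derivable f x (dir R j) ->
  is_derive x (dir R j) f (pd j f x).
Proof. exact: derivableP. Qed.

Lemma is_derive_continuous (g : R -> R) (x d : R) :
  is_derive x (1 : R) g d -> {for x, continuous g}.
Proof. by move=> [dg _]; exact/differentiable_continuous/derivable1_diffP. Qed.

(** The increment may have either sign and the intermediate point is located by its distance to [a],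
    the form that epsilon-delta estimates consume. *)
Lemma mean_value (g g' : R -> R) : (forall x, is_derive x (1 : R) g (g' x)) ->
  forall a h, exists2 c : R, `|c - a| <= `|h| & g (a + h) - g a = g' c * h.
Proof.
move=> dg a h; have cg : continuous g by move=> x; exact: is_derive_continuous.
have [h0|h0] := leP 0 h.
  have ah : a <= a + h by rewrite lerDl.
  have [c] := MVT_segment ah (fun x _ => dg x) (continuous_subspaceT cg).
  rewrite in_itv/= => /andP[ac cb] ->; exists c; last by rewrite addrAC subrr add0r.
  by rewrite !ger0_norm// ?subr_ge0// lerBlDl.
have ah : a + h <= a by rewrite gerDl ltW.
have [c] := MVT_segment ah (fun x _ => dg x) (continuous_subspaceT cg).
rewrite in_itv/= => /andP[ac cb] E; exists c.
  by rewrite ler0_norm ?subr_le0// ltr0_norm// opprB lerBlDr addrC -lerBlDr opprK.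
by rewrite -opprB E opprD addrA subrr add0r -mulrN opprK.
Qed.

Lemma mean_value1 f a h y : (forall x : R, derivable f (x, y) (dir R 0)) ->
  exists2 c : R, `|c - a| <= `|h| & f (a + h, y) - f (a, y) = pd 0 f (c, y) * h.
Proof.
move=> df; apply: (mean_value (fun s => f (s, y)) (fun s => pd 0 f (s, y))) => x.
exact: is_derive_slice1.
Qed.

Lemma mean_value2 f x a h : (forall y : R, derivable f (x, y) (dir R 1)) ->
  exists2 c : R, `|c - a| <= `|h| & f (x, a + h) - f (x, a) = pd 1 f (x, c) * h.
Proof.
move=> df; apply: (mean_value (fun s => f (x, s)) (fun s => pd 1 f (x, s))) => y.
exact: is_derive_slice2.
Qed.

Lemma continuous_at_ball f (x : R * R) : {for x, continuous f} ->
  forall e : R, 0 < e -> exists2 d : R, 0 < d &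
    forall a b, `|a - x.1| < d -> `|b - x.2| < d -> `|f (a, b) - f x| < e.
Proof.
move=> /cvgrPdist_lt cf e e0; have /= /nbhs_ballP[d /= d0 dP] := cf e e0.
exists d => // a b ax bx; rewrite distrC; apply: dP; split => /=.
  by rewrite /ball/= distrC.
by rewrite /ball/= distrC.
Qed.

Lemma dist_half (x a b e : R) :
  `|x - a| < e / 2 -> `|x - b| < e / 2 -> `|b - a| <= e.
Proof.
move=> xa xb; have -> : b - a = (x - a) - (x - b) by ring.
by rewrite (le_trans (ler_normB _ _))// [e]splitr lerD// ltW.
Qed.

(** The second difference of [f] over a square of side [h] is, by two mean value theorems in either
    order, [h * h] times each mixed derivative at some point of that square. Both mixed derivatives
    are close to their values at the corner, hence these are within any [e] of each other. *)
Lemma schwarz f : (forall x, derivable f x (dir R 0)) ->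
  (forall x, derivable f x (dir R 1)) ->
  (forall x, derivable (pd 0 f) x (dir R 1)) ->
  (forall x, derivable (pd 1 f) x (dir R 0)) ->
  continuous (pd 1 (pd 0 f)) -> continuous (pd 0 (pd 1 f)) ->
  pd 0 (pd 1 f) = pd 1 (pd 0 f).
Proof.
move=> d0 d1 d01 d10 c1 c2; apply/funext => -[a b].
apply/eqP; rewrite -subr_eq0 -normr_le0; apply/ler_addgt0Pl => /= e e0.
rewrite addr0; have e20 : 0 < e / 2 by rewrite divr_gt0.
have [r1 r10 H1] := continuous_at_ball _ (a, b) (c1 (a, b)) _ e20.
have [r2 r20 H2] := continuous_at_ball _ (a, b) (c2 (a, b)) _ e20.
pose h := Num.min r1 r2 / 2.
have h0 : 0 < h by rewrite divr_gt0// lt_min r10 r20.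
have hr : h < Num.min r1 r2 by rewrite ltr_pdivrMr// mulr_natr mulr2n ltrDl lt_min r10 r20.
have /andP[hr1 hr2] : (h < r1) && (h < r2) by rewrite -lt_min.
have nh : `|h| = h by rewrite gtr0_norm.
pose g (z : R * R) := f (z.1, z.2 + h) - f z.
have dg1 x y : is_derive (x, y) (dir R 0) g (pd 0 f (x, y + h) - pd 0 f (x, y)).
  apply: is_derive_of_slice1.
  exact: (is_deriveB (is_derive_slice1 (d0 (x, y + h))) (is_derive_slice1 (d0 (x, y)))).
have [c1' k1 E1] := mean_value1 g a h b (fun x => is_derive_derivable _ _ _ _ _ _ (dg1 x b)).
rewrite /pd (is_derive_val _ _ _ _ _ _ (dg1 _ _)) in E1.
have [e1 l1 F1] := mean_value2 (pd 0 f) c1' b h (fun y => d01 (c1', y)).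
rewrite {}F1 /g/= in E1.
pose g2 (z : R * R) := f (z.1 + h, z.2) - f z.
have dg2 x y : is_derive (x, y) (dir R 1) g2 (pd 1 f (x + h, y) - pd 1 f (x, y)).
  apply: is_derive_of_slice2.
  exact: (is_deriveB (is_derive_slice2 (d1 (x + h, y))) (is_derive_slice2 (d1 (x, y)))).
have [c2' k2 E2] := mean_value2 g2 a b h (fun x => is_derive_derivable _ _ _ _ _ _ (dg2 a x)).
rewrite /pd (is_derive_val _ _ _ _ _ _ (dg2 _ _)) in E2.
have [e2 l2 F2] := mean_value1 (pd 1 f) a h c2' (fun y => d10 (y, c2')).
rewrite {}F2 /g2/= in E2.
have EE : pd 0 (pd 1 f) (e2, c2') = pd 1 (pd 0 f) (c1', e1).
  apply: (@mulIf _ (h * h)); first by rewrite mulf_neq0// gt_eqF.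
  rewrite [LHS]mulrA [RHS]mulrA; apply: (etrans (esym E2)); apply: etrans E1; ring.
have A1 := H1 c1' e1 (le_lt_trans k1 _) (le_lt_trans l1 _).
have A2 := H2 e2 c2' (le_lt_trans l2 _) (le_lt_trans k2 _).
rewrite nh in A1 A2; move: (A1 hr1 hr1) (A2 hr2 hr2); rewrite EE => {}A1 {}A2.
exact: (dist_half _ _ _ _ A1 A2).
Qed.

(** The increment splits into a vertical move on the fixed line through [a], where derivability
    suffices, and a horizontal move at a varying height, where the mean value theorem and the
    continuity of [pd 0 f] apply. Only one partial derivative has to be continuous. *)
Lemma derive_line f (x v : R * R) t :
  (forall x, derivable f x (dir R 0)) -> (forall x, derivable f x (dir R 1)) ->
  continuous (pd 0 f) ->
  is_derive t (1 : R) (fun s => f (x.1 + s * v.1, x.2 + s * v.2))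
    (v.1 * pd 0 f (x.1 + t * v.1, x.2 + t * v.2) +
     v.2 * pd 1 f (x.1 + t * v.1, x.2 + t * v.2)).
Proof.
move=> d0 d1 c0; set a := x.1 + t * v.1; set b := x.2 + t * v.2.
have D2 : is_derive t (1 : R) (fun s => f (a, x.2 + s * v.2)) (v.2 * pd 1 f (a, b)).
  have db : is_derive t (1 : R) (fun s => x.2 + s * v.2) v.2.
    apply: is_derive_eq; rewrite scaler0 !add0r.
    by rewrite -[_ *: _]/(_ * _) ?mulr1 ?mul1r.
  have dfb : is_derive (x.2 + t * v.2) (1 : R) (fun s => f (a, s)) (pd 1 f (a, b)).
    exact: is_derive_slice2.
  rewrite mulrC.
  exact: (@is_derive1_comp _ (fun s => f (a, s)) (fun s => x.2 + s * v.2) t _ _ dfb db).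
have D1 : is_derive t (1 : R)
    (fun s => f (x.1 + s * v.1, x.2 + s * v.2) - f (a, x.2 + s * v.2))
    (v.1 * pd 0 f (a, b)).
  suff L : h^-1 *: ((f (x.1 + (h *: 1 + t) * v.1, x.2 + (h *: 1 + t) * v.2)
        - f (a, x.2 + (h *: 1 + t) * v.2)) -
      (f (x.1 + t * v.1, x.2 + t * v.2) - f (a, x.2 + t * v.2)))
      @[h --> (0 : R)^'] --> v.1 * pd 0 f (a, b).
    by split; [apply/cvg_ex; eexists; exact: L|exact/cvg_lim].
  apply/cvgrPdist_le => e e0.
  (* The [+ 1] here and below covers a vanishing component of [v]. *)
  have e'0 : 0 < e / (`|v.1| + 1) by rewrite divr_gt0// ltr_pwDr.
  have [r r0 H] := continuous_at_ball _ (a, b) (c0 (a, b)) _ e'0.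
  near=> h.
  rewrite -/a -/b subrr subr0 -[h *: 1]/(h * 1) mulr1.
  have -> : x.1 + (h + t) * v.1 = a + h * v.1 by rewrite /a; ring.
  have -> : x.2 + (h + t) * v.2 = b + h * v.2 by rewrite /b; ring.
  have [c ca ->] := mean_value1 f a (h * v.1) (b + h * v.2) (fun x => d0 (x, _)).
  have h0 : h != 0 by near: h; exact: nbhs_dnbhs_neq.
  rewrite -[_ *: _]/(_ * _).
  rewrite (_ : h^-1 * _ = pd 0 f (c, b + h * v.2) * v.1); last by field.
  rewrite mulrC -mulrBl normrM distrC.
  have hb (w : R) : `|h| < r / (`|w| + 1) -> `|h * w| < r.
    rewrite ltr_pdivlMr ?ltr_pwDr// => /le_lt_trans; apply.
    by rewrite normrM ler_wpM2l// lerDl.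
  have /ltW : `|pd 0 f (c, b + h * v.2) - pd 0 f (a, b)| < e / (`|v.1| + 1).
    apply: H => /=.
      apply: (le_lt_trans ca); apply: hb; near: h.
      by apply: dnbhs0_lt; rewrite divr_gt0// ltr_pwDr.
    rewrite addrAC subrr add0r; apply: hb; near: h.
    by apply: dnbhs0_lt; rewrite divr_gt0// ltr_pwDr.
  rewrite ler_pdivlMr ?ltr_pwDr//; apply: le_trans.
  by rewrite ler_wpM2l// lerDl.
have := is_deriveD D1 D2; congr is_derive.
by apply/funext => s; rewrite /= subrK.
Unshelve. all: end_near. Qed.

Lemma FTC2_continuous (F f : R -> R) a b : a <= b ->
  (forall x, is_derive x (1 : R) F (f x)) -> continuous f ->
  (\int[mu]_(x in `[a, b]) (f x)%:E = (F b - F a)%:E)%E.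
Proof.
rewrite le_eqVlt => /predU1P[<- _ _|ab dF cf].
  by rewrite subrr set_itv1 integral_set1.
have cF : continuous F by move=> x; exact: is_derive_continuous.
rewrite EFinB; apply: continuous_FTC2 => //.
- exact: continuous_subspaceT.
- split; first by move=> x _; exact: ex_derive.
  + by apply: cvg_at_right_filter; exact: cF.
  + by apply: cvg_at_left_filter; exact: cF.
- by move=> x _; rewrite derive1E; exact: derive_val.
Qed.

Lemma FTC2_slice1 f a b y : a <= b -> (forall x, derivable f x (dir R 0)) ->
  continuous (pd 0 f) ->
  (\int[mu]_(x in `[a, b]) (pd 0 f (x, y))%:E = (f (b, y) - f (a, y))%:E)%E.
Proof.
move=> ab df cf; apply: (FTC2_continuous (fun x => f (x, y))) => // x.
  exact: is_derive_slice1.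
by apply: continuous_comp2; [exact: cf|exact: cvg_id|exact: cst_continuous].
Qed.

Lemma FTC2_slice2 f a b x : a <= b -> (forall x, derivable f x (dir R 1)) ->
  continuous (pd 1 f) ->
  (\int[mu]_(y in `[a, b]) (pd 1 f (x, y))%:E = (f (x, b) - f (x, a))%:E)%E.
Proof.
move=> ab df cf; apply: (FTC2_continuous (fun y => f (x, y))) => // y.
  exact: is_derive_slice2.
by apply: continuous_comp2; [exact: cf|exact: cst_continuous|exact: cvg_id].
Qed.

End partials.

(** * Integrals depending on a parameter, and Gaussian integrals *)

Section parametric.
Context {R : realType}.
Implicit Types f : R * R -> R.
Local Notation mu := (@lebesgue_measure R).
Local Notation mu2 := (mu \x mu)%E.
Local Notation plane := (measurableTypeR R * measurableTypeR R)%type.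

Lemma along_quotient f (j : 'I_3) (x : R * R) (h : R) :
  (fun k : R => k^-1 *: (f (k *: dir R j + (x.1 + h * (dir R j).1, x.2 + h * (dir R j).2))
     - f (x.1 + h * (dir R j).1, x.2 + h * (dir R j).2))) =
  (fun k : R => k^-1 *: ((fun s => f (x.1 + s * (dir R j).1, x.2 + s * (dir R j).2))
     (k *: (1 : R) + h) - f (x.1 + h * (dir R j).1, x.2 + h * (dir R j).2))).
Proof.
apply/funext => k; congr (_ *: (f _ - _)).
rewrite -[k *: 1]/(k * 1) mulr1; case: (dir R j) => a b /=.
by congr pair => /=; rewrite -[_ *: _]/(_ * _); ring.
Qed.

Lemma is_derive_along f (j : 'I_3) (x : R * R) (h : R) :
  derivable f (x.1 + h * (dir R j).1, x.2 + h * (dir R j).2) (dir R j) ->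
  is_derive h (1 : R) (fun s => f (x.1 + s * (dir R j).1, x.2 + s * (dir R j).2))
    (pd j f (x.1 + h * (dir R j).1, x.2 + h * (dir R j).2)).
Proof.
move=> df; split; first by rewrite /derivable -along_quotient.
by rewrite /derive -along_quotient.
Qed.

(** Reduces a directional derivative to one real variable for all [j] at once, the zero direction
    included; the slice lemmas need one version per axis. *)
Lemma is_derive_of_along f (j : 'I_3) (x : R * R) (d : R) :
  is_derive (0 : R) (1 : R) (fun s => f (x.1 + s * (dir R j).1, x.2 + s * (dir R j).2)) d ->
  is_derive x (dir R j) f d.
Proof.
set g := fun s : R => _.
have E : (fun k : R => k^-1 *: (f (k *: dir R j + x) - f x)) =
    (fun k : R => k^-1 *: (g (k *: (1 : R) + 0) - g 0)).
  apply/funext => k; rewrite /g addr0 -[k *: 1]/(k * 1) mulr1 !mul0r !addr0.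
  rewrite -surjective_pairing; congr (_ *: (f _ - _)).
  by rewrite addrC.
move=> -[df fd]; split; first by rewrite /derivable E.
by rewrite /derive E.
Qed.

Lemma is_derive_Rintegral (F F' : R -> R * R -> R) (G : R * R -> R)
    (B : set plane) (a u v : R) : measurable B -> u < a < v ->
  (forall h, u < h < v -> mu2.-integrable B (EFin \o F h)) ->
  (forall h z, u < h < v -> B z -> is_derive h (1 : R) (F ^~ z) (F' h z)) ->
  (forall z, 0 <= G z) -> mu2.-integrable B (EFin \o G) ->
  (forall h z, u < h < v -> B z -> `|F' h z| <= G z) ->
  is_derive a (1 : R) (fun h => \int[mu2]_(z in B) F h z)
    (\int[mu2]_(z in B) F' a z).
Proof.
move=> mB uav iF dF G0 iG FG.
have Ia : `]u, v[%classic a by rewrite /= in_itv.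
have iF' x : `]u, v[%classic x -> mu2.-integrable B (EFin \o F x).
  by rewrite /= in_itv/=; exact: iF.
have dF' x y : `]u, v[%classic x -> B y -> derivable (F ^~ y) x 1.
  by rewrite /= in_itv/= => xI By; exact: is_derive_derivable (dF _ _ xI By).
have FG' x y : `]u, v[%classic x -> B y -> `|partial1of2 F x y| <= G y.
  rewrite /= in_itv/= => xI By; rewrite partial1of2E (is_derive_val _ _ _ _ _ _ (dF _ _ xI By)).
  exact: FG.
split; first exact: (derivable_under_integral mB Ia iF' dF' G0 iG FG').
rewrite -derive1E (differentiation_under_integral mB Ia iF' dF' G0 iG FG').
apply: eq_Rintegral => z; rewrite inE => Bz.
by rewrite partial1of2E (is_derive_val _ _ _ _ _ _ (dF _ _ uav Bz)).
Qed.

(** Dominated convergence speaks of sequences. If continuity failed for some [e], points at distance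
    less than [1 / (n + 1)] from [x] would keep the integrals [e] apart, against dominated
    convergence along them. *)
Lemma continuous_Rintegral (T : normedModType R) (F : T -> R * R -> R)
    (G : R * R -> R) (B : set plane) (x : T) (r : R) : measurable B -> 0 < r ->
  (forall p, measurable_fun B (F p : plane -> R)) ->
  (forall z, B z -> {for x, continuous (F ^~ z)}) ->
  mu2.-integrable B (EFin \o G) ->
  (forall p z, ball x r p -> B z -> `|F p z| <= G z) ->
  {for x, continuous (fun p => \int[mu2]_(z in B) F p z)}.
Proof.
move=> mB r0 mF cF iG FG.
apply/cvgrPdist_lt => /= e e0; apply: contrapT => H.
have {H} /choice[p pP] (n : nat) : exists p, ball x (Num.min r n.+1%:R^-1) p /\
    e <= `|\int[mu2]_(z in B) F x z - \int[mu2]_(z in B) F p z|.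
  apply: contrapT => Hn; apply: H; apply/nbhs_ballP.
  exists (Num.min r n.+1%:R^-1) => /=; first by rewrite lt_min r0 invr_gt0 ltr0n.
  move=> p xp /=; rewrite ltNge; apply/negP => ep; apply: Hn; by exists p.
have px : p n @[n --> \oo] --> x.
  apply/cvgrPdist_lt => /= d d0; near=> n.
  have [+ _] := pP n; rewrite -ball_normE/= lt_min => /andP[_ /lt_trans]; apply.
  by near: n; exact: near_infty_natSinv_lt (PosNum d0).
have iFx q : ball x r q -> mu2.-integrable B (EFin \o F q).
  move=> xq; apply: (le_integrable mB _ _ iG).
    by apply/measurable_EFinP; exact: mF.
  by move=> z Bz /=; rewrite lee_fin (le_trans (FG _ _ xq Bz))// ler_norm.
have xpn n : ball x r (p n).
  by have [+ _] := pP n; apply: le_ball; rewrite ge_min lexx.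
have [] := @dominated_convergence _ _ _ mu2 B mB (fun n z => (F (p n) z)%:E)
  (fun z => (F x z)%:E) (EFin \o G).
- by move=> n; apply/measurable_EFinP; exact: mF.
- by apply/measurable_EFinP; exact: mF.
- apply: aeW => z Bz; apply: cvg_EFin; first exact: nearW.
  exact: (@cvg_comp _ _ _ p (F ^~ z) _ (nbhs x) _ px (cF z Bz)).
- exact: iG.
- by apply: aeW => z n Bz; rewrite lee_fin; exact: FG.
move=> _ _ L.
have {L} : (\int[mu2]_(z in B) F (p n) z) @[n --> \oo] --> \int[mu2]_(z in B) F x z.
  apply: fine_cvg; rewrite fineK//.
  by apply: integrable_fin_num => //; exact: iFx (ballxx _ r0).
move/cvgrPdist_lt => /(_ e e0)[N _ /(_ N (leqnn N))] /=.
by rewrite ltNge; case: (pP N) => _ ->.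
Unshelve. all: end_near. Qed.

Definition gaussian (c : R) (z : R * R) : R := expR (- (c * (z.1 ^+ 2 + z.2 ^+ 2))).

Lemma continuous_gaussian c : continuous (gaussian c).
Proof.
move=> z; apply: continuous_comp; last exact: continuous_expR.
apply: continuousN; apply: continuousM; first exact: cst_continuous.
apply: continuousD; apply: continuousM; first exact: cvg_fst.
- exact: cvg_fst.
- exact: cvg_snd.
- exact: cvg_snd.
Qed.

Lemma gaussian_ge0 c z : 0 <= gaussian c z. Proof. exact: expR_ge0. Qed.

Lemma integral_gauss (c : R) : 0 < c ->
  (\int[mu]_x (expR (- (c * x ^+ 2)))%:E = (Num.sqrt (pi / c))%:E)%E.
Proof.
move=> c0; have sc0 : 0 < Num.sqrt c by rewrite sqrtr_gt0.
have := ge0_integral_affine (@gauss_fun R) (Num.sqrt c) 0 sc0.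
rewrite integralT_gauss => /(_ (@continuous_gauss_fun R) (@gauss_fun_ge0 R)).
under eq_integral do rewrite EFinM addr0.
rewrite ge0_integralZl_EFin//; last 2 first.
- by move=> x _; rewrite lee_fin gauss_fun_ge0.
- apply/measurable_EFinP; apply: continuous_measurable_fun => x.
  apply: continuous_comp; last exact: continuous_gauss_fun.
  by apply: continuousM; [exact: cst_continuous|exact: cvg_id].
under eq_integral do rewrite /gauss_fun exprMn sqr_sqrtr ?ltW//.
(* Finiteness is not known beforehand: an infinite value would contradict the scaling identity,
   whose other side is the finite Gauss integral. *)
move: (\int[mu]_x _)%E => -[r| |].
- rewrite -EFinM => -[E]; congr EFin.
  rewrite sqrtrM ?ltW ?pi_gt0// E sqrtrV ?ltW//.
  by rewrite mulrAC divff ?mul1r// gt_eqF.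
- by rewrite gt0_muley// lte_fin.
- by rewrite gt0_muleNy// lte_fin.
Qed.

Lemma integral_gaussian (c : R) : 0 < c ->
  (\int[mu2]_z (gaussian c z)%:E = (pi / c)%:E)%E.
Proof.
move=> c0.
rewrite (fubini_tonelli1 _ (measurable_EFin_plane _ (continuous_gaussian c)))//=; last first.
  by move=> x; rewrite lee_fin gaussian_ge0.
have m1 : measurable_fun setT (fun x : measurableTypeR R => (expR (- (c * x ^+ 2)))%:E).
  apply/measurable_EFinP; apply: continuous_measurable_fun => x.
  apply: continuous_comp; last exact: continuous_expR.
  apply: continuousN; apply: continuousM; first exact: cst_continuous.
  by apply: continuousM; exact: cvg_id.
under eq_integral => x _.
  rewrite /fubini_F /=.
  under eq_integral do rewrite /gaussian/= mulrDr opprD expRD EFinM.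
  rewrite ge0_integralZl_EFin ?expR_ge0//.
  rewrite integral_gauss// muleC.
  over.
rewrite ge0_integralZl_EFin ?sqrtr_ge0//.
by rewrite integral_gauss// -EFinM -expr2 sqr_sqrtr// divr_ge0 ?ltW ?pi_gt0.
Qed.

Lemma integrable_gaussian c : 0 < c -> mu2.-integrable setT (EFin \o gaussian c).
Proof.
move=> c0; apply/integrableP; split.
  exact: (measurable_EFin_plane _ (continuous_gaussian c)).
under eq_integral do rewrite /= ger0_norm ?gaussian_ge0//.
by rewrite integral_gaussian// ltry.
Qed.

Lemma integrable_gaussian_dom f c C : 0 < c -> continuous f ->
  (forall z, `|f z| <= C * gaussian c z) -> mu2.-integrable setT (EFin \o f).
Proof.
move=> c0 cf fC.
have iG : mu2.-integrable setT (fun z => (C%:E * (gaussian c z)%:E)%E).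
  by apply: integrableZl => //; exact: integrable_gaussian.
apply: (le_integrable _ _ _ iG) => //.
  exact: measurable_EFin_plane.
move=> z _ /=; rewrite lee_fin (le_trans (fC z))//; exact: ler_norm.
Qed.

End parametric.

(** * The rescaled heat average: integrability, maximum principle, joint continuity *)

Section heat.
Context {R : realType}.
Implicit Types f g : R * R -> R.
Local Notation mu := (@lebesgue_measure R).
Local Notation mu2 := (mu \x mu)%E.
Local Notation plane := (measurableTypeR R * measurableTypeR R)%type.

Lemma continuous_scale f (c : R) : continuous f -> continuous (fun z => c * f z).
Proof. by move=> cf z; apply: continuousM; [exact: cst_continuous|exact: cf]. Qed.

Lemma Rintegral_translate f (a b : R) : continuous f ->
  \int[mu2]_z f (z.1 + a, z.2 + b) = \int[mu2]_z f z.
Proof.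
move=> cf; rewrite /Rintegral (integral_plane_affine1 f 1 (cst a))//; last first.
  by move=> ?; exact: cst_continuous.
rewrite [in RHS](integral_plane_affine2 _ 1 (cst b))//=; last 2 first.
- by move=> ?; exact: cst_continuous.
- move=> z; apply: continuousM; first exact: cst_continuous.
  apply: continuous_comp2; [exact: cf| |exact: cvg_snd].
  apply: continuousD; last exact: cst_continuous.
  by apply: continuousM; [exact: cst_continuous|exact: cvg_fst].
by congr fine; apply: eq_integral => z _; rewrite !mul1r.
Qed.

Lemma dir_sqr_le1 (j : 'I_3) : (dir R j).1 ^+ 2 <= 1 /\ (dir R j).2 ^+ 2 <= 1.
Proof.
by rewrite /dir/=; split; case: (_ == _); rewrite ?expr1n ?expr0n//= ?lexx ?ler01.
Qed.

Lemma sqr_shift_ge (w q : R) : q ^+ 2 <= 1 -> w ^+ 2 / 2 - 1 <= (w + q) ^+ 2.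
Proof. have H : 0 <= (w + 2 * q) ^+ 2 by exact: sqr_ge0. move=> q1; nra. Qed.

(** Giving up half of the exponent pays for a unit shift: each coordinate loses at most 1 in its
    square, and two losses times the coefficient 1/2 make [expR 1]. This yields one integrable
    majorant for all shifts with [|h| <= 1]. *)
Lemma gaussian_shift (j : 'I_3) (h : R) (z : R * R) : `|h| <= 1 ->
  gaussian 2^-1 (z.1 + h * (dir R j).1, z.2 + h * (dir R j).2) <=
  expR 1 * gaussian 4^-1 z.
Proof.
move=> h1; rewrite /gaussian -expRD ler_expR.
move: (dir R j) (dir_sqr_le1 j) => [a b] /= [e1 e2].
have hh : h ^+ 2 <= 1 by rewrite -(@expr1n R 2) -[h ^+ 2]real_normK ?num_real// ler_sqr ?nnegrE.
have A (w c : R) : c ^+ 2 <= 1 -> w ^+ 2 / 2 - 1 <= (w + h * c) ^+ 2.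
  move=> c1; have : (h * c) ^+ 2 <= 1 by rewrite exprMn -[1]mulr1 ler_pM// sqr_ge0.
  exact: sqr_shift_ge.
by have := A z.1 a e1; have := A z.2 b e2; lra.
Qed.

(** The integral of a translate of [H] does not depend on the translation; differentiating this
    constant under the integral sign gives the claim, with no boundary terms. *)
Lemma integral_pd_eq0 (j : 'I_3) (H : R * R -> R) (C : R) : continuous H ->
  (forall z, derivable H z (dir R j)) -> continuous (pd j H) ->
  (forall z, `|H z| <= C * gaussian 2^-1 z) ->
  (forall z, `|pd j H z| <= C * gaussian 2^-1 z) ->
  \int[mu2]_z pd j H z = 0.
Proof.
move=> cH dH cdH HC dHC.
have C0 : 0 <= C.
  have := HC (0, 0); rewrite /gaussian/= expr0n/= addr0 mulr0 oppr0 expR0 mulr1.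
  exact: le_trans.
pose e := dir R j.
have ce h : continuous (fun z : R * R => H (z.1 + h * e.1, z.2 + h * e.2)).
  move=> z; apply: continuous_comp2; first exact: cH.
    by apply: continuousD; [exact: cvg_fst|exact: cst_continuous].
  by apply: continuousD; [exact: cvg_snd|exact: cst_continuous].
have B f h z : `|h| <= 1 -> (forall z, `|f z| <= C * gaussian 2^-1 z) ->
    `|f (z.1 + h * e.1, z.2 + h * e.2)| <= (C * expR 1) * gaussian 4^-1 z.
  move=> h1 fC; rewrite (le_trans (fC _))// -mulrA ler_wpM2l// gaussian_shift//.
have hle (h : R) : -1 < h < 1 -> `|h| <= 1.
  by move=> /andP[h1 h2]; rewrite ler_norml !ltW.
have D := @is_derive_Rintegral R (fun h z => H (z.1 + h * e.1, z.2 + h * e.2))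
  (fun h z => pd j H (z.1 + h * e.1, z.2 + h * e.2))
  (fun z => (C * expR 1) * gaussian 4^-1 z) setT 0 (-1) 1 measurableT.
have {D} : is_derive (0 : R) (1 : R)
    (fun h => \int[mu2]_z H (z.1 + h * e.1, z.2 + h * e.2))
    (\int[mu2]_z pd j H (z.1 + 0 * e.1, z.2 + 0 * e.2)).
  apply: D.
  - by rewrite ltrN10 ltr01.
  - move=> h /hle h1; apply: (@integrable_gaussian_dom _ _ 4^-1 (C * expR 1)) => //.
    + by move=> z; exact: B.
  - by move=> h z _ _; exact: is_derive_along.
  - by move=> z; rewrite mulr_ge0 ?gaussian_ge0// mulr_ge0// expR_ge0.
  - apply: (@integrable_gaussian_dom _ _ 4^-1 (C * expR 1)) => //.
    + by apply: continuous_scale; exact: continuous_gaussian.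
    + by move=> z; rewrite ger0_norm// mulr_ge0 ?gaussian_ge0// mulr_ge0// expR_ge0.
  - by move=> h z /hle h1 _; exact: B.
rewrite [X in is_derive _ _ X _](_ : _ = cst (\int[mu2]_z H z)); last first.
  by apply/funext => h; rewrite Rintegral_translate.
move=> /is_derive_val; rewrite derive_cst => E.
by rewrite [RHS]E; apply: eq_Rintegral => z _; rewrite !mul0r !addr0 -surjective_pairing.
Qed.

Definition heat_kernel (z : R * R) : R := pi^-1 * gaussian 1 z.

(* The convolution with the heat kernel at time [t], rescaled by [s = sqrt (4 nu t)]: the
   singularity at [t = 0] disappears. *)
Definition heat_avg f (s : R) (x : R * R) : R :=
  \int[mu2]_z (heat_kernel z * f (x.1 - s * z.1, x.2 - s * z.2)).

(** A bounded velocity makes the potential Lipschitz, not bounded. This is the growth it can have,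
    and the Gaussian still integrates it. *)
Definition linear_growth f (C : R) := forall x, `|f x| <= C * (1 + `|x.1| + `|x.2|).

Lemma heat_kernel_ge0 z : 0 <= heat_kernel z.
Proof. by rewrite mulr_ge0 ?gaussian_ge0// invr_ge0 pi_ge0. Qed.

Lemma continuous_heat_kernel : continuous heat_kernel.
Proof.
by apply: continuous_scale; exact: continuous_gaussian.
Qed.

Lemma integrable_heat_kernel : mu2.-integrable setT (EFin \o heat_kernel).
Proof.
apply: (@integrable_gaussian_dom _ _ 1 pi^-1) => //.
  exact: continuous_heat_kernel.
by move=> z; rewrite ger0_norm// heat_kernel_ge0.
Qed.

Lemma integral_heat_kernel : \int[mu2]_z heat_kernel z = 1.
Proof.
rewrite /heat_kernel RintegralZl//; last exact: integrable_gaussian.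
by rewrite /Rintegral integral_gaussian//= divr1 mulVf// lt0r_neq0// pi_gt0.
Qed.

Lemma linear_growth_ge0 f C : linear_growth f C -> 0 <= C.
Proof.
by move=> /(_ (0, 0)); rewrite /= normr0 !addr0 mulr1; exact: le_trans.
Qed.

Lemma bounded_linear_growth f C : (forall x, `|f x| <= C) -> linear_growth f C.
Proof.
move=> fC x; rewrite (le_trans (fC x))// ler_peMr//.
  exact: le_trans (fC x).
by rewrite -addrA lerDl addr_ge0.
Qed.

(** Half of the Gaussian exponent absorbs the linear weight through [1 + q <= expR q]; the other
    half stays as the majorant. *)
Lemma weight_gaussian (z : R * R) :
  (1 + `|z.1| + `|z.2|) * heat_kernel z <= 4 * gaussian 2^-1 z.
Proof.
have E : gaussian 1 z = gaussian 2^-1 z * gaussian 2^-1 z.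
  by rewrite /gaussian -expRD; congr expR; lra.
have p1 : (pi : R)^-1 <= 1 by rewrite invf_le1 ?pi_gt0// (le_trans _ (pi_ge2 R))// ler1n.
rewrite /heat_kernel E.
suff H : (1 + `|z.1| + `|z.2|) * gaussian 2^-1 z <= 4.
  rewrite [leLHS](_ : _ = pi^-1 * ((1 + `|z.1| + `|z.2|) * gaussian 2^-1 z * gaussian 2^-1 z)); last by ring.
  rewrite -[leRHS]mul1r ler_pM ?invr_ge0 ?pi_ge0//.
    by rewrite !mulr_ge0 ?gaussian_ge0// !addr_ge0.
  by rewrite ler_wpM2r// gaussian_ge0.
rewrite /gaussian expRN ler_pdivrMr ?expR_gt0//.
set q := 2^-1 * _.
have : 1 + q <= expR q by exact: expR_ge1Dx.
have := sqr_ge0 (`|z.1| - 1); have := sqr_ge0 (`|z.2| - 1).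
have : `|z.1| ^+ 2 = z.1 ^+ 2 by rewrite real_normK ?num_real.
have : `|z.2| ^+ 2 = z.2 ^+ 2 by rewrite real_normK ?num_real.
rewrite {1}/q; nra.
Qed.

Lemma linear_growth_shift f C (s : R) (x z : R * R) : linear_growth f C ->
  `|f (x.1 - s * z.1, x.2 - s * z.2)| <=
  C * ((1 + `|x.1| + `|x.2|) * (1 + `|s|)) * (1 + `|z.1| + `|z.2|).
Proof.
move=> fC; rewrite (le_trans (fC _))//= -mulrA ler_wpM2l ?(linear_growth_ge0 _ _ fC)//.
have := ler_normB x.1 (s * z.1); have := ler_normB x.2 (s * z.2).
rewrite !normrM.
have := normr_ge0 x.1; have := normr_ge0 x.2; have := normr_ge0 s.
have := normr_ge0 z.1; have := normr_ge0 z.2.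
move: `|x.1| `|x.2| `|s| `|z.1| `|z.2| => a b c d e e0 d0 c0 b0 a0 H1 H2.
have : 0 <= (a + b) * (d + e) * (1 + c) by rewrite !mulr_ge0 ?addr_ge0.
have : 0 <= (a + b) * c by rewrite !mulr_ge0 ?addr_ge0.
nra.
Qed.

Lemma heat_integrand_le f C (s : R) (x z : R * R) : linear_growth f C ->
  `|heat_kernel z * f (x.1 - s * z.1, x.2 - s * z.2)| <=
  4 * C * ((1 + `|x.1| + `|x.2|) * (1 + `|s|)) * gaussian 2^-1 z.
Proof.
move=> fC; rewrite normrM ger0_norm ?heat_kernel_ge0//.
rewrite (le_trans (ler_wpM2l (heat_kernel_ge0 z) (linear_growth_shift _ _ s x z fC)))//.
have C0 := linear_growth_ge0 _ _ fC.
set M := (1 + _ + _) * (1 + `|s|).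
have M0 : 0 <= M by rewrite mulr_ge0 ?addr_ge0.
have /(ler_wpM2l (mulr_ge0 C0 M0)) := weight_gaussian z.
by congr (_ <= _); ring.
Qed.

Lemma continuous_heat_integrand f (s : R) (x : R * R) : continuous f ->
  continuous (fun z => heat_kernel z * f (x.1 - s * z.1, x.2 - s * z.2)).
Proof.
move=> cf z; apply: continuousM; first exact: continuous_heat_kernel.
apply: continuous_comp2; first exact: cf.
- apply: continuousB; first exact: cst_continuous.
  by apply: continuousM; [exact: cst_continuous|exact: cvg_fst].
- apply: continuousB; first exact: cst_continuous.
  by apply: continuousM; [exact: cst_continuous|exact: cvg_snd].
Qed.

Lemma integrable_heat_integrand f C (s : R) (x : R * R) : continuous f ->
  linear_growth f C ->
  mu2.-integrable setT
    (EFin \o (fun z => heat_kernel z * f (x.1 - s * z.1, x.2 - s * z.2))).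
Proof.
move=> cf fC; apply: (@integrable_gaussian_dom _ _ 2^-1 _ _ _ (fun z => heat_integrand_le _ _ s x z fC)) => //.
exact: continuous_heat_integrand.
Qed.

Lemma heat_avg0 f x : heat_avg f 0 x = f x.
Proof.
rewrite /heat_avg; under eq_Rintegral do rewrite !mul0r !subr0 -surjective_pairing.
by rewrite RintegralZr ?integral_heat_kernel ?mul1r//; exact: integrable_heat_kernel.
Qed.

(** The maximum principle: the kernel is nonnegative and has mass one. *)
Lemma heat_avg_le f C s x : continuous f -> (forall x, `|f x| <= C) ->
  `|heat_avg f s x| <= C.
Proof.
move=> cf fC; have gf := bounded_linear_growth _ _ fC.
have ig := integrable_heat_integrand _ _ s x cf gf.
rewrite (le_trans (le_normr_Rintegral _ ig))// -[leRHS]mul1r -integral_heat_kernel.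
rewrite -RintegralZr//; last exact: integrable_heat_kernel.
apply: le_Rintegral => //.
- exact: (integrable_norm ig).
- apply: (@integrable_gaussian_dom _ _ 1 (C / pi)) => //.
    by move=> z; apply: continuousM; [exact: continuous_heat_kernel|exact: cst_continuous].
  move=> z; rewrite ger0_norm.
    by rewrite /heat_kernel mulrC mulrA.
  by apply: mulr_ge0; [exact: heat_kernel_ge0|exact: linear_growth_ge0 gf].
- by move=> z _; rewrite normrM ger0_norm ?heat_kernel_ge0// ler_wpM2l// heat_kernel_ge0.
Qed.

Lemma continuous_heat_avg f C : continuous f -> linear_growth f C ->
  continuous (fun p : R * (R * R) => heat_avg f p.1 p.2).
Proof.
move=> cf fC [s x]; have C0 := linear_growth_ge0 _ _ fC.
(* The majorant must serve the whole unit ball around [(s, x)], hence the norms enlarged by 1. *)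
have D := (@continuous_Rintegral R (R * (R * R))%type (fun p z => heat_kernel z * f (p.2.1 - p.1 * z.1, p.2.2 - p.1 * z.2))
  (fun z => 4 * C * ((1 + (`|x.1| + 1) + (`|x.2| + 1)) * (1 + (`|s| + 1))) * gaussian 2^-1 z) setT (s, x) 1 measurableT ltr01); apply: D.
- move=> p; apply: continuous_measurable_plane; exact: continuous_heat_integrand.
- move=> z _; apply: continuousM; first exact: cst_continuous.
  have c1 : {for (s, x), continuous (fun p : R * (R * R) => p.1)} by exact: cvg_fst.
  have c2 : {for (s, x), continuous (fun p : R * (R * R) => p.2)} by exact: cvg_snd.
  apply: continuous_comp2; first exact: cf.
  + apply: continuousB; first by apply: (continuous_comp c2); exact: cvg_fst.
    by apply: continuousM; [exact: c1|exact: cst_continuous].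
  + apply: continuousB; first by apply: (continuous_comp c2); exact: cvg_snd.
    by apply: continuousM; [exact: c1|exact: cst_continuous].
- apply: (@integrable_gaussian_dom _ _ 2^-1 _ _ _ (fun z => _)) => //.
  + by apply: continuous_scale; exact: continuous_gaussian.
  + move=> z; rewrite ger0_norm; first exact: lexx.
    by rewrite mulr_ge0 ?gaussian_ge0// !mulr_ge0// !addr_ge0.
- move=> [t y] z [/= ts [y1 y2]] _.
  rewrite (le_trans (heat_integrand_le _ _ t y z fC))// ler_wpM2r ?gaussian_ge0//.
  have nle (a b : R) : ball a 1 b -> `|b| <= `|a| + 1.
    rewrite /ball/= => ab; rewrite -[b](subrK a) addrC (le_trans (ler_normD _ _))// lerD2l.
    by rewrite distrC ltW.
  rewrite ler_wpM2l ?mulr_ge0// ler_pM ?addr_ge0//.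
    by rewrite !lerD// nle.
  by rewrite lerD// nle.
Qed.

End heat.

(** * Derivatives of the heat average and Gaussian integration by parts *)

Section heat_derivatives.
Context {R : realType}.
Implicit Types f g : R * R -> R.
Local Notation mu := (@lebesgue_measure R).
Local Notation mu2 := (mu \x mu)%E.
Local Notation plane := (measurableTypeR R * measurableTypeR R)%type.

(** The derivative falls on [f], so the majorant is [D] times the kernel. Linear growth of [f] is
    enough, which lets the statement apply to the potential itself. *)
Lemma is_derive_heat_avg f C D (j : 'I_3) s x : continuous f ->
  linear_growth f C -> (forall x, derivable f x (dir R j)) ->
  continuous (pd j f) -> (forall x, `|pd j f x| <= D) ->
  is_derive x (dir R j) (heat_avg f s) (heat_avg (pd j f) s x).
Proof.
move=> cf fC df cdf fD; apply: is_derive_of_along.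
pose F h (z : R * R) := heat_kernel z *
  f ((x.1 - s * z.1) + h * (dir R j).1, (x.2 - s * z.2) + h * (dir R j).2).
pose F' h (z : R * R) := heat_kernel z *
  pd j f ((x.1 - s * z.1) + h * (dir R j).1, (x.2 - s * z.2) + h * (dir R j).2).
have FE (q : R * R -> R) h : (fun z => heat_kernel z *
    q ((x.1 - s * z.1) + h * (dir R j).1, (x.2 - s * z.2) + h * (dir R j).2)) =
    (fun z => heat_kernel z *
    q ((x.1 + h * (dir R j).1, x.2 + h * (dir R j).2).1 - s * z.1,
       (x.1 + h * (dir R j).1, x.2 + h * (dir R j).2).2 - s * z.2)).
  by apply/funext => z; congr (_ * q _); congr pair => /=; rewrite addrAC.
have -> : (fun h => heat_avg f s (x.1 + h * (dir R j).1, x.2 + h * (dir R j).2)) =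
    (fun h => \int[mu2]_z F h z).
  by apply/funext => h; rewrite /heat_avg /F (FE f).
have -> : heat_avg (pd j f) s x = \int[mu2]_z F' 0 z.
  by rewrite /heat_avg; apply: eq_Rintegral => z _; rewrite /F' !mul0r !addr0.
have D0 : 0 <= D by exact: le_trans (fD x).
have kD0 (z : R * R) : 0 <= D * heat_kernel z.
  by apply: mulr_ge0 => //; exact: heat_kernel_ge0.
have H := @is_derive_Rintegral R F F' (fun z => D * heat_kernel z) setT 0 (-1) 1 measurableT.
apply: H.
- by rewrite ltrN10 ltr01.
- by move=> h _; rewrite /F (FE f); exact: integrable_heat_integrand cf fC.
- move=> h z _ _; rewrite /F /F'.
  have D1 := is_derive_along f j (x.1 - s * z.1, x.2 - s * z.2) h (df _).
  have := is_deriveZ (heat_kernel z) D1; exact.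
- exact: kD0.
- apply: (@integrable_gaussian_dom _ _ 1 (D / pi)) => //.
  + by apply: continuous_scale; exact: continuous_heat_kernel.
  + by move=> z; rewrite ger0_norm ?kD0// /heat_kernel mulrA.
- move=> h z _ _; rewrite /F' normrM ger0_norm ?heat_kernel_ge0// mulrC.
  by apply: ler_wpM2r => //; exact: heat_kernel_ge0.
Qed.

Lemma pd_heat_avg f C D (j : 'I_3) s : continuous f ->
  linear_growth f C -> (forall x, derivable f x (dir R j)) ->
  continuous (pd j f) -> (forall x, `|pd j f x| <= D) ->
  pd j (heat_avg f s) = heat_avg (pd j f) s.
Proof.
move=> cf fC df cdf fD; apply/funext => x.
exact: is_derive_val (is_derive_heat_avg _ _ _ _ _ _ cf fC df cdf fD).
Qed.

(** The scalar product with [dir R j]: up to [- 2], the factor that [pd j] brings out of the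
    Gaussian. *)
Definition dirdot (j : 'I_3) (z : R * R) : R := z.1 * (dir R j).1 + z.2 * (dir R j).2.

Lemma dirdot0 z : dirdot 0 z = z.1.
Proof. by rewrite /dirdot /dir/= mulr1 mulr0 addr0. Qed.

Lemma dirdot1 z : dirdot 1 z = z.2.
Proof. by rewrite /dirdot /dir/= mulr1 mulr0 add0r. Qed.

Lemma dirdot_le j z : `|dirdot j z| <= `|z.1| + `|z.2|.
Proof.
rewrite /dirdot (le_trans (ler_normD _ _))// !normrM lerD// ler_piMr//.
  by rewrite /dir/=; case: (_ == _); rewrite ?normr1 ?normr0 ?ler01.
by rewrite /dir/=; case: (_ == _); rewrite ?normr1 ?normr0 ?ler01.
Qed.

Lemma continuous_dirdot j : continuous (dirdot j).
Proof.
by move=> z; apply: cvgD; apply: cvgM; [exact: cvg_fst|exact: cvg_cst|exact: cvg_snd|exact: cvg_cst].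
Qed.

Lemma is_derive_heat_kernel j z :
  is_derive z (dir R j) (@heat_kernel R) (- 2 * dirdot j z * heat_kernel z).
Proof.
apply: is_derive_of_along.
pose q (s : R) := - (1 * ((z.1 + s * (dir R j).1) ^+ 2 + (z.2 + s * (dir R j).2) ^+ 2)).
have lin (a b : R) : is_derive (0 : R) (1 : R) (fun s : R => a + s * b) b.
  apply: is_derive_eq; rewrite scaler0 !add0r.
  by rewrite -[_ *: _]/(_ * _) ?mulr1 ?mul1r.
have sq (a b : R) : is_derive (0 : R) (1 : R) (fun s : R => (a + s * b) ^+ 2) (2 * a * b).
  have := is_deriveM (lin a b) (lin a b); rewrite mul0r addr0.
  by congr is_derive; rewrite -![_ *: _]/(_ * _); ring.
have dq : is_derive (0 : R) (1 : R) q (- 2 * dirdot j z).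
  have := is_deriveN (is_deriveD (sq z.1 (dir R j).1) (sq z.2 (dir R j).2)).
  rewrite (_ : - (fun s : R => _) = q); last first.
    by apply/funext => s; rewrite /q mul1r.
  by congr is_derive; rewrite /dirdot; ring.
have de := is_derive1_comp (is_derive_expR (q 0)) dq.
have := is_deriveZ (pi^-1) de.
rewrite (_ : pi^-1 \*: (_ \o _) = (fun s : R =>
   heat_kernel (z.1 + s * (dir R j).1, z.2 + s * (dir R j).2))) //.
congr is_derive; rewrite -[_ *: _]/(_ * _) /heat_kernel /gaussian /q !mul0r !addr0.
by ring.
Qed.

Lemma is_derive_rescale g (j : 'I_3) s (x z : R * R) :
  (forall x, derivable g x (dir R j)) ->
  is_derive z (dir R j) (fun z => g (x.1 - s * z.1, x.2 - s * z.2))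
    (- s * pd j g (x.1 - s * z.1, x.2 - s * z.2)).
Proof.
move=> dg; apply: is_derive_of_along.
pose y := (x.1 - s * z.1, x.2 - s * z.2).
have D0 : is_derive (- s * 0 : R) (1 : R)
    (fun h => g (y.1 + h * (dir R j).1, y.2 + h * (dir R j).2)) (pd j g y).
  have := is_derive_along g j y (- s * 0) (dg _).
  by rewrite mulr0 !mul0r !addr0 -surjective_pairing.
have D1 : is_derive (0 : R) (1 : R) (fun h : R => - s * h) (- s).
  by apply: is_derive_eq; rewrite -[_ *: _]/(_ * _) mulr1.
have := @is_derive1_comp _ _ (fun h : R => - s * h) 0 _ _ D0 D1.
rewrite (_ : _ \o _ = (fun h => g (x.1 - s * (z.1 + h * (dir R j).1),
   x.2 - s * (z.2 + h * (dir R j).2)))); last first.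
  by apply/funext => h /=; congr (g _); congr pair; ring.
by congr is_derive; rewrite mulrC.
Qed.

(* Integration by parts against the Gaussian. *)
Lemma integral_dirdot_heat_kernel g C (j : 'I_3) s x : continuous g ->
  (forall x, `|g x| <= C) -> (forall x, derivable g x (dir R j)) ->
  continuous (pd j g) -> (forall x, `|pd j g x| <= C) ->
  \int[mu2]_z (dirdot j z * (heat_kernel z * g (x.1 - s * z.1, x.2 - s * z.2))) =
  - (s / 2) * heat_avg (pd j g) s x.
Proof.
move=> cg gC dg cdg dgC.
have C0 : 0 <= C by exact: le_trans (gC x).
pose H (z : R * R) := heat_kernel z * g (x.1 - s * z.1, x.2 - s * z.2).
pose H1 (z : R * R) := dirdot j z * H z.
pose H2 (z : R * R) := heat_kernel z * pd j g (x.1 - s * z.1, x.2 - s * z.2).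
have dH z : is_derive z (dir R j) H (- 2 * H1 z - s * H2 z).
  have := is_deriveM (is_derive_heat_kernel j z) (is_derive_rescale g j s x z dg).
  rewrite (_ : _ * _ = H)//.
  congr is_derive; rewrite -![_ *: _]/(_ * _) /H1 /H2 /H; ring.
have pdH : pd j H = (fun z => - 2 * H1 z - s * H2 z).
  by apply/funext => z; exact: is_derive_val (dH z).
have cH : continuous H by exact: continuous_heat_integrand.
have cH2 : continuous H2 by exact: continuous_heat_integrand.
have cH1 : continuous H1.
  by move=> z; apply: continuousM; [exact: continuous_dirdot|exact: cH].
have w1 (z : R * R) : 1 <= 1 + `|z.1| + `|z.2| by rewrite -addrA lerDl addr_ge0.
have kle (z : R * R) : heat_kernel z <= 4 * gaussian 2^-1 z.
  apply: le_trans (weight_gaussian z).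
  by have := ler_wpM2r (heat_kernel_ge0 z) (w1 z); rewrite mul1r.
have bH (q : R * R -> R) (z : R * R) : (forall x, `|q x| <= C) ->
    `|heat_kernel z * q (x.1 - s * z.1, x.2 - s * z.2)| <= C * heat_kernel z.
  move=> qC; rewrite normrM ger0_norm ?heat_kernel_ge0// mulrC.
  exact: (ler_wpM2r (heat_kernel_ge0 z) (qC _)).
have bH' (q : R * R -> R) (z : R * R) : (forall x, `|q x| <= C) ->
    `|heat_kernel z * q (x.1 - s * z.1, x.2 - s * z.2)| <= (4 * C) * gaussian 2^-1 z.
  move=> /bH qC; rewrite (le_trans (qC z))// (mulrC 4) -mulrA ler_wpM2l//.
have bH1 (z : R * R) : `|H1 z| <= (4 * C) * gaussian 2^-1 z.
  rewrite /H1 normrM; apply: (@le_trans _ _ (C * ((1 + `|z.1| + `|z.2|) * heat_kernel z))).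
    rewrite mulrCA ler_pM//; last exact: bH.
    by rewrite (le_trans (dirdot_le j z))// -addrA lerDr.
  by rewrite (mulrC 4) -mulrA ler_wpM2l// weight_gaussian.
have E := @integral_pd_eq0 R j H ((4 * C) * (2 + `|s|)) cH
  (fun z => is_derive_derivable _ _ _ _ _ _ (dH z)).
have {}E : \int[mu2]_z pd j H z = 0.
  have g0 (z : R * R) : 0 <= 4 * C * gaussian 2^-1 z.
    by rewrite mulr_ge0 ?gaussian_ge0// mulr_ge0.
  apply: E.
  - rewrite pdH => z; apply: cvgB.
      exact: (continuous_scale H1 (- 2) cH1 z).
    exact: (continuous_scale H2 s cH2 z).
  - move=> z; apply: (le_trans (bH' _ z gC)); apply: ler_wpM2r; first exact: gaussian_ge0.
    rewrite ler_peMr ?mulr_ge0//.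
    by rewrite (le_trans _ (lerD (lexx 2) (normr_ge0 s)))// addr0 ler1n.
  - move=> z; rewrite pdH; apply: (le_trans (ler_normB _ _)).
    rewrite [leRHS](_ : _ = 2 * (4 * C * gaussian 2^-1 z) +
      `|s| * (4 * C * gaussian 2^-1 z)); last by ring.
    rewrite (normrM (- 2)) (normrM s) normrN (ger0_norm (ler0n R 2)).
    by apply: lerD; apply: ler_wpM2l => //; exact: bH'.
have i1 : mu2.-integrable setT (EFin \o H1).
  exact: (@integrable_gaussian_dom _ _ 2^-1 _ _ cH1 bH1).
have i2 : mu2.-integrable setT (EFin \o H2).
  by apply: (@integrable_gaussian_dom _ _ 2^-1 (4 * C) _ cH2) => // z; exact: bH'.
move: E; rewrite pdH RintegralB//; last 2 first.
- by under [X in _.-integrable _ X]eq_fun do rewrite /= EFinM; exact: integrableZl.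
- by under [X in _.-integrable _ X]eq_fun do rewrite /= EFinM; exact: integrableZl.
rewrite !RintegralZl// => /eqP; rewrite subr_eq0 => /eqP E.
rewrite -[LHS]/(\int[mu2]_z H1 z) /heat_avg -[\int[mu2]_z (_ * _)]/(\int[mu2]_z H2 z).
by rewrite mulNr mulrAC -E; field.
Qed.

End heat_derivatives.

(** * The heat equation, first in the scale [s], then in time *)

Section heat_equation.
Context {R : realType}.
Implicit Types f g : R * R -> R.
Local Notation mu := (@lebesgue_measure R).
Local Notation mu2 := (mu \x mu)%E.
Local Notation plane := (measurableTypeR R * measurableTypeR R)%type.

Definition continuous_bounded f := continuous f /\ exists C : R, forall x, `|f x| <= C.

Definition C2_bounded f :=
  [/\ continuous_bounded f,
      forall j, (forall x, derivable f x (dir R j)) /\ continuous_bounded (pd j f)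
    & forall j k, (forall x, derivable (pd j f) x (dir R k)) /\
        continuous_bounded (pd k (pd j f))].

(** Differentiating in [s] produces [- z . grad f (x - s z)] against the kernel. As the factor [z]
    times the kernel is [- 1/2] of its gradient, integration by parts turns this into [s / 2] times
    the averaged Laplacian. *)
Lemma is_derive_heat_avg_scale f (s : R) (x : R * R) : C2_bounded f ->
  is_derive s (1 : R) (fun s => heat_avg f s x)
    (s / 2 * (heat_avg (pd 0 (pd 0 f)) s x + heat_avg (pd 1 (pd 1 f)) s x)).
Proof.
move=> [[cf [C fC]] d1 d2].
have [[df0 [c0 [C0 f0]]] [df1 [c1 [C1 f1]]]] := (d1 0, d1 1).
have [[df00 [c00 [C00 f00]]] [df11 [c11 [C11 f11]]]] := (d2 0 0, d2 1 1).
have gf := bounded_linear_growth _ _ fC.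
pose F (h : R) (z : R * R) := heat_kernel z * f (x.1 - h * z.1, x.2 - h * z.2).
pose F0 (h : R) (z : R * R) := dirdot 0 z * (heat_kernel z * pd 0 f (x.1 - h * z.1, x.2 - h * z.2)).
pose F1 (h : R) (z : R * R) := dirdot 1 z * (heat_kernel z * pd 1 f (x.1 - h * z.1, x.2 - h * z.2)).
have C0_ge0 : 0 <= C0 by exact: le_trans (f0 x).
have C1_ge0 : 0 <= C1 by exact: le_trans (f1 x).
have G_ge0 (c : R) (z : R * R) : 0 <= c -> 0 <= 4 * c * gaussian 2^-1 z.
  by move=> c_ge0; apply: mulr_ge0; [exact: mulr_ge0|exact: gaussian_ge0].
have bF j (q : R * R -> R) (c h : R) (z : R * R) : 0 <= c -> (forall x, `|q x| <= c) ->
    `|dirdot j z * (heat_kernel z * q (x.1 - h * z.1, x.2 - h * z.2))| <=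
    4 * c * gaussian 2^-1 z.
  move=> c_ge0 qc; rewrite (normrM (dirdot j z)).
  apply: (@le_trans _ _ (c * ((1 + `|z.1| + `|z.2|) * heat_kernel z))).
    rewrite mulrCA; apply: ler_pM => //.
      by rewrite (le_trans (dirdot_le j z))// -addrA lerDr.
    rewrite normrM ger0_norm ?heat_kernel_ge0// mulrC.
    exact: (ler_wpM2r (heat_kernel_ge0 z) (qc _)).
  by rewrite (mulrC 4) -mulrA; apply: ler_wpM2l => //; exact: weight_gaussian.
have iG (c : R) : mu2.-integrable setT (EFin \o (fun z => c * gaussian 2^-1 z)).
  under [X in _.-integrable _ X]eq_fun do rewrite /= EFinM.
  by apply: integrableZl => //; exact: integrable_gaussian.
have iF j (q : R * R -> R) (c h : R) : 0 <= c -> continuous q -> (forall x, `|q x| <= c) ->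
    mu2.-integrable setT (EFin \o (fun z => dirdot j z *
      (heat_kernel z * q (x.1 - h * z.1, x.2 - h * z.2)))).
  move=> c_ge0 cq qc; apply: (@integrable_gaussian_dom _ _ 2^-1 (4 * c)) => //.
    move=> z; apply: cvgM; [exact: continuous_dirdot|exact: (continuous_heat_integrand q h x cq)].
  by move=> z; exact: bF.
have H := @is_derive_Rintegral R F (fun h z => - F0 h z - F1 h z)
  (fun z => 4 * C0 * gaussian 2^-1 z + 4 * C1 * gaussian 2^-1 z)
  setT s (s - 1) (s + 1) measurableT.
have {}H : is_derive s (1 : R) (fun s => \int[mu2]_z F s z)
    (\int[mu2]_z (- F0 s z - F1 s z)).
  apply: H.
  - by rewrite ltrBlDr ltrDl ltr01.
  - by move=> h _; exact: integrable_heat_integrand cf gf.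
  - move=> h z _ _.
    have := is_deriveZ (heat_kernel z) (@derive_line R f x (- z.1, - z.2) h df0 df1 c0).
    rewrite (_ : heat_kernel z \*: _ = F ^~ z); last first.
      by apply/funext => k; rewrite /F /= !mulrN.
    by congr is_derive; rewrite /F0 /F1 dirdot0 dirdot1 /= !mulrN -[_ *: _]/(_ * _); ring.
  - by move=> z; apply: addr_ge0; exact: G_ge0.
  - under [X in _.-integrable _ X]eq_fun do rewrite /= EFinD.
    by apply: integrableD => //; exact: iG.
  - move=> h z _ _; rewrite (le_trans (ler_normB _ _))// normrN.
    by apply: lerD; exact: bF.
have alg (a b : R) : s / 2 * (a + b) = - (- (s / 2) * a) - - (s / 2) * b by ring.
set w := (X in is_derive _ _ _ X).
suff -> : w = \int[mu2]_z (- F0 s z - F1 s z) by exact: H.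
have -> : \int[mu2]_z (- F0 s z - F1 s z) = - (\int[mu2]_z F0 s z) - \int[mu2]_z F1 s z.
  rewrite RintegralB//.
  - congr (_ - _); under eq_Rintegral do rewrite -mulN1r.
    by rewrite RintegralZl ?mulN1r//; exact: (iF 0 _ _ s C0_ge0 c0 f0).
  - under [X in _.-integrable _ X]eq_fun do rewrite /= -mulN1r EFinM.
    by apply: integrableZl => //; exact: (iF 0 _ _ s C0_ge0 c0 f0).
  - exact: (iF 1 _ _ s C1_ge0 c1 f1).
have bm (a b c : R) : a <= b -> a <= Num.max b c by move=> ab; rewrite le_max ab.
have bm' (a b c : R) : a <= c -> a <= Num.max b c by move=> ab; rewrite le_max ab orbT.
(* The integration by parts takes a single bound for a function and its derivative, hence the
   maxima. *)
rewrite (@integral_dirdot_heat_kernel R (pd 0 f) (Num.max C0 C00))//; last 2 first.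
- by move=> y; apply: bm.
- by move=> y; apply: bm'.
rewrite (@integral_dirdot_heat_kernel R (pd 1 f) (Num.max C1 C11))//; last 2 first.
- by move=> y; apply: bm.
- by move=> y; apply: bm'.
exact: alg.
Qed.

Lemma continuous_heat_flow f (nu C : R) : continuous f -> linear_growth f C ->
  continuous (fun z : R * (R * R) => heat_avg f (Num.sqrt (4 * nu * z.1)) z.2).
Proof.
move=> cf fC [t x].
have H := continuous_heat_avg f C cf fC (Num.sqrt (4 * nu * t), x).
apply: (@continuous_comp _ _ _ (fun z : R * (R * R) => (Num.sqrt (4 * nu * z.1), z.2))
  (fun p => heat_avg f p.1 p.2) (t, x)); last exact: H.
have cs : {for (t, x), continuous (fun z : R * (R * R) => Num.sqrt (4 * nu * z.1))}.
  apply: continuous_comp; last exact: sqrt_continuous.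
  by apply: cvgM; [exact: cvg_cst|exact: cvg_fst].
have c2 : {for (t, x), continuous (fun z : R * (R * R) => z.2)} by exact: cvg_snd.
exact: (cvg_pair cs c2).
Qed.

(** For [s = sqrt (4 nu t)] one has [ds/dt = 2 nu / s], which compensates the factor [s / 2]
    exactly. *)
Lemma heat_equation f (nu t : R) (x : R * R) : 0 < nu -> 0 < t -> C2_bounded f ->
  is_derive t (1 : R) (fun t => heat_avg f (Num.sqrt (4 * nu * t)) x)
    (nu * laplacian (heat_avg f (Num.sqrt (4 * nu * t))) x).
Proof.
move=> nu0 t0 Cf; have [[cf [C fC]] d1 d2] := Cf.
have gf := bounded_linear_growth _ _ fC.
set s := Num.sqrt (4 * nu * t).
have s0 : 0 < s by rewrite sqrtr_gt0 !mulr_gt0.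
have dl : is_derive t (1 : R) (fun t : R => 4 * nu * t) (4 * nu).
  by apply: is_derive_eq; rewrite -[_ *: _]/(_ * _) mulr1.
have ds := is_derive1_comp (is_derive1_sqrt (mulr_gt0 (mulr_gt0 (ltr0n R 4) nu0) t0)) dl.
have dh := @is_derive1_comp _ (fun s => heat_avg f s x)
  (fun t => Num.sqrt (4 * nu * t)) t _ _ (is_derive_heat_avg_scale f s x Cf) ds.
have pp j : pd j (pd j (heat_avg f s)) = heat_avg (pd j (pd j f)) s.
  have [df [cdf [D fD]]] := d1 j; have [ddf [cddf [E fE]]] := d2 j j.
  rewrite (pd_heat_avg _ _ _ _ _ cf gf df cdf fD).
  exact: (pd_heat_avg _ _ _ _ _ cdf (bounded_linear_growth _ _ fD) ddf cddf fE).
have alg (a b : R) : s / 2 * (a + b) * ((2 * s)^-1 * (4 * nu)) = nu * (a + b).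
  by field; exact: lt0r_neq0.
by rewrite /laplacian !pp -alg; exact: dh.
Qed.

End heat_equation.

HB.instance Definition _ (R : realType) := Measure.on (@plane_measure R).
(** Registered for Tonelli's theorem on the product of two planes, the space variable and the
    averaging variable. *)
Lemma sigma_finite_plane (R : realType) : sigma_finite setT (@plane_measure R).
Proof.
exists (fun n => rect (- n%:R) n%:R (- n%:R) n%:R); last first.
  by move=> n; split; [exact: measurable_rect|exact: rect_lty].
apply/esym/seteqP; split=> // -[x y] _.
pose n := (Num.truncn `|x|).+1; pose m := (Num.truncn `|y|).+1.
have xn : `|x| <= n%:R by apply/ltW; exact: truncnS_gt.
have ym : `|y| <= m%:R by apply/ltW; exact: truncnS_gt.
have nm : n%:R <= (maxn n m)%:R :> R by rewrite ler_nat leq_maxl.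
have mm : m%:R <= (maxn n m)%:R :> R by rewrite ler_nat leq_maxr.
exists (maxn n m) => //; split => /=; rewrite in_itv/= -ler_norml.
  exact: le_trans nm.
exact: le_trans mm.
Qed.
HB.instance Definition _ (R : realType) :=
  Measure_isSigmaFinite.Build _ _ _ (@plane_measure R) (@sigma_finite_plane R).

(** * Energy contraction, rotation invariance, and the link with [heat_potential] *)

Section heat_symmetry.
Context {R : realType}.
Implicit Types f g : R * R -> R.
Local Notation mu := (@lebesgue_measure R).
Local Notation mu2 := (mu \x mu)%E.
Local Notation plane := (measurableTypeR R * measurableTypeR R)%type.

Lemma ge0_integral_translate f (a b : R) : continuous f -> (forall x, 0 <= f x) ->
  (\int[mu2]_z (f (z.1 + a, z.2 + b))%:E = \int[mu2]_z (f z)%:E)%E.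
Proof.
move=> cf f0; rewrite [RHS](integral_plane_affine1 f 1 (cst a))//; last first.
  by move=> ?; exact: cst_continuous.
rewrite [RHS](integral_plane_affine2 _ 1 (cst b))//=; last 2 first.
- by move=> ?; exact: cst_continuous.
- move=> z; apply: continuousM; first exact: cst_continuous.
  apply: continuous_comp2; [exact: cf| |exact: cvg_snd].
  apply: continuousD; last exact: cst_continuous.
  by apply: continuousM; [exact: cst_continuous|exact: cvg_fst].
by apply: eq_integral => z _; rewrite !mul1r.
Qed.

Lemma continuous_sqr f : continuous f -> continuous (fun z => f z ^+ 2).
Proof. by move=> cf z; apply: cvgM; exact: cf. Qed.

Lemma sqr_le_bounded f C : (forall x, `|f x| <= C) -> forall x, `|f x ^+ 2| <= C ^+ 2.
Proof.
move=> fC x; have C0 : 0 <= C by exact: le_trans (fC x).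
by rewrite normrX ler_sqr ?nnegrE.
Qed.

(* Jensen's inequality, from the positivity of the average of [(f - m)^2]. *)
Lemma sqr_heat_avg_le f s x : continuous_bounded f ->
  heat_avg f s x ^+ 2 <= heat_avg (fun y => f y ^+ 2) s x.
Proof.
move=> [cf [C fC]]; set m := heat_avg f s x.
have i1 := integrable_heat_integrand f C s x cf (bounded_linear_growth _ _ fC).
have i2 := integrable_heat_integrand (fun y => f y ^+ 2) (C ^+ 2) s x
  (continuous_sqr _ cf) (bounded_linear_growth _ _ (sqr_le_bounded _ _ fC)).
have i0 := @integrable_heat_kernel R.
have iZ (c : R) (q : R * R -> R) : mu2.-integrable setT (EFin \o q) ->
    mu2.-integrable setT (EFin \o (fun z => c * q z)).
  move=> iq; under [X in _.-integrable _ X]eq_fun do rewrite /= EFinM.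
  exact: integrableZl.
have alg (a b : R) : 0 <= a - 2 * b * b + b ^+ 2 -> b ^+ 2 <= a by nra.
have : 0 <= \int[mu2]_z ((heat_kernel z * f (x.1 - s * z.1, x.2 - s * z.2) ^+ 2 -
    (2 * m) * (heat_kernel z * f (x.1 - s * z.1, x.2 - s * z.2))) +
    m ^+ 2 * heat_kernel z).
  apply: Rintegral_ge0 => z _.
  rewrite [leRHS](_ : _ = heat_kernel z * (f (x.1 - s * z.1, x.2 - s * z.2) - m) ^+ 2); last by ring.
  by apply: mulr_ge0; [exact: heat_kernel_ge0|exact: sqr_ge0].
rewrite RintegralD//; last 2 first.
- under [X in _.-integrable _ X]eq_fun do rewrite /= EFinB.
  by apply: integrableB => //; exact: iZ.
- exact: iZ.
rewrite RintegralB//; last exact: iZ.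
rewrite [X in _ - X + _]RintegralZl// [X in _ + X]RintegralZl// integral_heat_kernel.
rewrite -/(heat_avg f s x) -/m mulr1.
rewrite -[\int[_]_z _]/(heat_avg (fun y => f y ^+ 2) s x).
exact: alg.
Qed.

(** Averaging against a probability density contracts the L^2 norm: Jensen at each point, then
    Tonelli brings the space integral inside, where translation invariance removes the shift and the
    kernel integrates to one. *)
Lemma energy_heat_avg f (s : R) : continuous_bounded f ->
  (\int[@plane_measure R]_x (heat_avg f s x ^+ 2)%:E <=
    \int[@plane_measure R]_x (f x ^+ 2)%:E)%E.
Proof.
move=> [cf [C fC]]; have cf2 := continuous_sqr _ cf.
have gf2 := bounded_linear_growth _ _ (sqr_le_bounded _ _ fC).
have cavg q D : continuous q -> linear_growth q D -> continuous (heat_avg q s).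
  move=> cq qD x; have := continuous_heat_avg q D cq qD (s, x).
  move=> H; apply: (@continuous_comp _ _ _ (fun y => (s, y))
    (fun p : R * (R * R) => heat_avg q p.1 p.2) x _ H).
  exact: (cvg_pair (cvg_cst s) (@cvg_id _ _)).
pose F (p : plane * plane) : R :=
  heat_kernel p.2 * f (p.1.1 - s * p.2.1, p.1.2 - s * p.2.2) ^+ 2.
have F0 p : 0 <= F p by apply: mulr_ge0; [exact: heat_kernel_ge0|exact: sqr_ge0].
have F0e (p : plane * plane) : (0 <= (EFin \o F) p)%E by rewrite lee_fin.
have mF : measurable_fun setT (EFin \o F).
  apply/measurable_EFinP; apply: measurable_funM.
    apply: (measurableT_comp (f := heat_kernel : plane -> R)) => //.
    exact: continuous_measurable_plane (@continuous_heat_kernel R).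
  apply: (measurableT_comp (f := (fun z => f z ^+ 2) : plane -> R)
    (g := fun p : plane * plane => (p.1.1 - s * p.2.1, p.1.2 - s * p.2.2))).
    exact: continuous_measurable_plane.
  apply: measurable_fun_pair; apply: measurable_funB.
  - by apply: measurableT_comp.
  - by apply: measurable_funM => //; apply: measurableT_comp.
  - by apply: measurableT_comp.
  - by apply: measurable_funM => //; apply: measurableT_comp.
apply: (@le_trans _ _ (\int[@plane_measure R]_x \int[@plane_measure R]_z (F (x, z))%:E)%E).
  apply: ge0_le_integral => //.
  - by move=> x _; rewrite lee_fin sqr_ge0.
  - apply: measurable_EFin_plane; apply: continuous_sqr.
    exact: cavg cf (bounded_linear_growth _ _ fC).
  - exact: (measurable_fun_fubini_tonelli_F (m2 := @plane_measure R) (EFin \o F) mF F0e).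
  - move=> x _; have i2 := integrable_heat_integrand _ _ s x cf2 gf2.
    have -> : (\int[@plane_measure R]_z (F (x, z))%:E = (heat_avg (fun y => f y ^+ 2) s x)%:E)%E.
      by rewrite /heat_avg /Rintegral fineK//; exact: integrable_fin_num.
    by rewrite lee_fin; apply: sqr_heat_avg_le; split => //; exists C.
rewrite [leLHS](fubini_tonelli (m1 := @plane_measure R) (m2 := @plane_measure R) (EFin \o F) mF F0e) /=.
under eq_integral => z _.
  rewrite /F /=; under eq_integral do rewrite EFinM.
  rewrite ge0_integralZl_EFin ?heat_kernel_ge0//; last 2 first.
  - by move=> x _; rewrite lee_fin sqr_ge0.
  - apply: measurable_EFin_plane; apply: continuous_sqr => x.
    apply: continuous_comp2; first exact: cf.
      by apply: continuousB; [exact: cvg_fst|exact: cst_continuous].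
    by apply: continuousB; [exact: cvg_snd|exact: cst_continuous].
  rewrite (ge0_integral_translate (fun y => f y ^+ 2) (- (s * z.1)) (- (s * z.2)))//; last first.
    by move=> y; exact: sqr_ge0.
  over.
rewrite ge0_integralZr//; last 3 first.
- exact: measurable_EFin_plane (@continuous_heat_kernel R).
- by move=> z _; rewrite lee_fin heat_kernel_ge0.
- by apply: integral_ge0 => x _; rewrite lee_fin sqr_ge0.
have -> : (\int[mu2]_z (heat_kernel z)%:E = 1)%E.
  rewrite -integral_heat_kernel /Rintegral fineK//.
  by apply: integrable_fin_num => //; exact: integrable_heat_kernel.
by rewrite mul1e.
Qed.

(** A rotation is a product of three shears, with coefficients [p], [q], [p], where
    [p = (c - 1) / q] is minus the tangent of the half angle. Each shear preserves the integral by
    the affine substitutions with [a = 1]. The division by [q] excludes the angles 0 and pi. *)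
Lemma Rintegral_rotate f (c q : R) : c ^+ 2 + q ^+ 2 = 1 -> q != 0 -> continuous f ->
  \int[mu2]_z f z = \int[mu2]_z f (c * z.1 - q * z.2, q * z.1 + c * z.2).
Proof.
move=> cq q0 cf; pose p := (c - 1) / q.
have cl (a : R) : continuous (fun y : R => a * y).
  by move=> y; apply: cvgM; [exact: cvg_cst|exact: cvg_id].
have shear1 (h : R * R -> R) (a : R) : continuous h ->
    \int[mu2]_z h z = \int[mu2]_z h (z.1 + a * z.2, z.2) /\
    continuous (fun z => h (z.1 + a * z.2, z.2)).
  move=> ch; split.
    rewrite /Rintegral (integral_plane_affine1 h 1 (fun y => a * y))//.
    by congr fine; apply: eq_integral => z _; rewrite !mul1r.
  move=> z; apply: continuous_comp2; [exact: ch| |exact: cvg_snd].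
  apply: continuousD; first exact: cvg_fst.
  by apply: continuousM; [exact: cst_continuous|exact: cvg_snd].
have shear2 (h : R * R -> R) (a : R) : continuous h ->
    \int[mu2]_z h z = \int[mu2]_z h (z.1, z.2 + a * z.1) /\
    continuous (fun z => h (z.1, z.2 + a * z.1)).
  move=> ch; split.
    rewrite /Rintegral (integral_plane_affine2 h 1 (fun y => a * y))//.
    by congr fine; apply: eq_integral => z _; rewrite !mul1r.
  move=> z; apply: continuous_comp2; [exact: ch|exact: cvg_fst|].
  apply: continuousD; first exact: cvg_snd.
  by apply: continuousM; [exact: cst_continuous|exact: cvg_fst].
have [E1 c1] := shear1 _ p cf; have [E2 c2] := shear2 _ q c1.
have [E3 _] := shear1 _ p c2.
rewrite E1 E2 E3; apply: eq_Rintegral => z _ /=; congr (f _).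
have pq : p * q = c - 1 by rewrite /p divfK.
have ppq : p * (p * q) + 2 * p = - q.
  apply: (mulIf q0).
  have -> : (p * (p * q) + 2 * p) * q = (p * q) ^+ 2 + 2 * (p * q) by ring.
  have qq : q ^+ 2 = 1 - c ^+ 2 by rewrite -cq; ring.
  by rewrite pq mulNr -expr2 qq; ring.
congr pair.
  have -> : c * z.1 - q * z.2 = (1 + p * q) * z.1 + (p * (p * q) + 2 * p) * z.2.
    by rewrite ppq pq; ring.
  ring.
have -> : q * z.1 + c * z.2 = q * z.1 + (1 + p * q) * z.2 by rewrite pq; ring.
ring.
Qed.

Lemma eucl_sqr (x : R * R) : eucl x ^+ 2 = x.1 ^+ 2 + x.2 ^+ 2.
Proof. by rewrite /eucl sqr_sqrtr// addr_ge0 ?sqr_ge0. Qed.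

Lemma eucl_ge0 (x : R * R) : 0 <= eucl x.
Proof. exact: sqrtr_ge0. Qed.

Lemma radial_rotate f (c q : R) (x : R * R) : c ^+ 2 + q ^+ 2 = 1 ->
  radially_symmetric f -> f (c * x.1 - q * x.2, q * x.1 + c * x.2) = f x.
Proof.
move=> cq [g fg]; rewrite !fg; congr g; rewrite /eucl/=; congr Num.sqrt.
by rewrite -[RHS]mul1r -cq; ring.
Qed.

Lemma heat_avg_rotate f (c q s : R) (x : R * R) : continuous f ->
  radially_symmetric f -> c ^+ 2 + q ^+ 2 = 1 -> q != 0 ->
  heat_avg f s (c * x.1 - q * x.2, q * x.1 + c * x.2) = heat_avg f s x.
Proof.
move=> cf rf cq q0; rewrite /heat_avg.
rewrite (Rintegral_rotate _ c q)//; last exact: continuous_heat_integrand.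
apply: eq_Rintegral => z _ /=; congr (_ * _).
  rewrite /heat_kernel /gaussian/=; congr (_ * expR (- _)); rewrite !mul1r.
  by rewrite -[RHS]mul1r -cq; ring.
rewrite -[RHS](radial_rotate f c q _ cq rf)/=.
by congr (f _); congr pair; ring.
Qed.

(** Every point is rotated onto the half-line through [(1, 0)], where the average is a function of
    the radius. *)
Lemma radial_heat_avg f (s : R) : continuous f -> radially_symmetric f ->
  radially_symmetric (heat_avg f s).
Proof.
move=> cf rf; exists (fun r => heat_avg f s (r, 0)) => x.
have [x20|x20] := eqVneq x.2 0; last first.
  have r0 : 0 < eucl x.
    by rewrite /eucl sqrtr_gt0 ltr_wpDl ?sqr_ge0// exprn_even_gt0.
  have r0' := lt0r_neq0 r0.
  have H := @heat_avg_rotate f (x.1 / eucl x) (x.2 / eucl x) s (eucl x, 0) cf rf.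
  rewrite -H ?mulf_neq0 ?invr_neq0//=; last first.
    by rewrite !expr_div_n -mulrDl eucl_sqr divff// -eucl_sqr expf_neq0.
  by congr (heat_avg f s _); case: x {H x20 r0} r0' => a b r0'; congr pair => /=; field.
have ex : eucl x = `|x.1| by rewrite /eucl x20 expr0n addr0 sqrtr_sqr.
rewrite ex; case: x x20 {ex} => a b /= ->.
have [a0|a0] := leP 0 a; first by rewrite ger0_norm.
rewrite ltr0_norm//.
(* The half turn has sine 0 and is not covered by the rotation lemma; two quarter turns replace
   it. *)
have H y := @heat_avg_rotate f 0 1 s y cf rf.
rewrite -[RHS]H ?oner_eq0// ?expr0n ?expr1n ?add0r// -[RHS]H ?oner_eq0// ?expr0n ?expr1n ?add0r//=.
by congr (heat_avg f s _); congr pair; ring.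
Qed.

Lemma continuous_plane_affine1 f (a : R) (g : R -> R) : continuous g -> continuous f ->
  continuous (fun z => a * f (a * z.1 + g z.2, z.2)).
Proof.
move=> cg cf z; apply: cvgM; first exact: cvg_cst.
apply: continuous_comp2; [exact: cf| |exact: cvg_snd].
apply: continuousD; last by apply: continuous_comp; [exact: cvg_snd|exact: cg].
by apply: continuousM; [exact: cst_continuous|exact: cvg_fst].
Qed.

(** Substituting [y = s z], one coordinate at a time, gives the Jacobian [s ^+ 2 = 4 nu t]; it
    cancels the prefactor up to the [pi^-1] of [heat_kernel]. *)
Lemma heat_potentialE f (nu t C : R) : 0 < nu -> 0 < t -> continuous f ->
  linear_growth f C ->
  heat_potential nu f t = heat_avg f (Num.sqrt (4 * nu * t)).
Proof.
move=> nu0 t0 cf fC; apply/funext => x; rewrite /heat_potential.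
set s := Num.sqrt _.
have s2 : s ^+ 2 = 4 * nu * t by rewrite sqr_sqrtr// !mulr_ge0// ltW.
have s0 : 0 < s by rewrite sqrtr_gt0 !mulr_gt0.
pose F (y : R * R) : R := gaussian (4 * nu * t)^-1 y * f (x.1 - y.1, x.2 - y.2).
have cF : continuous F.
  move=> y; apply: continuousM; first exact: continuous_gaussian.
  apply: continuous_comp2; first exact: cf.
    by apply: continuousB; [exact: cst_continuous|exact: cvg_fst].
  by apply: continuousB; [exact: cst_continuous|exact: cvg_snd].
have -> : \int[@plane_measure R]_y
   (expR (- (eucl y ^+ 2 / (4 * nu * t))) * f (x - y)) = \int[mu2]_y F y.
  apply: eq_Rintegral => y _; rewrite /F /gaussian eucl_sqr.
  by congr (expR (- _) * _); rewrite mulrC.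
have -> : \int[mu2]_y F y = \int[mu2]_y (s * (s * F (s * y.1, s * y.2))).
  have c0 : continuous (cst 0 : R -> R) by move=> ?; exact: cst_continuous.
  have cF1 : continuous (fun z : R * R => s * F (s * z.1 + (cst 0 : R -> R) z.2, z.2)).
    exact: continuous_plane_affine1.
  rewrite /Rintegral (integral_plane_affine1 F s _ s0 c0 cF).
  rewrite (integral_plane_affine2 _ s _ s0 c0 cF1) /=.
  by congr fine; apply: eq_integral => z _; rewrite !addr0.
have -> : \int[mu2]_y (s * (s * F (s * y.1, s * y.2))) =
    \int[mu2]_y ((4 * pi * nu * t) * (heat_kernel y * f (x.1 - s * y.1, x.2 - s * y.2))).
  apply: eq_Rintegral => y _; rewrite /F /heat_kernel/=.
  have -> : gaussian (4 * nu * t)^-1 (s * y.1, s * y.2) = gaussian 1 y.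
    rewrite /gaussian/=; congr (expR (- _)); rewrite !exprMn s2; field.
    by rewrite !lt0r_neq0.
  have alg (g h p : R) : p != 0 ->
      s * (s * (g * h)) = 4 * p * nu * t * (p^-1 * g * h).
    by move=> p0; rewrite mulrA -expr2 s2; field.
  by apply: alg; rewrite lt0r_neq0// pi_gt0.
rewrite RintegralZl//; last exact: integrable_heat_integrand cf fC.
by rewrite mulrA mulVf ?mul1r// !mulf_neq0// lt0r_neq0// pi_gt0.
Qed.

End heat_symmetry.

(** * The Euclidean norm, its derivatives, and elementary estimates for radial functions *)

Section chain.
Context {R : realType}.
Implicit Types f : R * R -> R.

Lemma is_derive_comp_dir f (p : R -> R) (j : 'I_3) (x : R * R) (d d' : R) :
  is_derive x (dir R j) f d -> is_derive (f x) (1 : R) p d' ->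
  is_derive x (dir R j) (p \o f) (d' * d).
Proof.
move=> df dp; apply: is_derive_of_along.
have D0 : is_derive (0 : R) (1 : R)
    (fun s => f (x.1 + s * (dir R j).1, x.2 + s * (dir R j).2)) d.
  have := is_derive_along f j x 0; rewrite !mul0r !addr0 -surjective_pairing.
  by rewrite /pd (is_derive_val _ _ _ _ _ _ df); apply; exact: is_derive_derivable df.
apply: (@is_derive1_comp _ p (fun s => f (x.1 + s * (dir R j).1, x.2 + s * (dir R j).2)) 0 _ _ _ D0).
by rewrite !mul0r !addr0 -surjective_pairing.
Qed.

Lemma eucl_gt0 (x : R * R) : x != 0 -> 0 < eucl x.
Proof.
move=> x0; rewrite lt0r eucl_ge0 andbT; apply: contra x0 => /eqP e0.
have /eqP : x.1 ^+ 2 + x.2 ^+ 2 = 0 by rewrite -eucl_sqr e0 expr0n.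
rewrite paddr_eq0 ?sqr_ge0// !sqrf_eq0 => /andP[/eqP a /eqP b].
by rewrite (surjective_pairing x) a b.
Qed.

Lemma is_derive_sqrt_sum (a y : R) : 0 < a ^+ 2 + y ^+ 2 ->
  is_derive a (1 : R) (fun s => Num.sqrt (s ^+ 2 + y ^+ 2)) (a / Num.sqrt (a ^+ 2 + y ^+ 2)).
Proof.
move=> r0.
have D0 : is_derive a (1 : R) (fun s : R => s ^+ 2 + y ^+ 2) (2 * a).
  have := is_deriveD (is_deriveM (is_derive_id a (1 : R)) (is_derive_id a (1 : R)))
    (is_derive_cst (y ^+ 2) a (1 : R)).
  by congr is_derive; rewrite -![_ *: _]/(_ * _); ring.
have := @is_derive1_comp _ (@Num.sqrt R) (fun s : R => s ^+ 2 + y ^+ 2) a _ _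
  (is_derive1_sqrt r0) D0.
congr is_derive; field.
by rewrite lt0r_neq0// sqrtr_gt0.
Qed.

Lemma continuous_eucl : continuous (@eucl R).
Proof.
move=> x; apply: (@continuous_comp _ _ _ (fun x : R * R => x.1 ^+ 2 + x.2 ^+ 2)
  (@Num.sqrt R)); last exact: sqrt_continuous.
by apply: cvgD; apply: cvgM; first [exact: cvg_fst|exact: cvg_snd].
Qed.

Lemma is_derive_eucl1 (x : R * R) : x != 0 ->
  is_derive x (dir R 0) (@eucl R) (x.1 / eucl x).
Proof.
move=> /eucl_gt0; case: x => a b x0; apply: is_derive_of_slice1.
by apply: is_derive_sqrt_sum; rewrite -(eucl_sqr (a, b)) exprn_gt0.
Qed.

Lemma is_derive_eucl2 (x : R * R) : x != 0 ->
  is_derive x (dir R 1) (@eucl R) (x.2 / eucl x).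
Proof.
move=> /eucl_gt0; case: x => a b x0; apply: is_derive_of_slice2.
have r0 : 0 < b ^+ 2 + a ^+ 2 by rewrite addrC -(eucl_sqr (a, b)) exprn_gt0.
rewrite /eucl/=; have := is_derive_sqrt_sum b a r0; rewrite addrC.
congr is_derive.
by apply/funext => s; rewrite addrC.
Qed.

(** Serves where the chain rule breaks down: for the pressure at the origin, where [eucl] is not
    differentiable, and for the squared positive part at 0. *)
Lemma is_derive_quadratic (q : R -> R) (C : R) : (forall s, `|q s| <= C * s ^+ 2) ->
  is_derive (0 : R) (1 : R) q 0.
Proof.
move=> qC; have q0 : q 0 = 0.
  by apply/eqP; rewrite -normr_le0 (le_trans (qC 0))// expr0n mulr0.
suff L : h^-1 *: (q (h *: 1 + 0) - q 0) @[h --> (0 : R)^'] --> (0 : R).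
  by split; [apply/cvg_ex; eexists; exact: L|exact/cvg_lim].
have C0 : 0 <= C by have := qC 1; rewrite expr1n mulr1; exact: le_trans.
apply/cvgrPdist_le => e e0; near=> h.
have h0 : h != 0 by near: h; exact: nbhs_dnbhs_neq.
rewrite q0 subr0 addr0 sub0r normrN -[h *: 1]/(h * 1) mulr1 -[_ *: _]/(_ * _).
rewrite normrM normfV ler_pdivrMl ?normr_gt0//.
rewrite (le_trans (qC h))// -real_normK ?num_real// expr2 mulrA mulrC ler_wpM2l//.
have : `|h| <= e / (C + 1).
  near: h; apply: dnbhs0_le; rewrite divr_gt0// ltr_wpDl//.
rewrite ler_pdivlMr ?ltr_wpDl//; apply: le_trans.
by rewrite mulrC ler_wpM2l// lerDl.
Unshelve. all: end_near. Qed.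

Lemma is_derive_idM (g : R -> R) (a d : R) : is_derive a (1 : R) g d ->
  is_derive a (1 : R) (fun s => s * g s) (g a + a * d).
Proof.
move=> dg; have := is_deriveM (is_derive_id a (1 : R)) dg.
by congr is_derive; rewrite -![_ *: _]/(_ * _) mulr1 addrC.
Qed.

Lemma normr_sub_squeeze (a b c e : R) :
  a = 0 -> 0 <= b -> b <= c -> `|c| <= e -> `|a - b| <= e.
Proof.
move=> -> b0 bc ce; rewrite sub0r normrN ger0_norm//.
exact: le_trans bc (le_trans (ler_norm _) ce).
Qed.

(** Used with [a] the radial derivative divided by the radius and [b], [c] the coordinates: it
    compares [d_1 P] with the squared gradient. The core is [b <= b^2 + c^2] as soon as [c >= 1]. *)
Lemma slab_le (a b c : R) : 0 <= b -> 1 <= c ->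
  0 <= a ^+ 2 * b <= (a * b) ^+ 2 + (a * c) ^+ 2.
Proof.
move=> b0 c1; rewrite mulr_ge0 ?sqr_ge0//= !exprMn -mulrDr ler_wpM2l ?sqr_ge0//.
have hb : 0 <= (b - 2^-1) ^+ 2 by exact: sqr_ge0.
have hc : 0 <= (c - 1) * (c + 1) by apply: mulr_ge0; lra.
lra.
Qed.

Lemma integral_itv12_cst (c : R) :
  (\int[@lebesgue_measure R]_(y in `[1%R, 2%R]) c%:E = c%:E)%E.
Proof.
rewrite integral_cst//= lebesgue_measure_itv/= lte_fin ltr1n -EFinB -EFinM.
by congr EFin; ring.
Qed.

Lemma le_eucl1 (r y : R) : 0 <= r -> r <= eucl (r, y).
Proof.
move=> r0; rewrite /eucl/= -[leLHS]ger0_norm// -sqrtr_sqr ler_sqrt.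
  by rewrite lerDl sqr_ge0.
by rewrite addr_ge0 ?sqr_ge0.
Qed.

Lemma eucl_0y (y : R) : 0 <= y -> eucl (0, y) = y.
Proof. by move=> y0; rewrite /eucl/= expr0n add0r sqrtr_sqr ger0_norm. Qed.

End chain.

(** * The pressure of a radial flow: Euler equations, regularity at the origin, boundedness *)

Section radial_pressure.
Context {R : realType}.
Local Notation mu := (@lebesgue_measure R).
Local Notation mu2 := (mu \x mu)%E.
Variables (psi : R * R -> R) (D E : R).
Hypothesis psi_radial : radially_symmetric psi.
Hypothesis d1 : forall j x, derivable psi x (dir R j).
Hypothesis c1 : forall j, continuous (pd j psi).
Hypothesis d2 : forall j k x, derivable (pd j psi) x (dir R k).
Hypothesis c2 : forall j k, continuous (pd k (pd j psi)).
Hypothesis d2_bounded : forall x, `|pd 0 (pd 0 psi) x| <= D.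
Hypothesis energy_le :
  (\int[@plane_measure R]_x (pd 0 psi x ^+ 2 + pd 1 psi x ^+ 2)%:E <= E%:E)%E.

Let h (r : R) : R := pd 0 psi (r, 0).

Let psiE x : psi x = psi (eucl x, 0).
Proof.
have [g pg] := psi_radial; rewrite !pg; congr g.
by rewrite [RHS]/eucl /= expr0n addr0 sqrtr_sqr ger0_norm ?eucl_ge0.
Qed.

Let dG r : is_derive r (1 : R) (fun s => psi (s, 0)) (h r).
Proof. exact: is_derive_slice1. Qed.

(** The function [s |-> psi (s, 0)] is even, so its derivative vanishes at 0. This is what makes
    [h s ^+ 2 / s] harmless near the origin. *)
Let h0 : h 0 = 0.
Proof.
have dN : is_derive (0 : R) (1 : R) (fun s : R => - s) (- 1) by exact: is_deriveNid.
have dG0 : is_derive (- 0 : R) (1 : R) (fun s => psi (s, 0)) (h 0) by rewrite oppr0.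
have D1 := @is_derive1_comp _ (fun s => psi (s, 0)) (fun s => - s) 0 _ _ dG0 dN.
have EE : (fun s => psi (s, 0)) \o (fun s => - s) = (fun s => psi (s, 0)).
  by apply/funext => s /=; rewrite psiE [RHS]psiE /eucl/= sqrrN.
rewrite EE in D1; have := is_derive_val _ _ _ _ _ _ D1.
rewrite (is_derive_val _ _ _ _ _ _ (dG 0)) mulrN1 => H; lra.
Qed.

Let D_ge0 : 0 <= D. Proof. exact: le_trans (d2_bounded 0). Qed.

Let h_le r : `|h r| <= D * `|r|.
Proof.
have [c _] := mean_value1 (pd 0 psi) 0 r 0 (fun x => d2 0 0 (x, 0)).
rewrite add0r -/(h 0) -/(h r) h0 subr0 => ->.
by rewrite normrM ler_wpM2r.
Qed.

Let ch : continuous h.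
Proof.
move=> r; apply: continuous_comp2; [exact: c1|exact: cvg_id|exact: cst_continuous].
Qed.

Let pd_psi1 x : pd 0 psi x = h (eucl x) / eucl x * x.1.
Proof.
have EE : psi = (fun s => psi (s, 0)) \o (@eucl R) by apply/funext => y; exact: psiE.
have [->|x0] := eqVneq x 0.
  by rewrite mulr0; exact: h0.
have := is_derive_comp_dir _ _ _ _ _ _ (is_derive_eucl1 _ x0) (dG (eucl x)).
rewrite -EE => /is_derive_val; rewrite -/(pd 0 psi x) => ->.
by rewrite mulrA mulrAC.
Qed.

Let pd_psi2 x : pd 1 psi x = h (eucl x) / eucl x * x.2.
Proof.
have EE : psi = (fun s => psi (s, 0)) \o (@eucl R) by apply/funext => y; exact: psiE.
have [->|x0] := eqVneq x 0.
  rewrite mulr0.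
  have := is_derive_slice2 _ _ _ (d1 1 ((0 : R), (0 : R))).
  have -> : (fun s => psi (0, s)) = (fun s => psi (s, 0)).
    by apply/funext => s; rewrite psiE [RHS]psiE /eucl/= addrC.
  move=> /is_derive_val; rewrite (is_derive_val _ _ _ _ _ _ (dG 0)) h0.
  by move=> <-.
have := is_derive_comp_dir _ _ _ _ _ _ (is_derive_eucl2 _ x0) (dG (eucl x)).
rewrite -EE => /is_derive_val; rewrite -/(pd 1 psi x) => ->.
by rewrite mulrA mulrAC.
Qed.

(** At [s = 0] the convention [0^-1 = 0] gives the value 0, which is also the limit because [|k s|]
    is at most [D ^+ 2 * |s|]. Hence [k] is continuous on the whole line. *)
Let k (s : R) : R := h s ^+ 2 / s.

Let k_le s : `|k s| <= D ^+ 2 * `|s|.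
Proof.
rewrite /k; have [->|s0] := eqVneq s 0; first by rewrite invr0 mulr0 normr0 mulr0.
rewrite normrM normfV ler_pdivrMr ?normr_gt0// normrX -mulrA -expr2 -exprMn.
by rewrite ler_sqr ?nnegrE ?mulr_ge0// h_le.
Qed.

Let k_ge0 s : 0 <= s -> 0 <= k s.
Proof. by move=> s0; rewrite /k divr_ge0// sqr_ge0. Qed.

Let k0 : k 0 = 0. Proof. by rewrite /k invr0 mulr0. Qed.

Let ck : continuous k.
Proof.
move=> s; have [->|s0] := eqVneq s 0; last first.
  apply: cvgM; first by apply: cvgM; exact: ch.
  by apply: cvgV => //; exact: cvg_id.
apply/cvgrPdist_le => /= e e0; near=> t.
rewrite k0 sub0r normrN (le_trans (k_le t))//.
have : `|t| <= e / (D ^+ 2 + 1).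
  near: t; exists (e / (D ^+ 2 + 1)); first by rewrite /= divr_gt0// ltr_wpDl ?sqr_ge0.
  by move=> t; rewrite /= sub0r normrN; exact: ltW.
rewrite ler_pdivlMr ?ltr_wpDl ?sqr_ge0//; apply: le_trans.
by rewrite mulrC ler_wpM2l// lerDl.
Unshelve. all: end_near. Qed.

Let p (r : R) : R := \int[mu]_(s in `[0, r]) k s.

Let ik (r : R) : mu.-integrable `[0, r] (EFin \o k).
Proof.
apply: continuous_compact_integrable; first exact: segment_compact.
exact: continuous_subspaceT.
Qed.

Let pE r : (p r)%:E = (\int[mu]_(s in `[0%R, r]) (k s)%:E)%E.
Proof. by rewrite /p /Rintegral fineK//; apply: integrable_fin_num. Qed.

Let dp (r : R) : 0 < r -> is_derive r (1 : R) p (k r).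
Proof.
move=> r0; have rr : r < r + 1 by rewrite ltrDl.
have [dpr pr] := continuous_FTC1_closed rr (ik (r + 1)) r0 (@ck r).
by split; [exact: dpr|rewrite -derive1E; exact: pr].
Qed.

Let p_mono a b : a <= b -> p a <= p b.
Proof.
move=> ab; rewrite -lee_fin !pE; apply: ge0_subset_integral => //.
- by have /integrableP[] := ik b.
- by move=> x /=; rewrite in_itv/= => /andP[x0 _]; rewrite lee_fin k_ge0.
- by move=> x /=; rewrite !in_itv/= => /andP[-> /le_trans]; apply.
Qed.

Let p_ge0 r : 0 <= p r.
Proof.
by apply: Rintegral_ge0 => x /=; rewrite in_itv/= => /andP[x0 _]; exact: k_ge0.
Qed.

Let p_le r : 0 <= r -> p r <= D ^+ 2 * r ^+ 2.
Proof.
move=> r0; have H : p r <= \int[mu]_(s in `[0, r]) (cst (D ^+ 2 * r)) s.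
  apply: le_Rintegral => //.
    apply: continuous_compact_integrable; first exact: segment_compact.
    by apply: continuous_subspaceT => x; exact: cst_continuous.
  move=> x /=; rewrite in_itv/= => /andP[x0 xr].
  rewrite (le_trans (ler_norm _))// (le_trans (k_le x))// ger0_norm//.
  by rewrite ler_wpM2l// sqr_ge0.
apply: (le_trans H); rewrite Rintegral_cst//= lebesgue_measure_itv/= lte_fin.
case: ltP => [_|r0']; first by rewrite -EFinB/= subr0 expr2 mulrA.
by rewrite mulr0 mulr_ge0 ?sqr_ge0.
Qed.

Let P (x : R * R) : R := p (eucl x).

Let pd_P_at0 (j : 'I_3) : is_derive (0 : R * R) (dir R j) P 0.
Proof.
apply: is_derive_of_along; apply: (@is_derive_quadratic _ _ (D ^+ 2 * 2)) => s.
rewrite ger0_norm ?p_ge0// (le_trans (p_le _ (eucl_ge0 _)))//.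
rewrite eucl_sqr/= !add0r -mulrA ler_wpM2l ?sqr_ge0//.
have [e1 e2] := @dir_sqr_le1 R j.
rewrite !exprMn -mulrDr mulrC ler_wpM2r ?sqr_ge0//.
by rewrite (le_trans (lerD e1 e2)).
Qed.

Let dP1 x : is_derive x (dir R 0) P (h (eucl x) ^+ 2 / eucl x ^+ 2 * x.1).
Proof.
have [->|x0] := eqVneq x 0; first by rewrite mulr0; exact: pd_P_at0.
have := is_derive_comp_dir _ _ _ _ _ _ (is_derive_eucl1 _ x0) (dp (eucl x) (eucl_gt0 _ x0)).
congr is_derive; rewrite /k; field; exact: lt0r_neq0 (eucl_gt0 _ x0).
Qed.

Let dP2 x : is_derive x (dir R 1) P (h (eucl x) ^+ 2 / eucl x ^+ 2 * x.2).
Proof.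
have [->|x0] := eqVneq x 0; first by rewrite mulr0; exact: pd_P_at0.
have := is_derive_comp_dir _ _ _ _ _ _ (is_derive_eucl2 _ x0) (dp (eucl x) (eucl_gt0 _ x0)).
congr is_derive; rewrite /k; field; exact: lt0r_neq0 (eucl_gt0 _ x0).
Qed.

(** The angular derivative of a radial function vanishes. Differentiating this identity in each
    coordinate gives the very combinations of second derivatives that occur in the convective term,
    so no radial second derivative is computed and the origin needs no separate case. *)
Let tangential x : x.2 * pd 0 psi x - x.1 * pd 1 psi x = 0.
Proof. by rewrite pd_psi1 pd_psi2; ring. Qed.

Let tangential1 x :
  x.2 * pd 0 (pd 0 psi) x - (pd 1 psi x + x.1 * pd 0 (pd 1 psi) x) = 0.
Proof.
case: x => a b.
have D1 := is_deriveZ b (is_derive_slice1 _ _ _ (d2 0 0 (a, b))).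
have D2 := is_derive_idM _ _ _ (is_derive_slice1 _ _ _ (d2 1 0 (a, b))).
rewrite -[LHS](is_derive_val _ _ _ _ _ _ (is_deriveB D1 D2)).
rewrite (_ : _ - _ = cst 0) ?derive_cst//.
by apply/funext => s; exact: (tangential (s, b)).
Qed.

Let tangential2 x :
  (pd 0 psi x + x.2 * pd 1 (pd 0 psi) x) - x.1 * pd 1 (pd 1 psi) x = 0.
Proof.
case: x => a b.
have D1 := is_deriveZ a (is_derive_slice2 _ _ _ (d2 1 1 (a, b))).
have D2 := is_derive_idM _ _ _ (is_derive_slice2 _ _ _ (d2 0 1 (a, b))).
rewrite -[LHS](is_derive_val _ _ _ _ _ _ (is_deriveB D2 D1)).
rewrite (_ : _ - _ = cst 0) ?derive_cst//.
by apply/funext => s; exact: (tangential (a, s)).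
Qed.

Let schwarz_psi : pd 0 (pd 1 psi) = pd 1 (pd 0 psi).
Proof. by apply: schwarz. Qed.

Let euler1 x : pd 1 psi x * pd 0 (pd 1 psi) x - pd 0 psi x * pd 1 (pd 1 psi) x +
  pd 0 P x = 0.
Proof.
rewrite [X in _ + X](is_derive_val _ _ _ _ _ _ (dP1 x)).
have := tangential2 x; rewrite schwarz_psi.
move: (pd 1 (pd 0 psi) x) (pd 1 (pd 1 psi) x) => m q.
rewrite pd_psi1 pd_psi2 -expr_div_n; move: (h (eucl x) / eucl x) => a H.
rewrite (_ : _ + _ = a * (a * x.1 + x.2 * m - x.1 * q)); last by ring.
by rewrite H mulr0.
Qed.

Let euler2 x : - (pd 1 psi x * pd 0 (pd 0 psi) x) + pd 0 psi x * pd 1 (pd 0 psi) x +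
  pd 1 P x = 0.
Proof.
rewrite [X in _ + X](is_derive_val _ _ _ _ _ _ (dP2 x)).
have := tangential1 x; rewrite schwarz_psi.
move: (pd 1 (pd 0 psi) x) (pd 0 (pd 0 psi) x) => m q.
rewrite pd_psi1 pd_psi2 -expr_div_n; move: (h (eucl x) / eucl x) => a H.
rewrite (_ : _ + _ = - (a * (x.2 * q - (a * x.2 + x.1 * m)))); last by ring.
by rewrite H mulr0 oppr0.
Qed.

(** Continuity is read off the Euler equation, whose other terms are polynomial in derivatives of
    [psi]; the explicit formula has a quotient by the radius. *)
Let continuous_pdP0 : continuous (pd 0 P).
Proof.
have -> : pd 0 P = (fun x => pd 0 psi x * pd 1 (pd 1 psi) x - pd 1 psi x * pd 0 (pd 1 psi) x).
  apply/funext => x; apply/eqP; rewrite -subr_eq0 opprB addrC.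
  by apply/eqP; exact: euler1.
by move=> x; apply: cvgB; apply: cvgM; [exact: (c1 0 x)|exact: (c2 1 1 x)|exact: (c1 1 x)|exact: (c2 1 0 x)].
Qed.

Let continuous_pdP1 : continuous (pd 1 P).
Proof.
have -> : pd 1 P = (fun x => pd 1 psi x * pd 0 (pd 0 psi) x - pd 0 psi x * pd 1 (pd 0 psi) x).
  apply/funext => x; apply/eqP; rewrite -subr_eq0 opprB addrC (addrC (pd 0 psi x * _)).
  by apply/eqP; exact: euler2.
by move=> x; apply: cvgB; apply: cvgM; [exact: (c1 1 x)|exact: (c2 0 0 x)|exact: (c1 0 x)|exact: (c2 0 1 x)].
Qed.

(** The fundamental theorem is applied to [p] at positive radii only; at the origin the bound
    [p r <= D ^+ 2 * r ^+ 2] squeezes. *)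
Let cP : continuous P.
Proof.
move=> x; have [->|x0] := eqVneq x 0; last first.
  apply: (@continuous_comp _ _ _ (@eucl R) p x); first exact: continuous_eucl.
  exact: is_derive_continuous (dp _ (eucl_gt0 _ x0)).
have e0 : eucl (0 : R * R) = 0.
  by rewrite /eucl/= expr0n addr0 sqrtr0.
have p0 : p 0 = 0.
  apply/eqP; rewrite eq_le p_ge0 andbT.
  by have := p_le 0 (lexx 0); rewrite expr0n mulr0.
have cq : (fun x : R * R => D ^+ 2 * eucl x ^+ 2) y @[y --> (0 : R * R)] --> (0 : R).
  have <- : D ^+ 2 * eucl (0 : R * R) ^+ 2 = 0 by rewrite e0 expr0n mulr0.
  apply: cvgM; first exact: cvg_cst.
  by apply: cvgM; exact: continuous_eucl.
have PP0 : P 0 = 0 by rewrite -p0 -e0.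
apply/cvgrPdist_le => /= e e_gt0; move/cvgrPdist_le : cq => /(_ e e_gt0).
apply: filterS => y /=; rewrite sub0r normrN => H.
exact: normr_sub_squeeze PP0 (p_ge0 _) (p_le _ (eucl_ge0 y)) H.
Qed.

Let grad2 (x : R * R) := pd 0 psi x ^+ 2 + pd 1 psi x ^+ 2.

Let continuous_grad2 : continuous grad2.
Proof.
by move=> x; apply: cvgD; apply: cvgM; [exact: (c1 0 x)|exact: (c1 0 x)|exact: (c1 1 x)|exact: (c1 1 x)].
Qed.

Let grad2_ge0 x : 0 <= grad2 x. Proof. by rewrite addr_ge0 ?sqr_ge0. Qed.

Let E_ge0 : 0 <= E.
Proof.
rewrite -lee_fin; apply: le_trans energy_le; apply: integral_ge0 => x _.
by rewrite lee_fin grad2_ge0.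
Qed.

(* For [1 <= y] one has [0 <= d_1 P (s, y) <= |grad psi (s, y)|^2], so integrating over the
   slab [0, r] x [1, 2] bounds the growth of [p] by the energy. *)
Let pd_P_slab x : 0 <= x.1 -> 1 <= x.2 -> 0 <= pd 0 P x <= grad2 x.
Proof.
move=> x1 x2; rewrite [pd 0 P x](is_derive_val _ _ _ _ _ _ (dP1 x)).
rewrite /grad2 pd_psi1 pd_psi2 -expr_div_n.
exact: slab_le.
Qed.

Let p_slab r : 0 <= r -> p r - p 2 <= E.
Proof.
move=> r0; have dP x := is_derive_derivable _ _ _ _ _ _ (dP1 x).
have mr : measurable (rect 0 r 1 2) by exact: measurable_rect.
rewrite -lee_fin; apply: le_trans energy_le.
have H1 : (\int[mu2]_(z in rect 0 r 1 2) (pd 0 P z)%:E <=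
    \int[@plane_measure R]_x (grad2 x)%:E)%E.
  apply: (@le_trans _ _ (\int[mu2]_(z in rect 0%R r 1%R 2%R) (grad2 z)%:E)%E).
    apply: ge0_le_integral; first exact: mr.
    - move=> [a b] [/=]; rewrite !in_itv/= => /andP[a0 _] /andP[b1 _].
      by rewrite lee_fin; case/andP: (pd_P_slab (a, b) a0 b1).
    - exact: measurable_funTS (measurable_EFin_plane _ continuous_pdP0).
    - exact: measurable_funTS (measurable_EFin_plane _ continuous_grad2).
    - move=> [a b] [/=]; rewrite !in_itv/= => /andP[a0 _] /andP[b1 _].
      by rewrite lee_fin; case/andP: (pd_P_slab (a, b) a0 b1).
  apply: ge0_subset_integral; [exact: mr|exact: measurableT| | |].
  - exact: (measurable_EFin_plane _ continuous_grad2).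
  - by move=> x _; rewrite lee_fin; exact: grad2_ge0.
  - exact: subsetT.
apply: le_trans H1; rewrite (integral_rect21 _ 0 r 1 2 continuous_pdP0).
under eq_integral do rewrite (FTC2_slice1 _ _ _ _ r0 dP continuous_pdP0).
(* The interval [1, 2] has length 1. On it [P (r, y) >= p r], as the norm is at least [r], and
   [P (0, y) = p y <= p 2]. *)
have -> : ((p r - p 2)%:E = \int[mu]_(y in `[1%R, 2%R]) (p r - p 2)%:E)%E.
  by rewrite integral_itv12_cst.
have cPs (a : R) : continuous (fun y => P (a, y)).
  by move=> y; apply: continuous_comp2; [exact: cP|exact: cst_continuous|exact: cvg_id].
apply: le_integral; first exact: measurable_itv.
- apply: continuous_compact_integrable; first exact: segment_compact.
  by apply: continuous_subspaceT => y; exact: cst_continuous.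
- apply: continuous_compact_integrable; first exact: segment_compact.
  by apply: continuous_subspaceT => y; apply: cvgB; exact: cPs.
move=> y; rewrite inE/= in_itv/= => /andP[y1 y2]; rewrite lee_fin; apply: lerB.
  exact/p_mono/le_eucl1.
by apply: p_mono; rewrite eucl_0y; [exact: y2|exact: le_trans ler01 y1].
Qed.

Lemma radial_pressure : exists P0 : R * R -> R,
  [/\ Ck 1 P0,
      forall x, pd 1 psi x * pd 0 (pd 1 psi) x - pd 0 psi x * pd 1 (pd 1 psi) x +
        pd 0 P0 x = 0,
      forall x, - (pd 1 psi x * pd 0 (pd 0 psi) x) + pd 0 psi x * pd 1 (pd 0 psi) x +
        pd 1 P0 x = 0
    & forall x, `|P0 x| <= 4 * D ^+ 2 + E].
Proof.
exists P; split; [|exact: euler1|exact: euler2|].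
- case=> [|j [|//]] _; first by split; [exact: cP|move=> _; apply: ord3_ind => x;
    [exact: is_derive_derivable (dP1 x)|exact: is_derive_derivable (dP2 x)|exact: derivable0]].
  split; last by move=> H; exact: False_ind (notF H).
  move: j; apply: ord3_ind;
    [exact: continuous_pdP0|exact: continuous_pdP1|].
  rewrite /= (_ : pd 2 P = cst 0); last by apply/funext => x; exact: pd2.
  by move=> x; exact: cst_continuous.
(* The constant is [p 2 <= D ^+ 2 * 2 ^+ 2] plus the growth beyond radius 2, at most [E]. *)
- move=> x; rewrite [`|_|]ger0_norm; last exact: p_ge0.
  have alg (a b c : R) : a - b <= E -> b <= c * 2 ^+ 2 -> a <= 4 * c + E by lra.
  exact: alg (p_slab _ (eucl_ge0 x)) (p_le 2 (ler0n R 2)).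
Qed.

End radial_pressure.

(** * Automation for continuity of polynomial expressions *)

Section continuity.
Context {R : realType} {T : topologicalType}.
Implicit Types f g : T -> R.

Lemma continuous_add f g : continuous f -> continuous g -> continuous (fun x => f x + g x).
Proof. by move=> cf cg x; apply: cvgD; [exact: cf|exact: cg]. Qed.

Lemma continuous_mul f g : continuous f -> continuous g -> continuous (fun x => f x * g x).
Proof. by move=> cf cg x; apply: cvgM; [exact: cf|exact: cg]. Qed.

Lemma continuous_opp f : continuous f -> continuous (fun x => - f x).
Proof. by move=> cf x; apply: cvgN; exact: cf. Qed.

Lemma continuous_const (c : R) : continuous (fun _ : T => c).
Proof. by move=> x; exact: cvg_cst. Qed.

Lemma continuous_expn f n : continuous f -> continuous (fun x => f x ^+ n).
Proof.
move=> cf x; apply: (@continuous_comp _ _ _ f (fun y => y ^+ n)); first exact: cf.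
exact: exprn_continuous.
Qed.

End continuity.

(** Second-order patterns recover the operands as functions, so each lemma is applied with explicit
    arguments. The leaves are closed by hypotheses, which is why continuity facts are put in the
    context before each call of [continuity]. *)
Ltac continuity_step h :=
  lazymatch h with
  | (fun x => @?f x + @?g x) => apply: (@continuous_add _ _ f g)
  | (fun x => - @?f x) => apply: (@continuous_opp _ _ f)
  | (fun x => @?f x * @?g x) => apply: (@continuous_mul _ _ f g)
  | (fun x => @?f x ^+ ?n) => apply: (@continuous_expn _ _ f n)
  | (fun x => ?c) => apply: (@continuous_const _ _ c)
  end.

Ltac continuity :=
  repeat match goal with
  | |- forall x, continuous_at x ?h => continuity_step h
  | _ => assumption
  end.

(** * The local energy balance as pointwise algebra *)

Section flux.
Context {R : realType}.

(** One component of the energy flux of [w]: [c] is the squared cutoff, [a0], [a1] the derivatives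
    of [w] in the direction considered, [b] the advecting component, [q] the pressure and [s] the
    component of [w]. The result is arranged as [energy_dissipation] expects it. *)
Lemma is_derive_flux (V : normedModType R) (x v : V) (nu : R)
    (c w0 w1 a0 a1 b q s : V -> R) (dc dw0 dw1 da0 da1 db dq ds : R) :
  is_derive x v c dc -> is_derive x v w0 dw0 -> is_derive x v w1 dw1 ->
  is_derive x v a0 da0 -> is_derive x v a1 da1 -> is_derive x v b db ->
  is_derive x v q dq -> is_derive x v s ds ->
  is_derive x v
    (fun x => c x * (nu * (w0 x * a0 x + w1 x * a1 x)
      - 2^-1 * ((w0 x * w0 x + w1 x * w1 x) * b x) - q x * s x))
    (dc * (nu * (w0 x * a0 x + w1 x * a1 x)
      - 2^-1 * ((w0 x * w0 x + w1 x * w1 x) * b x) - q x * s x) +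
     c x * (nu * (dw0 * a0 x + w0 x * da0 + dw1 * a1 x + w1 x * da1)
      - (w0 x * dw0 + w1 x * dw1) * b x - 2^-1 * ((w0 x * w0 x + w1 x * w1 x) * db)
      - dq * s x - q x * ds)).
Proof.
move=> Dc D0 D1 Da0 Da1 Db Dq Ds.
have H := is_deriveM Dc (is_deriveB (is_deriveB
  (is_deriveZ nu (is_deriveD (is_deriveM D0 Da0) (is_deriveM D1 Da1)))
  (is_deriveZ 2^-1 (is_deriveM (is_deriveD (is_deriveM D0 D0) (is_deriveM D1 D1)) Db)))
  (is_deriveM Dq Ds)).
move: H; congr is_derive; rewrite /= -![_ *: _]/(_ * _).
rewrite !fctE -[(nu \*: _) x]/(nu * _) -[(2^-1 \*: _) x]/(2^-1 * _) /=; by field.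
Qed.

(** The balance multiplied by [th ^+ 2]: the two flux derivatives, then a remainder. The viscous
    part is completed to the squared gradient of [th w], so that it has a sign and leaves only
    [nu |grad th|^2 |w|^2]; the divergence constraints eliminate [V00] and [a00]. *)
Lemma energy_dissipation (nu th g0 g1 w0 w1 a00 a01 a10 a11 h000 h011 h100 h111
    V0 V1 V00 V11 q q0 q1 U00 U01 U10 U11 : R) : V00 + V11 = 0 -> a00 + a11 = 0 ->
  let W := w0 * w0 + w1 * w1 in
  th ^+ 2 * (w0 * (nu * (h000 + h011) - (V0 * a00 + V1 * a01) - (w0 * U00 + w1 * U01) - q0)
     + w1 * (nu * (h100 + h111) - (V0 * a10 + V1 * a11) - (w0 * U10 + w1 * U11) - q1)) =
  ((2 * th * g0) * (nu * (w0 * a00 + w1 * a10) - 2^-1 * (W * V0) - q * w0) +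
     th ^+ 2 * (nu * (a00 * a00 + w0 * h000 + a10 * a10 + w1 * h100)
      - (w0 * a00 + w1 * a10) * V0 - 2^-1 * (W * V00) - q0 * w0 - q * a00)) +
  ((2 * th * g1) * (nu * (w0 * a01 + w1 * a11) - 2^-1 * (W * V1) - q * w1) +
     th ^+ 2 * (nu * (a01 * a01 + w0 * h011 + a11 * a11 + w1 * h111)
      - (w0 * a01 + w1 * a11) * V1 - 2^-1 * (W * V11) - q1 * w1 - q * a11)) +
  (- nu * ((th * a00 + g0 * w0) ^+ 2 + (th * a01 + g1 * w0) ^+ 2 +
      (th * a10 + g0 * w1) ^+ 2 + (th * a11 + g1 * w1) ^+ 2)
   + nu * (g0 ^+ 2 + g1 ^+ 2) * W + th * (g0 * V0 + g1 * V1) * W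
   + 2 * th * q * (g0 * w0 + g1 * w1)
   - th ^+ 2 * (w0 * (w0 * U00 + w1 * U01) + w1 * (w0 * U10 + w1 * U11))).
Proof.
move=> /eqP; rewrite addr_eq0 => /eqP -> /eqP; rewrite addr_eq0 => /eqP ->.
by move=> W; rewrite /W; field.
Qed.

(** One factor [th] is kept on [g ^+ 2] because the divergence theorem controls the Dirichlet energy
    of the cutoff with precisely this weight. *)
Lemma young (Q eps th q g w : R) : 0 < eps -> 0 <= th <= 1 -> `|q| <= Q ->
  2 * th * q * (g * w) <= Q * (eps * (w * w) + th * g ^+ 2 / eps).
Proof.
move=> e0 /andP[t0 t1] qQ.
have Q0 : 0 <= Q by exact: le_trans qQ.
have /andP[q1 q2] : - Q <= q <= Q by rewrite -ler_norml.
have A : 2 * th * `|g| * `|w| <= eps * (w * w) + th * g ^+ 2 / eps.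
  have H : 0 <= (eps * `|w| - th * `|g|) ^+ 2 by exact: sqr_ge0.
  have E : eps * (w * w) + th * g ^+ 2 / eps - 2 * th * `|g| * `|w| =
     ((eps * `|w| - th * `|g|) ^+ 2 + th * (1 - th) * `|g| ^+ 2) / eps.
    have -> : w * w = `|w| ^+ 2 by rewrite real_normK ?num_real.
    have -> : g ^+ 2 = `|g| ^+ 2 by rewrite real_normK ?num_real.
    by field; exact: lt0r_neq0.
  rewrite -subr_ge0 E; apply: divr_ge0; last exact: ltW.
  by rewrite addr_ge0// !mulr_ge0// ?subr_ge0// sqr_ge0.
apply: (@le_trans _ _ (Q * (2 * th * `|g| * `|w|))); last exact: ler_wpM2l.
rewrite (le_trans (ler_norm _))// !normrM (ger0_norm t0) (ger0_norm (ler0n R 2)).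
have H : 0 <= 2 * th * (`|g| * `|w|) by rewrite !mulr_ge0.
have -> : 2 * th * `|q| * (`|g| * `|w|) = `|q| * (2 * th * (`|g| * `|w|)) by ring.
by rewrite -[2 * th * `|g| * `|w|]mulrA; apply: ler_wpM2r.
Qed.

Lemma stretching_le (K w0 w1 U00 U01 U10 U11 : R) :
  `|U00| <= K -> `|U01| <= K -> `|U10| <= K -> `|U11| <= K ->
  - (w0 * (w0 * U00 + w1 * U01) + w1 * (w0 * U10 + w1 * U11)) <=
  2 * K * (w0 * w0 + w1 * w1).
Proof.
move=> H00 H01 H10 H11.
have A (x y u : R) : `|u| <= K -> - (x * (y * u)) <= K * ((x * x + y * y) / 2).
  move=> uK; have K0 : 0 <= K by exact: le_trans uK.
  rewrite (le_trans (ler_norm _))// normrN !normrM mulrA mulrC.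
  apply: ler_pM => //.
  have : 0 <= (`|x| - `|y|) ^+ 2 by exact: sqr_ge0.
  have -> : x * x = `|x| ^+ 2 by rewrite real_normK ?num_real.
  have -> : y * y = `|y| ^+ 2 by rewrite real_normK ?num_real.
  lra.
have := A w0 w0 _ H00; have := A w0 w1 _ H01; have := A w1 w0 _ H10.
have := A w1 w1 _ H11; lra.
Qed.

(** Three kinds of terms remain once the viscous one is dropped by its sign: small multiples of [W],
    paid by the global energy; the weighted Dirichlet energy of the cutoff; and the stretching term,
    which carries [th ^+ 2] and so can be absorbed by Gronwall. *)
Lemma remainder_le (nu th g0 g1 w0 w1 b00 b01 b10 b11
    V0 V1 q U00 U01 U10 U11 C G Q K eps W : R) : W = w0 * w0 + w1 * w1 -> 0 < nu -> 0 < eps -> 0 <= th <= 1 ->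
  `|g0| <= G -> `|g1| <= G -> `|V0| <= C -> `|V1| <= C -> `|q| <= Q ->
  `|U00| <= K -> `|U01| <= K -> `|U10| <= K -> `|U11| <= K ->
  - nu * (b00 ^+ 2 + b01 ^+ 2 + b10 ^+ 2 + b11 ^+ 2)
   + nu * (g0 ^+ 2 + g1 ^+ 2) * W + th * (g0 * V0 + g1 * V1) * W
   + 2 * th * q * (g0 * w0 + g1 * w1)
   - th ^+ 2 * (w0 * (w0 * U00 + w1 * U01) + w1 * (w0 * U10 + w1 * U11)) <=
  (2 * nu * G ^+ 2 + 2 * C * G + Q * eps) * W + Q / eps * (th * (g0 ^+ 2 + g1 ^+ 2)) +
    2 * K * (th ^+ 2 * W).
Proof.
move=> WE nu0 e0 t01 g0G g1G V0C V1C qQ H00 H01 H10 H11.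
have /andP[t0 t1] := t01.
have W0 : 0 <= W by rewrite WE -!expr2 addr_ge0 ?sqr_ge0.
have B0 : - nu * (b00 ^+ 2 + b01 ^+ 2 + b10 ^+ 2 + b11 ^+ 2) <= 0.
  by rewrite mulNr oppr_le0 mulr_ge0 ?(ltW nu0)// !addr_ge0 ?sqr_ge0.
have G2 (g : R) : `|g| <= G -> g ^+ 2 <= G ^+ 2.
  move=> gG; rewrite -[g ^+ 2]real_normK ?num_real// ler_sqr ?nnegrE//.
  exact: le_trans gG.
have B1 : nu * (g0 ^+ 2 + g1 ^+ 2) * W <= (2 * nu * G ^+ 2) * W.
  rewrite ler_wpM2r// -mulrA mulrCA ler_wpM2l ?(ltW nu0)// mulr2n mulrDl mul1r.
  by rewrite lerD// G2.
have gV (g V : R) : `|g| <= G -> `|V| <= C -> th * (g * V) <= C * G.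
  move=> gG VC; have CG : 0 <= C * G.
    by rewrite mulr_ge0// (le_trans _ VC, le_trans _ gG).
  rewrite (le_trans (ler_norm _))// !normrM ger0_norm// -[leRHS]mul1r.
  by rewrite ler_pM ?mulr_ge0// mulrC ler_pM.
have B2 : th * (g0 * V0 + g1 * V1) * W <= (2 * C * G) * W.
  rewrite ler_wpM2r// mulrDr -mulrA mulr2n mulrDl mul1r lerD//; exact: gV.
have B3 : 2 * th * q * (g0 * w0 + g1 * w1) <=
    Q * eps * W + Q / eps * (th * (g0 ^+ 2 + g1 ^+ 2)).
  have := young Q eps th q g0 w0 e0 t01 qQ.
  have := young Q eps th q g1 w1 e0 t01 qQ => Y1 Y0.
  have := lerD Y0 Y1; rewrite -mulrDr => /le_trans; apply.
  by rewrite le_eqVlt WE; apply/orP; left; apply/eqP; field; exact: lt0r_neq0.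
have B4 : - (th ^+ 2 * (w0 * (w0 * U00 + w1 * U01) + w1 * (w0 * U10 + w1 * U11))) <=
    2 * K * (th ^+ 2 * W).
  rewrite -mulrN mulrCA ler_wpM2l ?sqr_ge0// WE; exact: stretching_le.
have := lerD (lerD (lerD (lerD B0 B1) B2) B3) B4; congr (_ <= _).
by ring.
Qed.

End flux.

(** * The divergence theorem on a square for fluxes vanishing on its sides *)

Section divergence.
Context {R : realType}.
Local Notation mu := (@lebesgue_measure R).
Local Notation mu2 := (mu \x mu)%E.
Implicit Types F D : R * R -> R.

(** Fubini and the fundamental theorem on horizontal slices. A square is used, although the cutoff
    lives on a disc, because its slices have fixed endpoints. *)
Lemma integral_divergence1 F D (A : R) : 0 <= A ->
  (forall x, is_derive x (dir R 0) F (D x)) -> continuous D ->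
  (forall y, F (A, y) = 0) -> (forall y, F (- A, y) = 0) ->
  \int[mu2]_(z in rect (- A) A (- A) A) D z = 0.
Proof.
move=> A0 dF cD FA FNA; rewrite /Rintegral integral_rect21//.
have AA : - A <= A by rewrite (le_trans _ A0)// oppr_le0.
have DE : D = pd 0 F by apply/funext => x; rewrite -(is_derive_val _ _ _ _ _ _ (dF x)).
rewrite DE in cD *; have dF' x := is_derive_derivable _ _ _ _ _ _ (dF x).
under eq_integral do rewrite (FTC2_slice1 _ _ _ _ AA dF' cD) FA FNA subrr.
by rewrite integral0.
Qed.

Lemma integral_divergence2 F D (A : R) : 0 <= A ->
  (forall x, is_derive x (dir R 1) F (D x)) -> continuous D ->
  (forall y, F (y, A) = 0) -> (forall y, F (y, - A) = 0) ->
  \int[mu2]_(z in rect (- A) A (- A) A) D z = 0.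
Proof.
move=> A0 dF cD FA FNA; rewrite /Rintegral integral_rect12//.
have AA : - A <= A by rewrite (le_trans _ A0)// oppr_le0.
have DE : D = pd 1 F by apply/funext => x; rewrite -(is_derive_val _ _ _ _ _ _ (dF x)).
rewrite DE in cD *; have dF' x := is_derive_derivable _ _ _ _ _ _ (dF x).
under eq_integral do rewrite (FTC2_slice2 _ _ _ _ AA dF' cD) FA FNA subrr.
by rewrite integral0.
Qed.

End divergence.

(* [w] is the difference of two velocities, [a] and [h] its derivatives, [V] the advecting
   velocity, [U] the gradient of the other velocity and [q] the difference of the pressures.
   The pressure is only known to be bounded, so [q w . grad th] is split by Young's inequality
   with a weight [eps] between [W] and the Dirichlet energy of the cutoff [th]. *)
Section energy_estimate.
Context {R : realType}.
Local Notation mu := (@lebesgue_measure R).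
Local Notation mu2 := (mu \x mu)%E.
Variables (nu A C G Q K eps : R).
Variables (th g0 g1 w0 w1 a00 a01 a10 a11 h000 h011 h100 h111
  V0 V1 V00 V11 q q0 q1 U00 U01 U10 U11 : R * R -> R).
Hypotheses (nu0 : 0 < nu) (A0 : 0 <= A) (eps0 : 0 < eps).
Hypotheses (dth0 : forall x, is_derive x (dir R 0) (fun x => th x ^+ 2) (2 * th x * g0 x))
  (dth1 : forall x, is_derive x (dir R 1) (fun x => th x ^+ 2) (2 * th x * g1 x)).
Hypotheses (dw00 : forall x, is_derive x (dir R 0) w0 (a00 x))
  (dw01 : forall x, is_derive x (dir R 1) w0 (a01 x))
  (dw10 : forall x, is_derive x (dir R 0) w1 (a10 x))
  (dw11 : forall x, is_derive x (dir R 1) w1 (a11 x))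
  (da00 : forall x, is_derive x (dir R 0) a00 (h000 x))
  (da01 : forall x, is_derive x (dir R 1) a01 (h011 x))
  (da10 : forall x, is_derive x (dir R 0) a10 (h100 x))
  (da11 : forall x, is_derive x (dir R 1) a11 (h111 x))
  (dV0 : forall x, is_derive x (dir R 0) V0 (V00 x))
  (dV1 : forall x, is_derive x (dir R 1) V1 (V11 x))
  (dq0 : forall x, is_derive x (dir R 0) q (q0 x))
  (dq1 : forall x, is_derive x (dir R 1) q (q1 x)).
Hypotheses (cth : continuous th) (cg0 : continuous g0) (cg1 : continuous g1)
  (cw0 : continuous w0) (cw1 : continuous w1)
  (ca00 : continuous a00) (ca01 : continuous a01)
  (ca10 : continuous a10) (ca11 : continuous a11)
  (ch000 : continuous h000) (ch011 : continuous h011)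
  (ch100 : continuous h100) (ch111 : continuous h111)
  (cV0 : continuous V0) (cV1 : continuous V1)
  (cV00 : continuous V00) (cV11 : continuous V11)
  (cq : continuous q) (cq0 : continuous q0) (cq1 : continuous q1)
  (cU00 : continuous U00) (cU01 : continuous U01)
  (cU10 : continuous U10) (cU11 : continuous U11).
Hypotheses (divV : forall x, V00 x + V11 x = 0) (divw : forall x, a00 x + a11 x = 0).
Hypotheses (th01 : forall x, 0 <= th x <= 1)
  (thA1 : forall y, th (A, y) = 0) (thNA1 : forall y, th (- A, y) = 0)
  (thA2 : forall y, th (y, A) = 0) (thNA2 : forall y, th (y, - A) = 0).
Hypotheses (g0_le : forall x, `|g0 x| <= G) (g1_le : forall x, `|g1 x| <= G)
  (V0_le : forall x, `|V0 x| <= C) (V1_le : forall x, `|V1 x| <= C)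
  (q_le : forall x, `|q x| <= Q)
  (U00_le : forall x, `|U00 x| <= K) (U01_le : forall x, `|U01 x| <= K)
  (U10_le : forall x, `|U10 x| <= K) (U11_le : forall x, `|U11 x| <= K).

Let W x := w0 x * w0 x + w1 x * w1 x.

Let production x :=
  w0 x * (nu * (h000 x + h011 x) - (V0 x * a00 x + V1 x * a01 x)
     - (w0 x * U00 x + w1 x * U01 x) - q0 x)
  + w1 x * (nu * (h100 x + h111 x) - (V0 x * a10 x + V1 x * a11 x)
     - (w0 x * U10 x + w1 x * U11 x) - q1 x).

Lemma energy_estimate :
  \int[mu2]_(z in rect (- A) A (- A) A) (th z ^+ 2 * production z) <=
  (2 * nu * G ^+ 2 + 2 * C * G + Q * eps) * \int[mu2]_(z in rect (- A) A (- A) A) W z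
  + Q / eps * \int[mu2]_(z in rect (- A) A (- A) A) (th z * (g0 z ^+ 2 + g1 z ^+ 2))
  + 2 * K * \int[mu2]_(z in rect (- A) A (- A) A) (th z ^+ 2 * W z).
Proof.
set B := rect _ _ _ _.
have mB : measurable B by exact: measurable_rect.
pose D0 x := (2 * th x * g0 x) * (nu * (w0 x * a00 x + w1 x * a10 x)
      - 2^-1 * ((w0 x * w0 x + w1 x * w1 x) * V0 x) - q x * w0 x) +
     th x ^+ 2 * (nu * (a00 x * a00 x + w0 x * h000 x + a10 x * a10 x + w1 x * h100 x)
      - (w0 x * a00 x + w1 x * a10 x) * V0 x
      - 2^-1 * ((w0 x * w0 x + w1 x * w1 x) * V00 x) - q0 x * w0 x - q x * a00 x).
pose D1 x := (2 * th x * g1 x) * (nu * (w0 x * a01 x + w1 x * a11 x)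
      - 2^-1 * ((w0 x * w0 x + w1 x * w1 x) * V1 x) - q x * w1 x) +
     th x ^+ 2 * (nu * (a01 x * a01 x + w0 x * h011 x + a11 x * a11 x + w1 x * h111 x)
      - (w0 x * a01 x + w1 x * a11 x) * V1 x
      - 2^-1 * ((w0 x * w0 x + w1 x * w1 x) * V11 x) - q1 x * w1 x - q x * a11 x).
have cD0 : continuous D0 by rewrite /D0; continuity.
have cD1 : continuous D1 by rewrite /D1; continuity.
have I0 : \int[mu2]_(z in B) D0 z = 0.
  apply: (integral_divergence1 _ _ _ A0 (fun x => is_derive_flux _ _ _ nu _ _ _ _ _ _ _ _ _ _ _ _ _ _ _ _
    (dth0 x) (dw00 x) (dw10 x) (da00 x) (da10 x) (dV0 x) (dq0 x) (dw00 x)) cD0).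
  - by move=> y; rewrite thA1 expr0n mul0r.
  - by move=> y; rewrite thNA1 expr0n mul0r.
have I1 : \int[mu2]_(z in B) D1 z = 0.
  apply: (integral_divergence2 _ _ _ A0 (fun x => is_derive_flux _ _ _ nu _ _ _ _ _ _ _ _ _ _ _ _ _ _ _ _
    (dth1 x) (dw01 x) (dw11 x) (da01 x) (da11 x) (dV1 x) (dq1 x) (dw11 x)) cD1).
  - by move=> y; rewrite thA2 expr0n mul0r.
  - by move=> y; rewrite thNA2 expr0n mul0r.
pose L x := th x ^+ 2 * production x.
have cL : continuous L by rewrite /L /production; continuity.
have cW : continuous W by rewrite /W; continuity.
have cT : continuous (fun z => th z * (g0 z ^+ 2 + g1 z ^+ 2)) by continuity.
have cTW : continuous (fun z => th z ^+ 2 * W z) by continuity.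
have iB f : continuous f -> mu2.-integrable B (EFin \o f) by exact: integrable_rect.
(* Subtracting the flux divergence, of zero integral, leaves an integrand that can be bounded
   pointwise. *)
have -> : \int[mu2]_(z in B) (th z ^+ 2 * production z) =
    \int[mu2]_(z in B) (L z - (D0 z + D1 z)).
  rewrite RintegralB//; [|exact: iB|by apply: iB; continuity].
  by rewrite RintegralD//; [rewrite I0 I1 addr0 subr0|exact: iB|exact: iB].
pose c1 := 2 * nu * G ^+ 2 + 2 * C * G + Q * eps.
rewrite -/c1.
rewrite -RintegralZl//; last exact: iB.
rewrite -[X in _ + X + _]RintegralZl//; last exact: iB.
rewrite -[X in _ <= _ + X]RintegralZl//; last exact: iB.
rewrite -RintegralD//; [|by apply: iB; continuity|by apply: iB; continuity].
rewrite -RintegralD//; [|by apply: iB; continuity|by apply: iB; continuity].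
apply: le_Rintegral => //; [by apply: iB; continuity|by apply: iB; continuity|].
move=> x _; rewrite /L /production.
rewrite (energy_dissipation nu (th x) (g0 x) (g1 x) (w0 x) (w1 x) _ (a01 x) (a10 x) _
  _ _ _ _ _ _ _ _ (q x) _ _ _ _ _ _ (divV x) (divw x)) -/(W x).
rewrite [X in X <= _](_ : _ = - nu * ((th x * a00 x + g0 x * w0 x) ^+ 2 +
      (th x * a01 x + g1 x * w0 x) ^+ 2 +
      (th x * a10 x + g0 x * w1 x) ^+ 2 + (th x * a11 x + g1 x * w1 x) ^+ 2)
   + nu * (g0 x ^+ 2 + g1 x ^+ 2) * W x + th x * (g0 x * V0 x + g1 x * V1 x) * W x
   + 2 * th x * q x * (g0 x * w0 x + g1 x * w1 x)
   - th x ^+ 2 * (w0 x * (w0 x * U00 x + w1 x * U01 x) + w1 x * (w0 x * U10 x + w1 x * U11 x))).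
  exact: remainder_le.
by rewrite addrC addKr.
Qed.

End energy_estimate.

(** * The logarithmic cutoff and its Dirichlet energy *)

Section cutoff.
Context {R : realType}.
Local Notation mu := (@lebesgue_measure R).
Local Notation mu2 := (mu \x mu)%E.

(** The added 1 makes the logarithm smooth at the origin, so no inner radius has to be cut out. *)
Definition den (x : R * R) : R := 1 + x.1 ^+ 2 + x.2 ^+ 2.

Definition cutoff (M : R) (x : R * R) : R := Num.max (1 - ln (den x) / M) 0.

(** The derivative of [1 - ln (den x) / M] without the maximum. In the derivative of the squared
    cutoff it is multiplied by [cutoff M x], so the formula is right on both sides of the kink and
    the function stays continuous. *)
Definition cutoff_grad1 (M : R) (x : R * R) : R := - (2 * x.1 / den x) / M.
Definition cutoff_grad2 (M : R) (x : R * R) : R := - (2 * x.2 / den x) / M.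

Lemma den_ge1 x : 1 <= den x.
Proof. by rewrite /den -addrA lerDl addr_ge0 ?sqr_ge0. Qed.

Lemma den_gt0 x : 0 < den x. Proof. exact: lt_le_trans (den_ge1 x). Qed.

Lemma continuous_fst : continuous (fun x : R * R => x.1).
Proof. by move=> x; exact: cvg_fst. Qed.

Lemma continuous_snd : continuous (fun x : R * R => x.2).
Proof. by move=> x; exact: cvg_snd. Qed.

Lemma continuous_den : continuous den.
Proof.
have c1 := continuous_fst; have c2 := continuous_snd.
by rewrite /den; continuity.
Qed.

Lemma continuous_invden : continuous (fun x => (den x)^-1).
Proof.
move=> x; apply: cvgV; first by rewrite lt0r_neq0// den_gt0.
exact: continuous_den.
Qed.

Lemma continuous_cutoff M : continuous (cutoff M).
Proof.
apply: continuous_maxr0.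
have cl : continuous (fun x => ln (den x)).
  move=> x; apply: (@continuous_comp _ _ _ den (@ln R) x).
    exact: continuous_den.
  by apply: continuous_ln; exact: den_gt0.
by continuity.
Qed.

Lemma continuous_cutoff_grad1 M : continuous (cutoff_grad1 M).
Proof.
have c1 := continuous_fst; have c2 := continuous_invden.
by rewrite /cutoff_grad1; continuity.
Qed.

Lemma continuous_cutoff_grad2 M : continuous (cutoff_grad2 M).
Proof.
have c1 := continuous_snd; have c2 := continuous_invden.
by rewrite /cutoff_grad2; continuity.
Qed.

(** Squaring removes the kink of the positive part; this is why the energy carries the square of the
    cutoff. *)
Lemma is_derive_max0_sqr (s : R) :
  is_derive s (1 : R) (fun s => Num.max s 0 ^+ 2) (2 * Num.max s 0).
Proof.
have D0 : is_derive s (1 : R) (fun s : R => s * s) (2 * s).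
  have := is_deriveM (is_derive_id s (1 : R)) (is_derive_id s (1 : R)).
  by congr is_derive; rewrite -![_ *: _]/(_ * _); ring.
have [s0|s0|->] := ltgtP s 0.
- rewrite ?(max_r (ltW s0)) mulr0.
  apply: (near_eq_is_derive _ (is_derive_cst (0 : R) s (1 : R))).
  near=> t.
  rewrite max_r ?expr0n//; apply: ltW.
  by near: t; exact: lt_nbhsl.
- rewrite ?(max_l (ltW s0)); apply: (near_eq_is_derive _ D0).
  near=> t; rewrite max_l ?expr2//; apply: ltW.
  by near: t; exact: lt_nbhsr.
- rewrite ?maxxx mulr0; apply: (@is_derive_quadratic _ _ 1) => t.
  rewrite mul1r ger0_norm ?sqr_ge0//.
  have [t0|t0] := leP t 0; first by rewrite expr0n sqr_ge0.
  by [].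
Unshelve. all: end_near. Qed.

Lemma is_derive_ln_den (a b : R) :
  is_derive a (1 : R) (fun s => ln (1 + s ^+ 2 + b ^+ 2)) (2 * a / (1 + a ^+ 2 + b ^+ 2)).
Proof.
have D0 : is_derive a (1 : R) (fun s : R => 1 + s ^+ 2 + b ^+ 2) (2 * a).
  have := is_deriveD (is_deriveD (is_derive_cst (1 : R) a (1 : R))
    (is_deriveM (is_derive_id a (1 : R)) (is_derive_id a (1 : R))))
    (is_derive_cst (b ^+ 2) a (1 : R)).
  by congr is_derive; rewrite -![_ *: _]/(_ * _); ring.
have := @is_derive1_comp _ (@ln R) (fun s : R => 1 + s ^+ 2 + b ^+ 2) a _ _
  (is_derive1_ln (den_gt0 (a, b))) D0.
by congr is_derive; rewrite mulrC.
Qed.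

Lemma is_derive_lnden1 x : is_derive x (dir R 0) (fun x => ln (den x)) (2 * x.1 / den x).
Proof. by case: x => a b; apply: is_derive_of_slice1; exact: is_derive_ln_den. Qed.

Lemma is_derive_lnden2 x : is_derive x (dir R 1) (fun x => ln (den x)) (2 * x.2 / den x).
Proof.
case: x => a b; apply: is_derive_of_slice2.
have := is_derive_ln_den b a; rewrite addrAC.
by congr is_derive; apply/funext => s; rewrite addrAC.
Qed.

Lemma is_derive_cutoff_sqr (j : 'I_3) (M : R) x d :
  is_derive x (dir R j) (fun x => ln (den x)) d ->
  is_derive x (dir R j) (fun x => cutoff M x ^+ 2) (2 * cutoff M x * (- d / M)).
Proof.
move=> D0.
have D1 : is_derive x (dir R j) (fun x => 1 - ln (den x) / M) (- d / M).
  have := is_deriveB (is_derive_cst (1 : R) x (dir R j)) (is_deriveZ M^-1 D0).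
  rewrite sub0r -[M^-1 *: d]/(M^-1 * d) mulNr (mulrC d).
  by congr is_derive; apply/funext => y; rewrite mulrC.
exact: (is_derive_comp_dir _ _ _ _ _ _ D1 (is_derive_max0_sqr _)).
Qed.

Lemma is_derive_cutoff_sqr1 M x :
  is_derive x (dir R 0) (fun x => cutoff M x ^+ 2) (2 * cutoff M x * cutoff_grad1 M x).
Proof. exact: is_derive_cutoff_sqr (is_derive_lnden1 x). Qed.

Lemma is_derive_cutoff_sqr2 M x :
  is_derive x (dir R 1) (fun x => cutoff M x ^+ 2) (2 * cutoff M x * cutoff_grad2 M x).
Proof. exact: is_derive_cutoff_sqr (is_derive_lnden2 x). Qed.

Lemma cutoff_itv M x : 0 < M -> 0 <= cutoff M x <= 1.
Proof.
move=> M0; rewrite /cutoff le_max lexx orbT ge_max ler01 andbT/=.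
by rewrite gerBl divr_ge0 ?(ltW M0)// ln_ge0// den_ge1.
Qed.

Lemma double_le_sqr (a b : R) : `|2 * a| <= 1 + a ^+ 2 + b ^+ 2.
Proof.
rewrite normrM (ger0_norm (ler0n R 2)).
have -> : a ^+ 2 = `|a| ^+ 2 by rewrite real_normK ?num_real.
have H1 : 0 <= (`|a| - 1) ^+ 2 by exact: sqr_ge0.
have H2 : 0 <= b ^+ 2 by exact: sqr_ge0.
lra.
Qed.

Lemma cutoff_grad1_le M x : 0 < M -> `|cutoff_grad1 M x| <= M^-1.
Proof.
move=> M0; rewrite /cutoff_grad1 normrM normrN normfV (gtr0_norm M0) ler_piMl//.
  by rewrite invr_ge0 ltW.
rewrite normrM normfV (gtr0_norm (den_gt0 x)) ler_pdivrMr ?den_gt0// mul1r.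
exact: double_le_sqr.
Qed.

Lemma cutoff_grad2_le M x : 0 < M -> `|cutoff_grad2 M x| <= M^-1.
Proof.
move=> M0; rewrite /cutoff_grad2 normrM normrN normfV (gtr0_norm M0) ler_piMl//.
  by rewrite invr_ge0 ltW.
rewrite normrM normfV (gtr0_norm (den_gt0 x)) ler_pdivrMr ?den_gt0// mul1r /den addrAC.
exact: double_le_sqr.
Qed.

(** The radius [A] with [1 + A ^+ 2 = expR M], on whose circle the cutoff reaches 0. The sides of
    the square of half-side [A] are tangent to this circle. *)
Definition cut_radius (M : R) : R := Num.sqrt (expR M - 1).

Lemma cut_radius_sqr M : 0 < M -> 1 + cut_radius M ^+ 2 = expR M.
Proof.
move=> M0; rewrite /cut_radius sqr_sqrtr; first by rewrite addrC subrK.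
by rewrite subr_ge0 ltW// expR_gt1.
Qed.

Lemma cutoff_eq0 M x : 0 < M -> expR M <= den x -> cutoff M x = 0.
Proof.
move=> M0 Mx; rewrite /cutoff max_r// subr_le0 ler_pdivlMr// mul1r.
by rewrite -[leLHS]expRK ler_ln// posrE ?expR_gt0 ?den_gt0.
Qed.

Lemma cutoff_radius1 M y : 0 < M -> cutoff M (cut_radius M, y) = 0.
Proof.
by move=> M0; apply: cutoff_eq0 => //; rewrite /den/= cut_radius_sqr// lerDl sqr_ge0.
Qed.

Lemma cutoff_Nradius1 M y : 0 < M -> cutoff M (- cut_radius M, y) = 0.
Proof.
by move=> M0; apply: cutoff_eq0 => //; rewrite /den/= sqrrN cut_radius_sqr// lerDl sqr_ge0.
Qed.

Lemma cutoff_radius2 M y : 0 < M -> cutoff M (y, cut_radius M) = 0.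
Proof.
by move=> M0; apply: cutoff_eq0 => //; rewrite /den/= addrAC cut_radius_sqr// lerDl sqr_ge0.
Qed.

Lemma cutoff_Nradius2 M y : 0 < M -> cutoff M (y, - cut_radius M) = 0.
Proof.
by move=> M0; apply: cutoff_eq0 => //; rewrite /den/= sqrrN addrAC cut_radius_sqr// lerDl sqr_ge0.
Qed.

Lemma cut_radius_ge0 M : 0 <= cut_radius M. Proof. exact: sqrtr_ge0. Qed.

Lemma is_derive_gradln (j : 'I_3) (x : R * R) (p : R * R -> R) (d : R) :
  is_derive x (dir R j) p d -> is_derive x (dir R j) den (2 * p x) ->
  is_derive x (dir R j) (fun x => 2 * p x / den x) (2 * d / den x - (2 * p x) ^+ 2 / den x ^+ 2).
Proof.
move=> dp dd; have dn0 : den x != 0 by rewrite lt0r_neq0// den_gt0.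
have dv : is_derive (den x) (1 : R) (fun s : R => s^-1) (- (den x ^- 2)).
  have := @is_deriveV _ (fun s : R => s) (den x) 1 1 dn0 (is_derive_id _ _).
  by congr is_derive; rewrite -[_ *: _]/(_ * _) mulr1.
have := is_deriveM (is_deriveZ 2 dp) (is_derive_comp_dir _ _ _ _ _ _ dd dv).
congr is_derive; rewrite -![_ *: _]/(_ * _) -![(2 \*: p) x]/(2 * p x) /=.
by field.
Qed.

Lemma is_derive_den1 x : is_derive x (dir R 0) den (2 * x.1).
Proof.
case: x => a b; apply: is_derive_of_slice1.
have := is_deriveD (is_deriveD (is_derive_cst (1 : R) a (1 : R))
  (is_deriveM (is_derive_id a (1 : R)) (is_derive_id a (1 : R))))
  (is_derive_cst (b ^+ 2) a (1 : R)).
by congr is_derive; rewrite -![_ *: _]/(_ * _) /=; ring.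
Qed.

Lemma is_derive_den2 x : is_derive x (dir R 1) den (2 * x.2).
Proof.
case: x => a b; apply: is_derive_of_slice2.
have := is_deriveD (is_derive_cst (1 + a ^+ 2) b (1 : R))
  (is_deriveM (is_derive_id b (1 : R)) (is_derive_id b (1 : R))).
by congr is_derive; rewrite -![_ *: _]/(_ * _) /=; ring.
Qed.

Lemma is_derive_fst (x : R * R) : is_derive x (dir R 0) (fun x => x.1) 1.
Proof. by case: x => a b; apply: is_derive_of_slice1; exact: is_derive_id. Qed.

Lemma is_derive_snd (x : R * R) : is_derive x (dir R 1) (fun x => x.2) 1.
Proof. by case: x => a b; apply: is_derive_of_slice2; exact: is_derive_id. Qed.

Lemma integral_cauchy_density (A : R) : 0 <= A ->
  (\int[mu]_(x in `[(- A)%R, A]) ((1 + x ^+ 2)^-1)%:E = (2 * atan A)%:E)%E.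
Proof.
move=> A0; have AA : - A <= A by rewrite (le_trans _ A0)// oppr_le0.
have ci : continuous (fun x : R => (1 + x ^+ 2)^-1).
  move=> x; apply: cvgV; first by rewrite lt0r_neq0// ltr_pwDl// sqr_ge0.
  by apply: cvgD; [exact: cvg_cst|exact: exprn_continuous].
rewrite (FTC2_continuous _ _ _ _ AA (@is_derive1_atan R) ci).
by rewrite atanN opprK mulr2n mulrDl mul1r.
Qed.

Lemma continuous_cauchy_product : continuous (fun z : R * R =>
  4 * ((1 + z.1 ^+ 2)^-1 * (1 + z.2 ^+ 2)^-1)).
Proof.
have cv (f : R * R -> R) : continuous f -> continuous (fun z => (1 + f z ^+ 2)^-1).
  move=> cf z; apply: cvgV; first by rewrite lt0r_neq0// ltr_pwDl// sqr_ge0.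
  by apply: cvgD; [exact: cvg_cst|apply: cvgM; exact: cf].
have c1 := cv _ continuous_fst; have c2 := cv _ continuous_snd.
by continuity.
Qed.

(** The integral factors into [4 * (2 * atan A) ^+ 2], and [atan] is at most [pi / 2]. *)
Lemma integral_cauchy_product_le (A : R) : 0 <= A ->
  \int[mu2]_(z in rect (- A) A (- A) A)
    (4 * ((1 + z.1 ^+ 2)^-1 * (1 + z.2 ^+ 2)^-1)) <= 4 * pi ^+ 2.
Proof.
move=> A0; rewrite /Rintegral integral_rect21; last exact: continuous_cauchy_product.
have ci : continuous (fun x : R => (1 + x ^+ 2)^-1).
  move=> x; apply: cvgV; first by rewrite lt0r_neq0// ltr_pwDl// sqr_ge0.
  by apply: cvgD; [exact: cvg_cst|exact: exprn_continuous].
have mi : measurable_fun `[- A, A] (fun x : measurableTypeR R => ((1 + x ^+ 2)^-1)%:E).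
  by apply/measurable_EFinP/measurable_funTS; exact: continuous_measurable_fun.
have i0 (x : R) : (0 <= ((1 + x ^+ 2)^-1)%:E)%E.
  by rewrite lee_fin invr_ge0 addr_ge0// sqr_ge0.
have t0 : 0 <= atan A by rewrite -atan0 le_atan.
under eq_integral => y _.
  under eq_integral => x _ do rewrite /= mulrCA mulrC EFinM.
  rewrite ge0_integralZl_EFin//; last first.
    by rewrite mulr_ge0// invr_ge0 addr_ge0// sqr_ge0.
  rewrite integral_cauchy_density// -EFinM -mulrA mulrCA mulrC EFinM.
  over.
rewrite ge0_integralZl_EFin//; last by rewrite !mulr_ge0.
rewrite integral_cauchy_density// -EFinM /=.
have tp := ltW (atan_ltpi2 A); have p0 := pi_ge0 R.
have : atan A ^+ 2 <= (pi / 2) ^+ 2 by rewrite ler_sqr ?nnegrE// divr_ge0.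
move: (pi : R) (atan A) => p t; rewrite expr_div_n; lra.
Qed.

(** [den x] dominates each of [1 + x.1 ^+ 2] and [1 + x.2 ^+ 2]. The product majorant is integrated
    by two arctangents, without polar coordinates. *)
Lemma den_sqr_ge (x : R * R) :
  4 / den x ^+ 2 <= 4 * ((1 + x.1 ^+ 2)^-1 * (1 + x.2 ^+ 2)^-1).
Proof.
rewrite -invfM ler_wpM2l// lef_pV2 ?posrE ?mulr_gt0 ?exprn_gt0 ?den_gt0 ?ltr_pwDl ?sqr_ge0//.
rewrite expr2 /den; apply: ler_pM.
- by rewrite addr_ge0// sqr_ge0.
- by rewrite addr_ge0// sqr_ge0.
- by rewrite lerDl sqr_ge0.
- by rewrite -addrA lerD2l lerDr sqr_ge0.
Qed.

(* The divergence theorem for [theta^2 grad ln (1 + r^2)] bounds the weighted Dirichlet energy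
   of the cutoff, since [lap ln (1 + r^2) = 4 / (1 + r^2)^2] is integrable. *)
Lemma cutoff_dirichlet (M : R) : 0 < M ->
  \int[mu2]_(z in rect (- cut_radius M) (cut_radius M) (- cut_radius M) (cut_radius M))
    (cutoff M z * (cutoff_grad1 M z ^+ 2 + cutoff_grad2 M z ^+ 2)) <= 2 * pi ^+ 2 / M.
Proof.
move=> M0; set A := cut_radius M; set B := rect _ _ _ _.
have A0 : 0 <= A := cut_radius_ge0 M.
have mB : measurable B by exact: measurable_rect.
have iB f : continuous f -> mu2.-integrable B (EFin \o f) by exact: integrable_rect.
have M0' := lt0r_neq0 M0.
pose D1 x := 2 * cutoff M x * cutoff_grad1 M x * (2 * x.1 / den x) +
  cutoff M x ^+ 2 * (2 * 1 / den x - (2 * x.1) ^+ 2 / den x ^+ 2).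
pose D2 x := 2 * cutoff M x * cutoff_grad2 M x * (2 * x.2 / den x) +
  cutoff M x ^+ 2 * (2 * 1 / den x - (2 * x.2) ^+ 2 / den x ^+ 2).
have c1 := continuous_fst; have c2 := continuous_snd; have ci := continuous_invden.
have cc := continuous_cutoff M; have cg1 := continuous_cutoff_grad1 M.
have cg2 := continuous_cutoff_grad2 M.
have ci2 : continuous (fun x => (den x ^+ 2)^-1).
  rewrite (_ : (fun x => _) = (fun x => (den x)^-1 ^+ 2)); first exact: continuous_expn.
  by apply/funext => x; rewrite exprVn.
have cD1 : continuous D1 by rewrite /D1; continuity.
have cD2 : continuous D2 by rewrite /D2; continuity.
have dprod (j : 'I_3) (x : R * R) (f g : R * R -> R) df dg :
    is_derive x (dir R j) f df -> is_derive x (dir R j) g dg ->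
    is_derive x (dir R j) (fun x => f x * g x) (df * g x + f x * dg).
  move=> Df Dg; have := is_deriveM Df Dg.
  by congr is_derive; rewrite -![_ *: _]/(_ * _) addrC (mulrC (g x)).
have I1 : \int[mu2]_(z in B) D1 z = 0.
  apply: (integral_divergence1 _ _ _ A0 (fun x => dprod _ _ _ _ _ _ (is_derive_cutoff_sqr1 M x)
    (is_derive_gradln _ _ _ _ (is_derive_fst x) (is_derive_den1 x))) cD1) => y.
    by rewrite cutoff_radius1// expr0n mul0r.
  by rewrite cutoff_Nradius1// expr0n mul0r.
have I2 : \int[mu2]_(z in B) D2 z = 0.
  apply: (integral_divergence2 _ _ _ A0 (fun x => dprod _ _ _ _ _ _ (is_derive_cutoff_sqr2 M x)
    (is_derive_gradln _ _ _ _ (is_derive_snd x) (is_derive_den2 x))) cD2) => y.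
    by rewrite cutoff_radius2// expr0n mul0r.
  by rewrite cutoff_Nradius2// expr0n mul0r.
pose T x := cutoff M x * (cutoff_grad1 M x ^+ 2 + cutoff_grad2 M x ^+ 2).
have cT : continuous T by rewrite /T; continuity.
have cS := continuous_cauchy_product.
(* As the gradient of the cutoff is [- M^-1] times that of [ln den], the cross term in [D1 + D2] is
   [- 2 M T]. Adding [2 M T] leaves [cutoff ^+ 2] times the Laplacian [4 / den ^+ 2]. *)
have H : \int[mu2]_(z in B) ((2 * M) * T z + (D1 z + D2 z)) <=
    \int[mu2]_(z in B) (4 * ((1 + z.1 ^+ 2)^-1 * (1 + z.2 ^+ 2)^-1)).
  apply: le_Rintegral => //; [by apply: iB; continuity|exact: iB|move=> x _].
  apply: le_trans (den_sqr_ge x).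
  have d0 := lt0r_neq0 (den_gt0 x).
  have -> : (2 * M) * T x + (D1 x + D2 x) = cutoff M x ^+ 2 * (4 / den x ^+ 2).
    have E : x.2 ^+ 2 = den x - 1 - x.1 ^+ 2 by rewrite /den; ring.
    rewrite /T /D1 /D2 /cutoff_grad1 /cutoff_grad2.
    move: (cutoff M x) (den x) x.1 x.2 d0 E => c d a b d0 E.
    have -> : 2 * M * (c * ((- (2 * a / d) / M) ^+ 2 + (- (2 * b / d) / M) ^+ 2)) +
      (2 * c * (- (2 * a / d) / M) * (2 * a / d) + c ^+ 2 * (2 * 1 / d - (2 * a) ^+ 2 / d ^+ 2) +
       (2 * c * (- (2 * b / d) / M) * (2 * b / d) + c ^+ 2 * (2 * 1 / d - (2 * b) ^+ 2 / d ^+ 2))) =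
      c ^+ 2 * (4 * (d - a ^+ 2 - b ^+ 2) / d ^+ 2) by field; rewrite M0' d0.
    by rewrite E; field.
  rewrite ler_piMl//; first by rewrite divr_ge0// sqr_ge0.
  have /andP[t0 t1] := cutoff_itv M x M0.
  by rewrite expr_le1.
move: H; rewrite RintegralD//; [|by apply: iB; continuity|by apply: iB; continuity].
rewrite [X in _ + X <= _ -> _]RintegralD//; [|exact: iB|exact: iB].
rewrite I1 I2 !addr0 RintegralZl//; last exact: iB.
move=> /le_trans /(_ (integral_cauchy_product_le A A0)).
rewrite ler_pdivlMr// => H.
rewrite -(ler_pM2l (ltr0n R 2)) (_ : 2 * (_ * M) = 2 * M * \int[mu2]_(z in B) T z); last first.
  by rewrite mulrCA mulrC.
by apply: (le_trans H); rewrite le_eqVlt; apply/orP; left; apply/eqP; ring.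
Qed.

End cutoff.

(** * Extension in time, compactness bounds, and Gronwall's inequality *)

Section generic.
Context {R : realType}.

Lemma sum_ord3 (F : 'I_3 -> R) : \sum_(j < 3) F j = F 0 + F 1 + F 2.
Proof.
rewrite !big_ord_recl big_ord0 addr0 addrA.
by congr (F _ + F _ + F _); exact: val_inj.
Qed.

Lemma continuous_section (F : R * (R * R) -> R) (t : R) (x : R * R) :
  {for (t, x), continuous F} -> {for x, continuous (fun x => F (t, x))}.
Proof.
move=> cF; apply: (@continuous_comp _ _ _ (fun x => (t, x)) F x _ cF).
exact: (cvg_pair (cvg_cst t) (@cvg_id _ _)).
Qed.

Lemma continuous_section_time (F : R * (R * R) -> R) (t : R) (x : R * R) :
  {for (t, x), continuous F} -> {for t, continuous (fun t => F (t, x))}.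
Proof.
move=> cF; apply: (@continuous_comp _ _ _ (fun t => (t, x)) F t _ cF).
exact: (cvg_pair (@cvg_id _ _) (cvg_cst x)).
Qed.

(** Composition with the retraction [t |-> max t 0] onto nonnegative times turns continuity within
    the closed half-space into plain continuity. *)
Lemma continuous_max0_extension (f : R * (R * R) -> R) :
  {within [set z : R * (R * R) | 0 <= z.1], continuous f} ->
  continuous (fun z : R * (R * R) => f (Num.max z.1 0, z.2)).
Proof.
move=> /subspace_continuousP cf z.
pose g (z : R * (R * R)) := (Num.max z.1 0, z.2).
have Ag y : [set z : R * (R * R) | 0 <= z.1] (g y) by rewrite /= le_max lexx orbT.
have cg : {for z, continuous g}.
  have c1 : {for z, continuous (fun z : R * (R * R) => Num.max z.1 0)}.
    by apply: (@continuous_maxr0 R _ (fun z : R * (R * R) => z.1)) => y; exact: cvg_fst.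
  have c2 : {for z, continuous (fun z : R * (R * R) => z.2)} by exact: cvg_snd.
  exact: (cvg_pair c1 c2).
move=> U HU; have := cf (g z) (Ag z) U HU; rewrite /fmap/= => H.
have H' : nbhs z (fun y => 0 <= (g y).1 -> U (f (g y))) by exact: cg _ H.
suff : nbhs z (fun y => U (f (g y))) by [].
by apply: filterS H' => y Hy; exact: Hy (Ag y).
Qed.

Lemma compact_norm_bound (T : topologicalType) (F : T -> R) (K : set T) : compact K ->
  (forall p, K p -> {for p, continuous F}) -> exists C : R, forall p, K p -> `|F p| <= C.
Proof.
move=> cK cF.
have : compact (F @` K).
  apply: continuous_compact => //; apply: continuous_in_subspaceT => p.
  by rewrite inE; exact: cF.
move=> /(@compact_bounded _ R^o)[M [_ MF]].
exists (M + 1) => p Kp; apply: (MF (M + 1)); first by rewrite ltrDl.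
by exists p.
Qed.

(** The function [expR (- k s) * E s - d * s] is nonincreasing. Derivatives are required on the open
    interval only, since a competing solution need not be differentiable at time 0. *)
Lemma gronwall (E E' : R -> R) (k d T : R) : 0 <= d -> continuous E -> E 0 = 0 ->
  0 <= k -> (forall t, 0 < t < T -> is_derive t (1 : R) E (E' t)) ->
  (forall t, 0 < t < T -> E' t <= k * E t + d) ->
  forall t, 0 <= t <= T -> E t <= d * t * expR (k * t).
Proof.
move=> d0 cE E0 k0 dE E'le t /andP[t0 tT].
pose phi (s : R) := expR (- k * s) * E s - d * s.
have dlin (c s : R) : is_derive s (1 : R) (fun s : R => c * s) c.
  have := is_deriveZ c (is_derive_id s (1 : R)).
  by congr is_derive; rewrite -[_ *: _]/(_ * _) mulr1.
have dexp (s : R) : is_derive s (1 : R) (fun s => expR (- k * s)) (expR (- k * s) * - k).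
  exact: (@is_derive1_comp _ (@expR R) (fun s => - k * s) s _ _ (is_derive_expR _) (dlin _ _)).
have dphi s : 0 < s < T ->
    is_derive s (1 : R) phi (expR (- k * s) * (E' s - k * E s) - d).
  move=> sT; have := is_deriveB (is_deriveM (dexp s) (dE s sT)) (dlin d s).
  by congr is_derive; rewrite -![_ *: _]/(_ * _); ring.
have phi_le s : 0 < s < T -> derive1 phi s <= 0.
  move=> sT; rewrite derive1E (is_derive_val _ _ _ _ _ _ (dphi s sT)) subr_le0.
  rewrite -[leRHS]mul1r; have := E'le s sT; rewrite -lerBlDl => H.
  have e1 : expR (- k * s) <= 1.
    rewrite -expR0 ler_expR mulNr oppr_le0 mulr_ge0//.
    by case/andP: sT => /ltW.
  apply: (@le_trans _ _ (expR (- k * s) * d)).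
    by rewrite ler_wpM2l// expR_ge0.
  by rewrite ler_wpM2r.
have cphi : continuous phi.
  have cexp : continuous (fun s : R => expR (- k * s)).
    by move=> s; apply: is_derive_continuous (dexp s).
  have cid : continuous (fun s : R => s) by move=> s; exact: cvg_id.
  by rewrite /phi; continuity.
have : phi t <= phi 0.
  apply: (@ler0_derive1_le_cc _ phi 0 T).
  - by move=> s; rewrite in_itv/= => sT; exact: is_derive_derivable (dphi s sT).
  - by move=> s; rewrite in_itv/=; exact: phi_le.
  - exact: continuous_subspaceT.
  - by rewrite in_itv/= t0 tT.
  - by rewrite in_itv/= lexx (le_trans t0 tT).
  - exact: t0.
rewrite /phi E0 !mulr0 subrr subr_le0 mulNr expRN.
by rewrite mulrC ler_pdivrMr ?expR_gt0.
Qed.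

End generic.

(** * The equation satisfied by the difference of two solutions *)

Section difference.
Context {R : realType}.
Local Notation mu := (@lebesgue_measure R).
Local Notation mu2 := (mu \x mu)%E.
Implicit Types (u v : R -> R * R -> 'rV[R]_3) (P : R -> R * R -> R).

Lemma continuous_velocity u i t : classical_velocity u -> 0 <= t -> continuous (cpt u i t).
Proof.
move=> /(_ i)[/continuous_max0_extension cu _] t0 x.
have := continuous_section _ _ _ (cu (t, x)).
by rewrite /= max_l.
Qed.

Lemma velocity_is_derive u i j t x : classical_velocity u -> 0 < t ->
  is_derive x (dir R j) (cpt u i t) (pd j (cpt u i t) x).
Proof. by move=> /(_ i)[_ H] /(H _ x)[_ d _ _]; exact: is_derive_pd. Qed.

Lemma velocity_is_derive2 u i j k t x : classical_velocity u -> 0 < t ->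
  is_derive x (dir R k) (pd j (cpt u i t)) (pd k (pd j (cpt u i t)) x).
Proof. by move=> /(_ i)[_ H] /(H _ x)[_ _ d _]; exact: is_derive_pd. Qed.

Lemma continuous_velocity_pd u i j t : classical_velocity u -> 0 < t ->
  continuous (pd j (cpt u i t)).
Proof.
move=> /(_ i)[_ H] t0 x; have [_ _ _ [_ c _]] := H t x t0.
exact: (continuous_section (fun z => pd j (cpt u i z.1) z.2) t x (c j)).
Qed.

Lemma continuous_velocity_pd2 u i j k t : classical_velocity u -> 0 < t ->
  continuous (pd k (pd j (cpt u i t))).
Proof.
move=> /(_ i)[_ H] t0 x; have [_ _ _ [_ _ c]] := H t x t0.
exact: (continuous_section (fun z => pd k (pd j (cpt u i z.1)) z.2) t x (c j k)).
Qed.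

Lemma Ck1_is_derive (P : R * R -> R) j x : Ck 1 P -> is_derive x (dir R j) P (pd j P x).
Proof. by move=> /(_ [::] isT)[_ /(_ isT j x)]; exact: is_derive_pd. Qed.

Lemma Ck1_continuous (P : R * R -> R) : Ck 1 P -> continuous P.
Proof. by move=> /(_ [::] isT)[]. Qed.

Lemma Ck1_continuous_pd (P : R * R -> R) j : Ck 1 P -> continuous (pd j P).
Proof. by move=> /(_ [:: j] isT)[]. Qed.

Lemma is_derive_sub (V : normedModType R) (f g : V -> R) (x h : V) (df dg : R) :
  is_derive x h f df -> is_derive x h g dg -> is_derive x h (fun x => f x - g x) (df - dg).
Proof. by move=> Hf Hg; exact: is_deriveB. Qed.

Lemma continuous_sub (T : topologicalType) (f g : T -> R) :
  continuous f -> continuous g -> continuous (fun x => f x - g x).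
Proof. by move=> cf cg x; apply: cvgB; [exact: cf|exact: cg]. Qed.

(** With w = v - u, the convection terms are split as (v . grad) w + (w . grad) u and not the other
    way round: the gradient that remains undifferentiated must be that of the heat flow. *)
Lemma momentum_difference (nu dv du lv lu v0 v1 v2 u0 u1 u2 av0 av1 au0 au1 qv qu : R) :
  dv - nu * lv + (v0 * av0 + v1 * av1 + v2 * 0) + qv = 0 ->
  du - nu * lu + (u0 * au0 + u1 * au1 + u2 * 0) + qu = 0 ->
  dv - du = nu * (lv - lu) - (v0 * (av0 - au0) + v1 * (av1 - au1))
    - ((v0 - u0) * au0 + (v1 - u1) * au1) - (qv - qu).
Proof.
move=> Hv Hu.
have -> : dv = nu * lv - (v0 * av0 + v1 * av1) - qv by lra.
have -> : du = nu * lu - (u0 * au0 + u1 * au1) - qu by lra.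
ring.
Qed.

Lemma velocity_difference u v Pu Pv (nu : R) i t x :
  momentum_eq nu u Pu -> momentum_eq nu v Pv -> 0 < t ->
  dt v i t x - dt u i t x =
  nu * ((pd 0 (pd 0 (cpt v i t)) x - pd 0 (pd 0 (cpt u i t)) x)
        + (pd 1 (pd 1 (cpt v i t)) x - pd 1 (pd 1 (cpt u i t)) x))
  - (cpt v 0 t x * (pd 0 (cpt v i t) x - pd 0 (cpt u i t) x)
     + cpt v 1 t x * (pd 1 (cpt v i t) x - pd 1 (cpt u i t) x))
  - ((cpt v 0 t x - cpt u 0 t x) * pd 0 (cpt u i t) x
     + (cpt v 1 t x - cpt u 1 t x) * pd 1 (cpt u i t) x)
  - (pd i (Pv t) x - pd i (Pu t) x).
Proof.
move=> mu_ mv_ t0; have := mv_ t x i t0; have := mu_ t x i t0.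
rewrite !sum_ord3 !pd2 /laplacian => Hu Hv.
rewrite (momentum_difference _ _ _ _ _ _ _ _ _ _ _ _ _ _ _ _ _ Hv Hu).
by congr (nu * _ - _ - _ - _); rewrite opprD addrACA.
Qed.

Lemma div_difference u v t x : divergence_free u -> divergence_free v -> 0 < t ->
  (pd 0 (cpt v 0 t) x - pd 0 (cpt u 0 t) x) + (pd 1 (cpt v 1 t) x - pd 1 (cpt u 1 t) x) = 0.
Proof.
move=> du dv t0; have := du t x t0; have := dv t x t0; rewrite !sum_ord3 !pd2 !addr0 => Hv Hu.
by rewrite addrACA -opprD Hv Hu subrr.
Qed.

Definition cut_square (M : R) : set (R * R) :=
  rect (- cut_radius M) (cut_radius M) (- cut_radius M) (cut_radius M).

Definition vdiff u v (i : 'I_3) (t : R) (x : R * R) : R := cpt v i t x - cpt u i t x.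

Definition vdiff_sqr u v (t : R) (x : R * R) : R :=
  vdiff u v 0 t x * vdiff u v 0 t x + vdiff u v 1 t x * vdiff u v 1 t x.

(** The energy estimate for the logarithmic cutoff: the gradient bound [G] is [M^-1], and the
    weighted Dirichlet term is replaced by [2 * pi ^+ 2 / M]. *)
Lemma difference_estimate u v Pu Pv (nu C Q K M eps t : R) :
  0 < nu -> 0 < t -> 0 < M -> 0 < eps ->
  classical_velocity u -> classical_velocity v -> divergence_free u -> divergence_free v ->
  momentum_eq nu u Pu -> momentum_eq nu v Pv -> Ck 1 (Pu t) -> Ck 1 (Pv t) ->
  (forall x i, `|cpt v i t x| <= C) -> (forall x, `|Pv t x - Pu t x| <= Q) ->
  (forall x i j, `|pd j (cpt u i t) x| <= K) ->
  \int[mu2]_(z in cut_square M) (cutoff M z ^+ 2 *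
     (vdiff u v 0 t z * (dt v 0 t z - dt u 0 t z)
      + vdiff u v 1 t z * (dt v 1 t z - dt u 1 t z))) <=
  (2 * nu * M^-1 ^+ 2 + 2 * C * M^-1 + Q * eps) * \int[mu2]_(z in cut_square M) vdiff_sqr u v t z
  + Q / eps * (2 * pi ^+ 2 / M)
  + 2 * K * \int[mu2]_(z in cut_square M) (cutoff M z ^+ 2 * vdiff_sqr u v t z).
Proof.
move=> nu0 t0 M0 eps0 cu cv du dv mu_ mv_ Pu1 Pv1 vC PQ uK.
have Q0 : 0 <= Q by exact: le_trans (PQ 0).
under eq_Rintegral => z _ do rewrite (velocity_difference _ _ _ _ nu 0 t z mu_ mv_ t0)
  (velocity_difference _ _ _ _ nu 1 t z mu_ mv_ t0).
have := energy_estimate nu (cut_radius M) C M^-1 Q K eps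
  (cutoff M) (cutoff_grad1 M) (cutoff_grad2 M) (vdiff u v 0 t) (vdiff u v 1 t)
  (fun x => pd 0 (cpt v 0 t) x - pd 0 (cpt u 0 t) x)
  (fun x => pd 1 (cpt v 0 t) x - pd 1 (cpt u 0 t) x)
  (fun x => pd 0 (cpt v 1 t) x - pd 0 (cpt u 1 t) x)
  (fun x => pd 1 (cpt v 1 t) x - pd 1 (cpt u 1 t) x)
  (fun x => pd 0 (pd 0 (cpt v 0 t)) x - pd 0 (pd 0 (cpt u 0 t)) x)
  (fun x => pd 1 (pd 1 (cpt v 0 t)) x - pd 1 (pd 1 (cpt u 0 t)) x)
  (fun x => pd 0 (pd 0 (cpt v 1 t)) x - pd 0 (pd 0 (cpt u 1 t)) x)
  (fun x => pd 1 (pd 1 (cpt v 1 t)) x - pd 1 (pd 1 (cpt u 1 t)) x)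
  (cpt v 0 t) (cpt v 1 t) (pd 0 (cpt v 0 t)) (pd 1 (cpt v 1 t))
  (fun x => Pv t x - Pu t x)
  (fun x => pd 0 (Pv t) x - pd 0 (Pu t) x)
  (fun x => pd 1 (Pv t) x - pd 1 (Pu t) x)
  (pd 0 (cpt u 0 t)) (pd 1 (cpt u 0 t)) (pd 0 (cpt u 1 t)) (pd 1 (cpt u 1 t)) nu0 (cut_radius_ge0 M) eps0.
have dD i j x := is_derive_sub _ _ _ _ _ _ _ (velocity_is_derive v i j t x cv t0)
  (velocity_is_derive u i j t x cu t0).
have dD2 i j k x := is_derive_sub _ _ _ _ _ _ _ (velocity_is_derive2 v i j k t x cv t0)
  (velocity_is_derive2 u i j k t x cu t0).
have cD i := continuous_sub _ _ _ (continuous_velocity v i t cv (ltW t0))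
   (continuous_velocity u i t cu (ltW t0)).
have cD1 i j := continuous_sub _ _ _ (continuous_velocity_pd v i j t cv t0)
   (continuous_velocity_pd u i j t cu t0).
have cD2 i j k := continuous_sub _ _ _ (continuous_velocity_pd2 v i j k t cv t0)
   (continuous_velocity_pd2 u i j k t cu t0).
have dP j x := is_derive_sub _ _ _ _ _ _ _ (Ck1_is_derive _ j x Pv1) (Ck1_is_derive _ j x Pu1).
have cP := continuous_sub _ _ _ (Ck1_continuous _ Pv1) (Ck1_continuous _ Pu1).
have cP1 j := continuous_sub _ _ _ (Ck1_continuous_pd _ j Pv1) (Ck1_continuous_pd _ j Pu1).
have divv x : pd 0 (cpt v 0 t) x + pd 1 (cpt v 1 t) x = 0.
  by have := dv t x t0; rewrite sum_ord3 pd2 addr0.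
move=> /(_ (is_derive_cutoff_sqr1 M) (is_derive_cutoff_sqr2 M)).
move=> /(_ (dD 0 0) (dD 0 1) (dD 1 0) (dD 1 1)).
move=> /(_ (dD2 0 0 0) (dD2 0 1 1) (dD2 1 0 0) (dD2 1 1 1)).
move=> /(_ (fun x => velocity_is_derive v 0 0 t x cv t0) (fun x => velocity_is_derive v 1 1 t x cv t0)).
move=> /(_ (dP 0) (dP 1) (continuous_cutoff M) (continuous_cutoff_grad1 M) (continuous_cutoff_grad2 M)).
move=> /(_ (cD 0) (cD 1) (cD1 0 0) (cD1 0 1) (cD1 1 0) (cD1 1 1)).
move=> /(_ (cD2 0 0 0) (cD2 0 1 1) (cD2 1 0 0) (cD2 1 1 1)).
move=> /(_ (continuous_velocity v 0 t cv (ltW t0)) (continuous_velocity v 1 t cv (ltW t0))).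
move=> /(_ (continuous_velocity_pd v 0 0 t cv t0) (continuous_velocity_pd v 1 1 t cv t0)).
move=> /(_ cP (cP1 0) (cP1 1)).
move=> /(_ (continuous_velocity_pd u 0 0 t cu t0) (continuous_velocity_pd u 0 1 t cu t0)).
move=> /(_ (continuous_velocity_pd u 1 0 t cu t0) (continuous_velocity_pd u 1 1 t cu t0)).
move=> /(_ divv (fun x => div_difference u v t x du dv t0)).
move=> /(_ (fun x => cutoff_itv M x M0) (fun y => cutoff_radius1 M y M0)).
move=> /(_ (fun y => cutoff_Nradius1 M y M0) (fun y => cutoff_radius2 M y M0)
  (fun y => cutoff_Nradius2 M y M0)).
move=> /(_ (fun x => cutoff_grad1_le M x M0) (fun x => cutoff_grad2_le M x M0)).
move=> /(_ (fun x => vC x 0) (fun x => vC x 1) PQ).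
move=> /(_ (fun x => uK x 0 0) (fun x => uK x 0 1) (fun x => uK x 1 0) (fun x => uK x 1 1)).
move=> /le_trans; apply; rewrite lerD2r lerD2l ler_wpM2l//.
  by rewrite divr_ge0 // ltW.
exact: cutoff_dirichlet.
Qed.

End difference.

(** * Time dependence of integrals over a fixed rectangle *)

Section parametric.
Context {R : realType}.
Local Notation mu := (@lebesgue_measure R).
Local Notation mu2 := (mu \x mu)%E.
Implicit Types f : R * (R * R) -> R.

Lemma compact_slab (s t a b c d : R) : compact (`[s, t]%classic `*` rect a b c d).
Proof. by apply: compact_setX; [exact: segment_compact|exact: compact_rect]. Qed.

Lemma continuous_integral_rect f (a b c d : R) : continuous f ->
  continuous (fun t => \int[mu2]_(z in rect a b c d) f (t, z)).
Proof.
move=> cf t.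
have [C fC] := compact_norm_bound _ f _ (compact_slab (t - 1) (t + 1) a b c d) (fun p _ => cf p).
have iC : mu2.-integrable (rect a b c d) (EFin \o (fun _ : R * R => C)).
  by apply: integrable_rect => x; exact: cvg_cst.
apply: (@continuous_Rintegral R R^o (fun s z => f (s, z)) (fun=> C) (rect a b c d) t 1).
- exact: measurable_rect.
- exact: ltr01.
- move=> s; apply: (@measurable_funS _ _ _ _ setT) => //.
  apply: continuous_measurable_plane => x; exact: continuous_section (cf (s, x)).
- move=> z _; exact: continuous_section_time (cf (t, z)).
- exact: iC.
- move=> s z; rewrite -ball_normE /ball_/= => st Bz; apply: fC; split => //=.
  rewrite in_itv/=; move: st; rewrite ltr_norml => /andP[h1 h2].
  by apply/andP; split; lra.
Qed.

Lemma is_derive_integral_rect f f' (a b c d t : R) : 0 < t ->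
  (forall s : R, 0 < s -> continuous (fun z => f (s, z))) ->
  (forall (s : R) (z : R * R), 0 < s -> is_derive s (1 : R) (fun s => f (s, z)) (f' (s, z))) ->
  (forall (s : R) (z : R * R), 0 < s -> {for (s, z), continuous f'}) ->
  is_derive t (1 : R) (fun t => \int[mu2]_(z in rect a b c d) f (t, z))
    (\int[mu2]_(z in rect a b c d) f' (t, z)).
Proof.
move=> t0 cf df cf'.
(* [f'] is continuous at positive times only, so the majorant is taken on a compact slab of times
   [t / 2, t + 1]. *)
have pos s : t / 2 <= s -> 0 < s by move=> ts; lra.
have cfK p : (`[t / 2, t + 1]%classic `*` rect a b c d) p -> {for p, continuous f'}.
  by case: p => s z [/= /andP[ts _] _]; apply: cf'; apply: pos; move: ts; rewrite bnd_simp.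
have [C fC] := compact_norm_bound _ f' _ (compact_slab (t / 2) (t + 1) a b c d) cfK.
have iC : mu2.-integrable (rect a b c d) (EFin \o (fun _ : R * R => `|C|)).
  by apply: integrable_rect => x; exact: cvg_cst.
apply: (is_derive_Rintegral (fun s z => f (s, z)) (fun s z => f' (s, z)) (fun=> `|C|)
  (rect a b c d) t (t / 2) (t + 1)).
- exact: measurable_rect.
- by apply/andP; split; lra.
- move=> s /andP[/ltW /pos s0 _]; apply: integrable_rect; exact: cf.
- by move=> s z /andP[/ltW /pos s0 _] _; exact: df.
- by move=> z; exact: normr_ge0.
- exact: iC.
- move=> s z /andP[h1 h2] Bz; apply: le_trans (ler_norm C); apply: fC; split => //=.
  by rewrite in_itv/= !ltW.
Qed.

End parametric.

(** * The localized energy of the difference and its time derivative *)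

Section local_energy.
Context {R : realType}.
Local Notation mu := (@lebesgue_measure R).
Local Notation mu2 := (mu \x mu)%E.
Implicit Types (u v : R -> R * R -> 'rV[R]_3) (P : R -> R * R -> R).

(* [Num.max t 0] extends the energy to a continuous function on the whole line. *)
Definition local_energy u v (M t : R) : R :=
  \int[mu2]_(z in cut_square M) (cutoff M z ^+ 2 * vdiff_sqr u v (Num.max t 0) z).

Lemma continuous_vdiff_sqr u v : classical_velocity u -> classical_velocity v ->
  continuous (fun p : R * (R * R) => vdiff_sqr u v (Num.max p.1 0) p.2).
Proof.
move=> cu cv.
have cD i : continuous (fun p : R * (R * R) => vdiff u v i (Num.max p.1 0) p.2).
  apply: continuous_sub.
  - exact: continuous_max0_extension (cv i).1.
  - exact: continuous_max0_extension (cu i).1.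
have c0 := cD 0; have c1 := cD 1; rewrite /vdiff_sqr; continuity.
Qed.

Lemma continuous_vdiff_sqr_slice u v t : classical_velocity u -> classical_velocity v ->
  0 <= t -> continuous (vdiff_sqr u v t).
Proof.
move=> cu cv t0.
have cD i : continuous (vdiff u v i t) by apply: continuous_sub; exact: continuous_velocity.
have c0 := cD 0; have c1 := cD 1; rewrite /vdiff_sqr; continuity.
Qed.

Lemma continuous_cutoff_time (M : R) : continuous (fun p : R * (R * R) => cutoff M p.2).
Proof.
move=> p; apply: (@continuous_comp _ _ _ snd (cutoff M) p); first exact: cvg_snd.
exact: continuous_cutoff.
Qed.

Lemma continuous_local_energy u v M : classical_velocity u -> classical_velocity v ->
  continuous (local_energy u v M).
Proof.
move=> cu cv.
apply: (continuous_integral_rect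
  (fun p => cutoff M p.2 ^+ 2 * vdiff_sqr u v (Num.max p.1 0) p.2)).
have c1 := continuous_vdiff_sqr _ _ cu cv; have c2 := continuous_cutoff_time M.
continuity.
Qed.

Lemma is_derive_vdiff u v (i : 'I_3) (t : R) (x : R * R) : classical_velocity u -> classical_velocity v -> 0 < t ->
  is_derive t (1 : R) (fun t => vdiff u v i t x) (dt v i t x - dt u i t x).
Proof.
move=> cu cv t0; have [dv _ _ _] := (cv i).2 t x t0; have [du _ _ _] := (cu i).2 t x t0.
apply: is_derive_sub; exact: DeriveDef.
Qed.

Lemma is_derive_vdiff_sqr u v (t : R) (x : R * R) (c : R) : classical_velocity u -> classical_velocity v -> 0 < t ->
  is_derive t (1 : R) (fun t => c * vdiff_sqr u v t x)
   (2 * (c * (vdiff u v 0 t x * (dt v 0 t x - dt u 0 t x)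
        + vdiff u v 1 t x * (dt v 1 t x - dt u 1 t x)))).
Proof.
move=> cu cv t0.
have d0 := is_derive_vdiff u v 0 t x cu cv t0; have d1 := is_derive_vdiff u v 1 t x cu cv t0.
have := is_deriveZ c (is_deriveD (is_deriveM d0 d0) (is_deriveM d1 d1)).
by congr is_derive; rewrite -![_ *: _]/(_ * _); ring.
Qed.

Lemma continuous_at_production (T : topologicalType) (p : T) (a b0 c0 b1 c1 : T -> R) :
  {for p, continuous a} -> {for p, continuous b0} -> {for p, continuous c0} ->
  {for p, continuous b1} -> {for p, continuous c1} ->
  {for p, continuous (fun p => a p ^+ 2 * (b0 p * c0 p + b1 p * c1 p))}.
Proof.
move=> ca cb0 cc0 cb1 cc1; apply: cvgM.
  by apply: (@continuous_comp _ _ _ a (fun y => y ^+ 2) p) => //; exact: exprn_continuous.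
by apply: cvgD; apply: cvgM.
Qed.

Lemma continuous_at_cpt u (i : 'I_3) (t : R) (x : R * R) : classical_velocity u -> 0 < t ->
  {for (t, x), continuous (fun p : R * (R * R) => cpt u i p.1 p.2)}.
Proof.
move=> cu t0; have ce := continuous_max0_extension _ (cu i).1 (t, x).
have pos : \forall p \near (t, x), 0 < p.1.
  exact: (@cvg_fst _ _ (nbhs t) (nbhs x) _ _ (lt_nbhsr t0)).
move=> U HU; have HV : nbhs (t, x) (fun p => U (cpt u i (Num.max p.1 0) p.2)).
  by apply: ce; rewrite /= max_l// ltW.
suff : nbhs (t, x) (fun p => U (cpt u i p.1 p.2)) by [].
by apply: filterS2 HV pos => p Up p0; rewrite max_l ?ltW// in Up.
Qed.

Lemma continuous_at_vdiff u v (i : 'I_3) (t : R) (x : R * R) : classical_velocity u -> classical_velocity v -> 0 < t ->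
  {for (t, x), continuous (fun p : R * (R * R) => vdiff u v i p.1 p.2)}.
Proof.
move=> cu cv t0; have c1 := continuous_at_cpt u i t x cu t0.
have c2 := continuous_at_cpt v i t x cv t0; exact: cvgB c2 c1.
Qed.

Lemma continuous_at_dvdiff u v (i : 'I_3) (t : R) (x : R * R) : classical_velocity u -> classical_velocity v -> 0 < t ->
  {for (t, x), continuous (fun p : R * (R * R) => dt v i p.1 p.2 - dt u i p.1 p.2)}.
Proof.
move=> cu cv t0; have [_ _ _ [dv _ _]] := (cv i).2 t x t0; have [_ _ _ [du _ _]] := (cu i).2 t x t0.
exact: cvgB dv du.
Qed.

Lemma is_derive_local_energy u v (M t : R) : classical_velocity u -> classical_velocity v -> 0 < t ->
  is_derive t (1 : R) (local_energy u v M)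
   (2 * \int[mu2]_(z in cut_square M) (cutoff M z ^+ 2 *
     (vdiff u v 0 t z * (dt v 0 t z - dt u 0 t z)
      + vdiff u v 1 t z * (dt v 1 t z - dt u 1 t z)))).
Proof.
move=> cu cv t0.
have cf (s : R) : 0 < s -> continuous (fun z => cutoff M z ^+ 2 * vdiff_sqr u v s z).
  move=> s0; have c1 := continuous_cutoff M.
  by have c2 := continuous_vdiff_sqr_slice u v s cu cv (ltW s0); continuity.
have cp (s : R) (z : R * R) : 0 < s -> {for (s, z), continuous (fun p : R * (R * R) =>
    cutoff M p.2 ^+ 2 * (vdiff u v 0 p.1 p.2 * (dt v 0 p.1 p.2 - dt u 0 p.1 p.2)
      + vdiff u v 1 p.1 p.2 * (dt v 1 p.1 p.2 - dt u 1 p.1 p.2)))}.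
  move=> s0; apply: continuous_at_production.
  - exact: continuous_cutoff_time.
  - exact: continuous_at_vdiff.
  - exact: continuous_at_dvdiff.
  - exact: continuous_at_vdiff.
  - exact: continuous_at_dvdiff.
have cp2 (s : R) (z : R * R) : 0 < s -> {for (s, z), continuous (fun p : R * (R * R) =>
    2 * (cutoff M p.2 ^+ 2 * (vdiff u v 0 p.1 p.2 * (dt v 0 p.1 p.2 - dt u 0 p.1 p.2)
      + vdiff u v 1 p.1 p.2 * (dt v 1 p.1 p.2 - dt u 1 p.1 p.2))))}.
  by move=> s0; apply: cvgM; [exact: cvg_cst|exact: cp].
have H := is_derive_integral_rect
  (fun p => cutoff M p.2 ^+ 2 * vdiff_sqr u v p.1 p.2) _
  (- cut_radius M) (cut_radius M) (- cut_radius M) (cut_radius M) t t0 cf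
  (fun s z s0 => is_derive_vdiff_sqr u v s z (cutoff M z ^+ 2) cu cv s0) cp2.
rewrite -RintegralZl; last first.
- apply: integrable_rect => z; exact: continuous_section (cp t z t0).
- exact: measurable_rect.
apply: near_eq_is_derive H.
near=> s; rewrite /local_energy max_l//.
by near: s; apply: filterS (lt_nbhsr t0) => r; exact: ltW.
Unshelve. all: end_near. Qed.

End local_energy.

(** * Upper and lower bounds for the localized energy *)

Section uniqueness.
Context {R : realType}.
Local Notation mu := (@lebesgue_measure R).
Local Notation mu2 := (mu \x mu)%E.
Implicit Types (u v : R -> R * R -> 'rV[R]_3) (P : R -> R * R -> R).

(** The source term in Gronwall's inequality: twice what the localization costs, [N] being a bound
    for the energy of the difference. Only this part has to vanish as [M] grows. *)
Definition energy_defect (nu C Q N M eps : R) : R :=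
  2 * ((2 * nu * M^-1 ^+ 2 + 2 * C * M^-1 + Q * eps) * N + Q / eps * (2 * pi ^+ 2 / M)).

Lemma local_energy0 u v (M : R) :
  (forall i x, cpt u i 0 x = cpt v i 0 x) -> local_energy u v M 0 = 0.
Proof.
move=> uv; rewrite /local_energy /vdiff_sqr /vdiff maxxx.
under eq_Rintegral do rewrite !uv !subrr !mulr0 addr0 mulr0.
by rewrite /Rintegral integral0.
Qed.

(** Gronwall with zero initial value. The rate [4 * K] is the stretching constant [2 * K] times the
    2 from differentiating a square. *)
Lemma local_energy_le u v Pu Pv (nu C Q K N M eps T : R) :
  0 < nu -> 0 < M -> 0 < eps -> 0 <= C -> 0 <= Q -> 0 <= K -> 0 <= N ->
  classical_velocity u -> classical_velocity v -> divergence_free u -> divergence_free v ->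
  momentum_eq nu u Pu -> momentum_eq nu v Pv ->
  (forall t, 0 < t -> Ck 1 (Pu t)) -> (forall t, 0 < t -> Ck 1 (Pv t)) ->
  (forall t x i, 0 < t < T -> `|cpt v i t x| <= C) ->
  (forall t x, 0 < t < T -> `|Pv t x - Pu t x| <= Q) ->
  (forall t x i j, 0 < t < T -> `|pd j (cpt u i t) x| <= K) ->
  (forall t, 0 < t < T -> \int[mu2]_(z in cut_square M) vdiff_sqr u v t z <= N) ->
  (forall i x, cpt u i 0 x = cpt v i 0 x) ->
  forall t : R, 0 <= t <= T ->
  local_energy u v M t <= energy_defect nu C Q N M eps * t * expR (4 * K * t).
Proof.
move=> nu0 M0 eps0 C0 Q0 K0 N0 cu cv du dv mu_ mv_ Pu1 Pv1 vC PQ uK WN uv0.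
have iM : 0 <= M^-1 by rewrite invr_ge0 ltW.
have p0 : 0 <= 2 * nu * M^-1 ^+ 2 + 2 * C * M^-1 + Q * eps.
  by rewrite !addr_ge0// !mulr_ge0// ?sqr_ge0// ltW.
have d0 : 0 <= energy_defect nu C Q N M eps.
  have q0 : 0 <= Q / eps by rewrite divr_ge0// ltW.
  have q1 : 0 <= 2 * pi ^+ 2 / M :> R by rewrite mulr_ge0// mulr_ge0// sqr_ge0.
  exact: mulr_ge0 (ler0n _ _) (addr_ge0 (mulr_ge0 p0 N0) (mulr_ge0 q0 q1)).
apply: (gronwall (local_energy u v M) _ (4 * K) _ T d0
  (continuous_local_energy u v M cu cv) (local_energy0 u v M uv0)).
- by rewrite mulr_ge0.
- by move=> t /andP[t0 _]; exact: is_derive_local_energy.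
move=> t tT; have /andP[t0 _] := tT.
have := difference_estimate u v Pu Pv nu C Q K M eps t nu0 t0 M0 eps0 cu cv du dv mu_ mv_
  (Pu1 t t0) (Pv1 t t0) (fun x i => vC t x i tT) (fun x => PQ t x tT) (fun x i j => uK t x i j tT).
rewrite /local_energy (max_l (ltW t0)).
have := ler_wpM2l p0 (WN t tT).
rewrite /energy_defect.
move: (2 * nu * _ + _ + _) (\int[_]_(_ in _) vdiff_sqr u v t _) => p I1.
move: (\int[_]_(_ in _) (cutoff M _ ^+ 2 * (vdiff _ _ _ _ _ * _ + _))) => I2.
move: (\int[_]_(_ in _) (cutoff M _ ^+ 2 * _)) => I3.
move: (Q / eps * _) => I4 h1 h2.
have e : 4 * K * I3 = 2 * (2 * K * I3) by ring.
rewrite e; move: (2 * K * I3) h2 => I5 h2; move: (p * I1) (p * N) h1 h2 => a b h1 h2.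
lra.
Qed.

(* With [M = m ^ 2] and [eps = 1 / m] both [Q * eps] and [Q / (eps * M)] are [O(1 / m)]. *)
Lemma energy_defect_le (nu C Q N m : R) : 0 <= nu -> 0 <= C -> 0 <= Q -> 0 <= N -> 1 <= m ->
  energy_defect nu C Q N (m ^+ 2) m^-1 <=
  2 * ((2 * nu + 2 * C + Q) * N + Q * (2 * pi ^+ 2)) / m.
Proof.
move=> nu0 C0 Q0 N0 m1; have m0 : 0 < m by exact: lt_le_trans m1.
have mn0 : m != 0 by rewrite lt0r_neq0.
rewrite /energy_defect -[leRHS]mulrA ler_pM2l ?ltr0n// [leRHS]mulrDl; apply: lerD; last first.
  by rewrite le_eqVlt; apply/orP; left; apply/eqP; field.
rewrite [leRHS]mulrAC ler_wpM2r// (mulrDl (_ + _) Q) (mulrDl (2 * nu)).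
have i0 : 0 <= m^-1 by rewrite invr_ge0 ltW.
have i1 : m^-1 <= 1 by rewrite invf_le1.
have i2 : m^-1 ^+ 2 <= m^-1 by rewrite expr2 ler_piMl.
have i4 : (m^-1 ^+ 2) ^+ 2 <= m^-1.
  apply: le_trans i2; rewrite [leLHS]expr2 ler_piMl ?sqr_ge0//.
  by rewrite expr2 mulr_ile1.
rewrite -exprVn; apply: lerD => //; apply: lerD; by rewrite ler_wpM2l// mulr_ge0.
Qed.

Lemma cutoff_gt0_square (M : R) x : 0 < M -> 0 < cutoff M x -> cut_square M x.
Proof.
move=> M0 cx.
suff H : `|x.1| <= cut_radius M /\ `|x.2| <= cut_radius M.
  by case: H; rewrite !ler_norml => h1 h2; split; rewrite /= in_itv.
have sq (a : R) : cut_radius M < `|a| -> expR M <= 1 + a ^+ 2.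
  move=> H; rewrite -cut_radius_sqr// lerD2l -[leRHS]real_normK ?num_real//.
  by rewrite ler_pXn2r ?nnegrE ?cut_radius_ge0// ltW.
split; rewrite leNgt; apply/negP => /sq H; move: cx; rewrite cutoff_eq0 ?ltxx//.
- by apply: le_trans H _; rewrite /den lerDl sqr_ge0.
- by apply: le_trans H _; rewrite /den addrAC lerDl sqr_ge0.
Qed.

Lemma cutoff_ge_half (M : R) x : 0 < M -> 2 * ln (den x) <= M -> 2^-1 <= cutoff M x.
Proof.
move=> M0 H; rewrite /cutoff le_max; apply/orP; left.
have : ln (den x) / M <= 2^-1 by rewrite ler_pdivrMr// mulrC ler_pdivlMr// mulrC.
lra.
Qed.

Lemma rect_gt0 (a b c d : R) : a < b -> c < d -> 0 < fine (mu2 (rect a b c d)).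
Proof.
move=> ab cd; rewrite /rect product_measure1E//= !lebesgue_measure_itv/= !lte_fin ab cd.
by rewrite -!EFinB -EFinM/= mulr_gt0// subr_gt0.
Qed.

(** If the solutions differ at [x], they differ by a definite amount on a small square around it,
    where the cutoff is at least 1/2 once [M >= 2 * ln D], with [D] a bound for [den] there. The
    lower bound [c] is independent of [M], so no limit of integrals is taken. *)
Lemma local_energy_lower u v (t : R) (x : R * R) :
  classical_velocity u -> classical_velocity v -> 0 <= t -> 0 < vdiff_sqr u v t x ->
  exists c M0 : R, 0 < c /\ forall M, 0 < M -> M0 <= M -> c <= local_energy u v M t.
Proof.
move=> cu cv t0 S0; set S := vdiff_sqr u v t in S0 *.
have cS : continuous S by exact: continuous_vdiff_sqr_slice.
have [r r0 Sr] := continuous_at_ball S x (cS x) (S x / 2) (divr_gt0 S0 (ltr0n _ 2)).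
pose B0 := rect (x.1 - r / 2) (x.1 + r / 2) (x.2 - r / 2) (x.2 + r / 2).
have B0r y : B0 y -> S x / 2 <= S y.
  case: y => a b [/=]; rewrite !in_itv/= => /andP[h1 h2] /andP[h3 h4].
  have : `|S (a, b) - S x| < S x / 2.
    by apply: Sr; rewrite ltr_norml; apply/andP; split; lra.
  by rewrite ltr_norml => /andP[+ _]; move: (S x) (S (a, b)) => p q; lra.
have [D xD] := compact_norm_bound _ den B0 (compact_rect _ _ _ _) (fun p _ => continuous_den p).
have m0 : 0 < fine (mu2 B0) by apply: rect_gt0; lra.
exists (2^-1 ^+ 2 * (S x / 2) * fine (mu2 B0)), (2 * ln D); split.
  by rewrite !mulr_gt0 ?exprn_gt0 ?invr_gt0 ?ltr0n.
move=> M M0 DM.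
have half y : B0 y -> 2^-1 <= cutoff M y.
  move=> By; apply: cutoff_ge_half => //; apply: le_trans DM.
  have dD : den y <= D by apply: le_trans (ler_norm _) (xD y By).
  by rewrite ler_pM2l ?ltr0n// ler_ln// posrE ?(lt_le_trans _ dD) ?den_gt0.
have sub : B0 `<=` cut_square M.
  by move=> y /half H; apply: cutoff_gt0_square => //; apply: lt_le_trans H; rewrite invr_gt0.
pose F y := cutoff M y ^+ 2 * S y.
have cF : continuous F.
  by have c1 := continuous_cutoff M; rewrite /F; continuity.
have mB0 : measurable (B0 : set (measurableTypeR R * measurableTypeR R)) by exact: measurable_rect.
have F0 y : 0 <= F y by rewrite /F mulr_ge0 ?sqr_ge0// addr_ge0// -expr2 sqr_ge0.
have le1 : \int[mu2]_(z in B0) F z <= local_energy u v M t.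
  rewrite /local_energy (max_l t0); apply: fine_le.
  - by apply: integrable_fin_num => //; exact: integrable_rect.
  - apply: integrable_fin_num; first exact: measurable_rect.
    exact: integrable_rect.
  - apply: ge0_subset_integral => //; first exact: measurable_rect.
    + by apply: measurable_funS (measurable_EFin_plane _ cF).
    + by move=> y _; rewrite lee_fin.
apply: le_trans le1; rewrite -Rintegral_cst//; apply: le_Rintegral => //.
- by apply: integrable_rect => y; exact: cvg_cst.
- exact: integrable_rect.
- move=> y By; apply: ler_pM.
  + by rewrite exprn_ge0// invr_ge0.
  + by rewrite divr_ge0// ltW.
  + by rewrite ler_pXn2r ?nnegrE ?invr_ge0 ?half// (le_trans _ (half y By)) ?invr_ge0.
  + exact: B0r.
Qed.

End uniqueness.

(** * Uniqueness against a solution with bounded gradient *)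

Section uniqueness_theorem.
Context {R : realType}.
Local Notation mu := (@lebesgue_measure R).
Local Notation mu2 := (mu \x mu)%E.
Implicit Types (u v : R -> R * R -> 'rV[R]_3) (P : R -> R * R -> R).

Lemma vdiff_sqr_ge0 u v t x : 0 <= vdiff_sqr u v t x.
Proof. by rewrite /vdiff_sqr -!expr2 addr_ge0 ?sqr_ge0. Qed.

Lemma sqr_difference_le (a0 a1 a2 b0 b1 b2 : R) :
  (b0 - a0) * (b0 - a0) + (b1 - a1) * (b1 - a1) <=
  2 * (a0 ^+ 2 + a1 ^+ 2 + a2 ^+ 2) + 2 * (b0 ^+ 2 + b1 ^+ 2 + b2 ^+ 2).
Proof.
have h0 : 0 <= (a0 + b0) ^+ 2 by exact: sqr_ge0.
have h1 : 0 <= (a1 + b1) ^+ 2 by exact: sqr_ge0.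
have h2 : 0 <= a2 ^+ 2 by exact: sqr_ge0.
have h3 : 0 <= b2 ^+ 2 by exact: sqr_ge0.
nra.
Qed.

Lemma continuous_kinetic u t : classical_velocity u -> 0 <= t ->
  continuous (fun x => \sum_(i < 3) (u t x 0 i) ^+ 2).
Proof.
move=> cu t0.
have -> : (fun x => \sum_(i < 3) (u t x 0 i) ^+ 2) =
    (fun x => cpt u 0 t x ^+ 2 + cpt u 1 t x ^+ 2 + cpt u 2 t x ^+ 2).
  by apply/funext => x; rewrite sum_ord3.
have c0 := continuous_velocity u 0 t cu t0; have c1 := continuous_velocity u 1 t cu t0.
have c2 := continuous_velocity u 2 t cu t0; continuity.
Qed.

Lemma kinetic_ge0 u (t : R) x : 0 <= \sum_(i < 3) (u t x 0 i) ^+ 2.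
Proof. by apply: sumr_ge0 => i _; exact: sqr_ge0. Qed.

Lemma integral_vdiff_sqr_le u v (a b c d Cu Cv t : R) :
  classical_velocity u -> classical_velocity v -> 0 <= t ->
  (energy (u t) <= Cu%:E)%E -> (energy (v t) <= Cv%:E)%E ->
  \int[mu2]_(z in rect a b c d) vdiff_sqr u v t z <= 2 * Cu + 2 * Cv.
Proof.
move=> cu cv t0 uC vC.
have cS := continuous_vdiff_sqr_slice u v t cu cv t0.
have ku := continuous_kinetic u t cu t0; have kv := continuous_kinetic v t cv t0.
rewrite -lee_fin /Rintegral fineK; last first.
  by apply: integrable_fin_num; [exact: measurable_rect|exact: integrable_rect].
rewrite EFinD !EFinM.
apply: le_trans (leeD (lee_wpmul2l _ uC) (lee_wpmul2l _ vC)) => //.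
rewrite /energy -!ge0_integralZl//; last 4 first.
- exact: measurable_EFin_plane.
- by move=> x _; rewrite lee_fin; exact: kinetic_ge0.
- exact: measurable_EFin_plane.
- by move=> x _; rewrite lee_fin; exact: kinetic_ge0.
rewrite -ge0_integralD//; last 4 first.
- by move=> x _; rewrite -EFinM lee_fin mulr_ge0// kinetic_ge0.
- by apply: measurable_funeM; exact: measurable_EFin_plane.
- by move=> x _; rewrite -EFinM lee_fin mulr_ge0// kinetic_ge0.
- by apply: measurable_funeM; exact: measurable_EFin_plane.
apply: (@le_trans _ _ (\int[mu2]_x (vdiff_sqr u v t x)%:E)%E).
  apply: ge0_subset_integral => //; first exact: measurable_rect.
  - exact: measurable_EFin_plane.
  - by move=> x _; rewrite lee_fin vdiff_sqr_ge0.
apply: ge0_le_integral => //.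
- by move=> x _; rewrite lee_fin vdiff_sqr_ge0.
- exact: measurable_EFin_plane.
- by apply: emeasurable_funD; apply: measurable_funeM; exact: measurable_EFin_plane.
- by move=> x _; rewrite -!EFinM -EFinD lee_fin !sum_ord3; exact: sqr_difference_le.
Qed.

Lemma vanishing_bound (a b c M0 : R) : 0 < c -> 0 <= b ->
  (forall m, 1 <= m -> M0 <= m ^+ 2 -> c <= a / m * b) -> False.
Proof.
move=> c0 b0 H.
(* The first two summands give [m ^+ 2 >= m >= M0]; the last makes [c * m] exceed [|a| * b]. *)
pose m := 1 + `|M0| + (`|a| * b) / c.
have q0 : 0 <= `|a| * b / c by rewrite divr_ge0 ?mulr_ge0// ltW.
have m1 : 1 <= m by rewrite /m -addrA lerDl addr_ge0.
have m0 : 0 < m by exact: lt_le_trans m1.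
have mM : M0 <= m ^+ 2.
  apply: (@le_trans _ _ m); last by rewrite expr2 ler_peMl// ltW.
  by rewrite (le_trans (ler_norm _))// /m; move: q0; move: (_ / c) => q; lra.
have := H m m1 mM; rewrite mulrAC ler_pdivlMr// => h.
have : `|a| * b < c * m.
  rewrite /m mulrDr mulrCA divff ?lt0r_neq0// mulr1 ltrDr mulr_gt0// addr_gt0_ge0//.
have : a * b <= `|a| * b by rewrite ler_wpM2r// ler_norm.
by move: (a * b) (`|a| * b) (c * m) h => x y z; lra.
Qed.

(** The gradient bound is asked of [u] alone. A positive difference at one point would keep the
    local energy above a fixed [c], while with [M = m ^+ 2] it is of order [1 / m]. *)
Lemma global_solution_unique (nu K : R) (u0 : R * R -> 'rV[R]_3) u v :
  0 < nu -> global_solution nu u0 u -> global_solution nu u0 v ->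
  (forall t x i j, 0 < t -> `|pd j (cpt u i t) x| <= K) ->
  forall (t : R) (x : R * R), 0 <= t -> v t x = u t x.
Proof.
move=> nu0 [[phiu ru] [cu [u0E [du [Pu [Pu1 mu_ eu]]]]]].
move=> [[phiv rv] [cv [v0E [dv [Pv [Pv1 mv_ ev]]]]]] uK t x t0.
suff S0 : vdiff_sqr u v t x = 0.
  have [w0 w1] : cpt v 0 t x = cpt u 0 t x /\ cpt v 1 t x = cpt u 1 t x.
    move: S0; rewrite /vdiff_sqr -!expr2 => /eqP.
    rewrite paddr_eq0 ?sqr_ge0// !sqrf_eq0 !subr_eq0 => /andP[/eqP -> /eqP ->] //.
  (* The energy sees the first two components; the third is 0 for both solutions by the symplectic
     representation. *)
  apply/rowP => i; have [_ /(_ x) ruE] := ru t t0; have [_ /(_ x) rvE] := rv t t0.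
  pose Q (j : 'I_3) := v t x 0 j = u t x 0 j.
  by apply: (ord3_ind Q) => //; rewrite /Q ruE rvE !mxE.
apply/eqP; rewrite eq_le vdiff_sqr_ge0 andbT leNgt; apply/negP => S0.
have [c [M0 [c0 low]]] := local_energy_lower u v t x cu cv t0 S0.
have [Cu uC] := eu (t + 1); have [Cv vC] := ev (t + 1).
have tT : 0 <= t <= t + 1 by rewrite t0 lerDl ler01.
have K0 : 0 <= K by exact: le_trans (uK 1 0 0 0 ltr01).
have Cu0 : 0 <= Cu by have [_ /(_ 0 0) H _] := uC t tT; exact: le_trans H.
have Cv0 : 0 <= Cv by have [_ /(_ 0 0) H _] := vC t tT; exact: le_trans H.
have N0 : 0 <= 2 * Cu + 2 * Cv by lra.
have Q0 : 0 <= Cv + Cu by lra.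
have in_T s : 0 < s < t + 1 -> 0 <= s <= t + 1 by move=> /andP[h1 h2]; rewrite !ltW.
apply: (vanishing_bound (2 * ((2 * nu + 2 * Cv + (Cv + Cu)) * (2 * Cu + 2 * Cv)
   + (Cv + Cu) * (2 * pi ^+ 2))) (t * expR (4 * K * t)) c M0 c0).
  by rewrite mulr_ge0// expR_ge0.
move=> m m1 mM; have m0 : 0 < m by exact: lt_le_trans m1.
apply: le_trans (low (m ^+ 2) (exprn_gt0 2 m0) mM) _.
apply: le_trans (local_energy_le u v Pu Pv nu Cv (Cv + Cu) K (2 * Cu + 2 * Cv) (m ^+ 2) m^-1
  (t + 1) nu0 (exprn_gt0 2 m0) _ Cv0 Q0 K0 N0 cu cv du dv mu_ mv_ Pu1 Pv1 _ _ _ _ _ t tT) _.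
- by rewrite invr_gt0.
- by move=> s y i /in_T /vC[].
- move=> s y sT; have /andP[s0 _] := sT.
  have [_ _ /(_ s0 y) h1] := uC s (in_T s sT); have [_ _ /(_ s0 y) h2] := vC s (in_T s sT).
  by apply: le_trans (ler_normB _ _) _; exact: lerD.
- by move=> s y i j /andP[s0 _]; exact: uK.
- move=> s sT; have /andP[s0 _] := sT; have [h1 _ _] := uC s (in_T s sT).
  have [h2 _ _] := vC s (in_T s sT).
  exact: integral_vdiff_sqr_le cu cv (ltW s0) h1 h2.
- by move=> i y; rewrite /cpt u0E v0E.
rewrite -[leLHS]mulrA ler_wpM2r ?mulr_ge0 ?expR_ge0//.
exact: energy_defect_le (ltW nu0) Cv0 Q0 N0 m1.
Qed.

End uniqueness_theorem.

(** * Heat flows of bounded C^2 functions are classical velocities *)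

Section heat_flow.
Context {R : realType}.
Implicit Types (f : R * R -> R) (u : R -> R * R -> 'rV[R]_3).

Definition C1_bounded f := continuous_bounded f /\
  forall j, (forall x, derivable f x (dir R j)) /\ continuous_bounded (pd j f).

Lemma C2_bounded_C1 f : C2_bounded f -> C1_bounded f.
Proof. by case. Qed.

Lemma C2_bounded_pd f j : C2_bounded f -> C1_bounded (pd j f).
Proof. by case=> _ d1 d2; split; [exact: (d1 j).2|exact: d2]. Qed.

Lemma is_derive_scale (V : normedModType R) (a : R) (f : V -> R) (x h : V) (df : R) :
  is_derive x h f df -> is_derive x h (fun x => a * f x) (a * df).
Proof. by move=> Hf; exact: is_deriveZ. Qed.

Lemma is_derive_flow f (a : R) j (s : R) x : C1_bounded f ->
  is_derive x (dir R j) (fun x => a * heat_avg f s x) (a * heat_avg (pd j f) s x).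
Proof.
move=> [[cf [C fC]] /(_ j)[df [cdf [D fD]]]]; apply: is_derive_scale.
exact: is_derive_heat_avg cf (bounded_linear_growth _ _ fC) df cdf fD.
Qed.

Lemma pd_flow f (a : R) j (s : R) : C1_bounded f ->
  pd j (fun x => a * heat_avg f s x) = (fun x => a * heat_avg (pd j f) s x).
Proof.
by move=> Cf; apply/funext => x; exact: is_derive_val (is_derive_flow _ _ _ _ _ Cf).
Qed.

Lemma continuous_flow f (a nu : R) : continuous_bounded f ->
  continuous (fun z : R * (R * R) => a * heat_avg f (Num.sqrt (4 * nu * z.1)) z.2).
Proof.
move=> [cf [C fC]].
have c := continuous_heat_flow f nu C cf (bounded_linear_growth _ _ fC); continuity.
Qed.

Lemma flow_heat_equation f (a nu t : R) x : 0 < nu -> 0 < t -> C2_bounded f ->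
  is_derive t (1 : R) (fun t => a * heat_avg f (Num.sqrt (4 * nu * t)) x)
    (nu * (a * heat_avg (pd 0 (pd 0 f)) (Num.sqrt (4 * nu * t)) x
         + a * heat_avg (pd 1 (pd 1 f)) (Num.sqrt (4 * nu * t)) x)).
Proof.
move=> nu0 t0 Cf; have := is_derive_scale _ a _ _ _ _ (heat_equation f nu t x nu0 t0 Cf).
have avgE j g : C1_bounded g ->
    pd j (heat_avg g (Num.sqrt (4 * nu * t))) = heat_avg (pd j g) (Num.sqrt (4 * nu * t)).
  move=> [[cg [C gC]] /(_ j)[dg [cdg [D gD]]]].
  exact: pd_heat_avg cg (bounded_linear_growth _ _ gC) dg cdg gD.
have C1 := C2_bounded_C1 f Cf; have C1p j := C2_bounded_pd f j Cf.
rewrite /laplacian (avgE 0 f C1) (avgE 1 f C1) (avgE 0 _ (C1p 0)) (avgE 1 _ (C1p 1)).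
by rewrite mulrCA mulrDr.
Qed.

(** The scalar [a] takes the values -1, 1 and 0, so that the three components of a symplectic field
    are handled alike. *)
Lemma classical_velocity_flow u (nu : R) : 0 < nu ->
  (forall i, exists (a : R) f, C2_bounded f /\
     cpt u i = fun t x => a * heat_avg f (Num.sqrt (4 * nu * t)) x) ->
  classical_velocity u.
Proof.
move=> nu0 uE i; have [a [f [Cf E]]] := uE i; have [cf d1 d2] := Cf.
have C1 := C2_bounded_C1 _ Cf.
split; first by rewrite E; apply: continuous_subspaceT; exact: continuous_flow.
move=> t x t0; split.
- by rewrite E; exact: is_derive_derivable (flow_heat_equation _ _ _ _ _ nu0 t0 Cf).
- by move=> j; rewrite E; exact: is_derive_derivable (is_derive_flow _ _ _ _ _ C1).
- move=> j k; rewrite E (pd_flow _ _ _ _ C1).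
  exact: is_derive_derivable (is_derive_flow _ _ _ _ _ (C2_bounded_pd _ j Cf)).
split.
- pose d (z : R * (R * R)) :=
    nu * (a * heat_avg (pd 0 (pd 0 f)) (Num.sqrt (4 * nu * z.1)) z.2
        + a * heat_avg (pd 1 (pd 1 f)) (Num.sqrt (4 * nu * z.1)) z.2).
  (* The formula for [dt] holds at positive times only; continuity is transferred from [d] on a
     neighbourhood of [(t, x)] where times are positive. *)
  have dE (s : R) y : 0 < s -> dt u i s y = d (s, y).
    by move=> s0; rewrite /dt E (is_derive_val _ _ _ _ _ _ (flow_heat_equation _ _ _ _ _ nu0 s0 Cf)).
  have cd : continuous d.
    have c0 := continuous_flow _ a nu (d2 0 0).2; have c1 := continuous_flow _ a nu (d2 1 1).2.
    exact: continuous_mul (continuous_const nu) (continuous_add _ _ c0 c1).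
  have pos : \forall p \near (t, x), 0 < p.1.
    exact: (@cvg_fst _ _ (nbhs t) (nbhs x) _ _ (lt_nbhsr t0)).
  move=> U HU; have HV : nbhs (t, x) (fun p => U (d p)) by apply: cd; rewrite -dE.
  suff : nbhs (t, x) (fun p => U (dt u i p.1 p.2)) by [].
  by apply: filterS2 HV pos => p Up p0; rewrite dE// -surjective_pairing.
- move=> j; suff -> : (fun z : R * (R * R) => pd j (cpt u i z.1) z.2) =
      (fun z => a * heat_avg (pd j f) (Num.sqrt (4 * nu * z.1)) z.2).
    exact: continuous_flow (d1 j).2 _.
  by apply/funext => z; rewrite E (pd_flow _ _ _ _ C1).
- move=> j k; suff -> : (fun z : R * (R * R) => pd k (pd j (cpt u i z.1)) z.2) =
      (fun z => a * heat_avg (pd k (pd j f)) (Num.sqrt (4 * nu * z.1)) z.2).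
    exact: continuous_flow (d2 j k).2 _.
  by apply/funext => z; rewrite E (pd_flow _ _ _ _ C1) (pd_flow _ _ _ _ (C2_bounded_pd _ j Cf)).
Qed.

End heat_flow.

(** * Bounds extracted from the regularity of the initial potential *)

Section uniform_bounds.
Context {R : realType}.

Lemma finite_bound (F : 'I_3 -> R * R -> R) :
  (forall j, exists C : R, forall x, `|F j x| <= C) ->
  exists C : R, forall j x, `|F j x| <= C.
Proof.
move=> FC; have [C0 h0] := FC 0; have [C1 h1] := FC 1; have [C2 h2] := FC 2.
have p0 := le_trans (normr_ge0 _) (h0 0); have p1 := le_trans (normr_ge0 _) (h1 0).
have p2 := le_trans (normr_ge0 _) (h2 0).
exists (C0 + C1 + C2); apply: ord3_ind => x.
- by apply: le_trans (h0 x) _; rewrite -addrA lerDl addr_ge0.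
- by apply: le_trans (h1 x) _; rewrite addrAC lerDr addr_ge0.
- by apply: le_trans (h2 x) _; rewrite lerDr addr_ge0.
Qed.

Lemma lipschitz_linear_growth (f : R * R -> R) (D : R) :
  (forall j x, derivable f x (dir R j)) -> (forall j x, `|pd j f x| <= D) ->
  linear_growth f (`|f 0| + D).
Proof.
move=> df fD [a b]; have D0 : 0 <= D by exact: le_trans (fD 0 0).
have [c1 _] := mean_value1 f 0 a b (fun x => df 0 (x, b)).
have [c2 _] := mean_value2 f 0 0 b (fun y => df 1 (0, y)).
rewrite !add0r => e2 e1.
have h1 : `|f (a, b) - f (0, b)| <= D * `|a| by rewrite e1 normrM ler_wpM2r.
have h2 : `|f (0, b) - f (0, 0)| <= D * `|b| by rewrite e2 normrM ler_wpM2r.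
have -> : f (a, b) = (f (a, b) - f (0, b)) + ((f (0, b) - f (0, 0)) + f (0, 0)).
  by rewrite addrA subrKA subrK.
apply: le_trans (ler_normD _ _) _; apply: le_trans (lerD h1 (ler_normD _ _)) _.
apply: le_trans (lerD (lexx _) (lerD h2 (lexx _))) _ => /=.
have : 0 <= `|f (0, 0)| * (`|a| + `|b|) by rewrite mulr_ge0 ?addr_ge0.
rewrite -[f 0]/(f (0, 0)); move: `|f (0, 0)| `|a| `|b| => p q r; nra.
Qed.

(** Here the three derivatives of the potential are spent: one to form a velocity component, two for
    its heat equation. *)
Lemma regular_C2_bounded (f : R * R -> R) j : Ck 3 f ->
  (forall s : seq 'I_3, (1 <= size s <= 3)%N -> exists C : R, forall x, `|pds s f x| <= C) ->
  C2_bounded (pd j f).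
Proof.
move=> cf fC; split.
- by split; [exact: (cf [:: j] isT).1|exact: (fC [:: j] isT)].
- move=> k; split; first by move=> x; exact: (cf [:: j] isT).2.
  by split; [exact: (cf [:: k; j] isT).1|exact: (fC [:: k; j] isT)].
- move=> k l; split; first by move=> x; exact: (cf [:: k; j] isT).2.
  by split; [exact: (cf [:: l; k; j] isT).1|exact: (fC [:: l; k; j] isT)].
Qed.

Lemma integral_sqrD (f g : R * R -> R) : continuous f -> continuous g ->
  (\int[@plane_measure R]_x (f x ^+ 2 + g x ^+ 2)%:E =
   \int[@plane_measure R]_x (f x ^+ 2)%:E + \int[@plane_measure R]_x (g x ^+ 2)%:E)%E.
Proof.
move=> cf cg; under eq_integral do rewrite EFinD.
have pos (h : R * R -> R) x : (0 <= (h x ^+ 2)%:E)%E by rewrite lee_fin sqr_ge0.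
apply: (@ge0_integralD _ _ _ (@plane_measure R)).
- exact: measurableT.
- by move=> x _; exact: pos.
- exact: (measurable_EFin_plane _ (continuous_sqr _ cf)).
- by move=> x _; exact: pos.
- exact: (measurable_EFin_plane _ (continuous_sqr _ cg)).
Qed.

Lemma energy_ge0 (v : R * R -> 'rV[R]_3) : (0 <= energy v)%E.
Proof.
apply: integral_ge0 => x _; rewrite lee_fin.
by apply: sumr_ge0 => i _; exact: sqr_ge0.
Qed.

Lemma fine_energyK (v : R * R -> 'rV[R]_3) : (energy v < +oo)%E -> (fine (energy v))%:E = energy v.
Proof. by move=> H; apply: fineK; rewrite (ge0_fin_numE (energy_ge0 v)). Qed.

Lemma energy_symplectic (f : R * R -> R) : energy (symplectic_field f) =
  (\int[@plane_measure R]_x (pd 0 f x ^+ 2 + pd 1 f x ^+ 2)%:E)%E.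
Proof.
have alg (a b : R) : (- a) ^+ 2 + b ^+ 2 + 0 ^+ 2 = b ^+ 2 + a ^+ 2 by ring.
by apply: eq_integral => x _; rewrite sum_ord3 !mxE alg.
Qed.

(** Unprimed letters stand for derivatives of the potential, primed ones for the heat averages they
    equal. Passing these identities as equations between numbers avoids rewriting under [pd]. *)
Lemma convection_component1 (a b p q r a' b' p' q' v0 v1 w0 w1 : R) :
  a = a' -> b = b' -> p = p' -> q = q' ->
  v0 = - 1 * a' -> v1 = 1 * b' -> w0 = - 1 * p' -> w1 = - 1 * q' ->
  a * p - b * q + r = 0 -> v0 * w0 + v1 * w1 + r = 0.
Proof. by move=> <- <- <- <- -> -> -> -> <-; ring. Qed.

Lemma convection_component2 (a b p q r a' b' p' q' v0 v1 w0 w1 : R) :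
  a = a' -> b = b' -> p = p' -> q = q' ->
  v0 = - 1 * a' -> v1 = 1 * b' -> w0 = 1 * p' -> w1 = 1 * q' ->
  - (a * p) + b * q + r = 0 -> v0 * w0 + v1 * w1 + r = 0.
Proof. by move=> <- <- <- <- -> -> -> -> <-; ring. Qed.

End uniform_bounds.

(** * The heat flow of the potential is a global solution *)

Section existence.
Context {R : realType}.
Variables (nu : R) (phi0 : R * R -> R).
Hypotheses (nu_gt0 : 0 < nu) (phi0_radial : radially_symmetric phi0)
  (phi0_regular : regular_enough phi0).

(** Built on [heat_avg] because the prefactor of [heat_potential] degenerates at [t = 0]. Here time
    0 gives [s = 0] and returns [phi0] itself; for negative times the square root is 0 as well, so
    the field is extended continuously by its initial value. *)
Definition heat_field (t : R) : R * R -> 'rV[R]_3 :=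
  symplectic_field (heat_avg phi0 (Num.sqrt (4 * nu * t))).

Let smooth : Ck 3 phi0. Proof. by case: phi0_regular. Qed.

Let C2f j : C2_bounded (pd j phi0).
Proof. by apply: regular_C2_bounded => //; case: phi0_regular. Qed.

Let D1ex : exists C : R, forall j x, `|pd j phi0 x| <= C.
Proof. by apply: finite_bound => j; have [[_ H] _ _] := C2f j. Qed.

Let D2ex : exists C : R, forall j k x, `|pd k (pd j phi0) x| <= C.
Proof.
have H j : exists C : R, forall k x, `|pd k (pd j phi0) x| <= C.
  by apply: finite_bound => k; have [_ H _] := C2f j; have [_ [_]] := H k.
have [C0 h0] := H 0; have [C1 h1] := H 1; have [C2 h2] := H 2.
have p0 := le_trans (normr_ge0 _) (h0 0 0); have p1 := le_trans (normr_ge0 _) (h1 0 0).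
have p2 := le_trans (normr_ge0 _) (h2 0 0).
exists (C0 + C1 + C2); apply: ord3_ind => k x.
- by apply: le_trans (h0 k x) _; rewrite -addrA lerDl addr_ge0.
- by apply: le_trans (h1 k x) _; rewrite addrAC lerDr addr_ge0.
- by apply: le_trans (h2 k x) _; rewrite lerDr addr_ge0.
Qed.

Let cphi : continuous phi0. Proof. exact: (smooth [::] isT).1. Qed.

Let dphi j x : derivable phi0 x (dir R j). Proof. exact: (smooth [::] isT).2. Qed.

Let growth : exists C : R, linear_growth phi0 C.
Proof. by have [D fD] := D1ex; exists (`|phi0 0| + D); exact: lipschitz_linear_growth. Qed.

Let cpd j : continuous (pd j phi0). Proof. by have [[]] := C2f j. Qed.

Let is_derive_psi j s x :
  is_derive x (dir R j) (heat_avg phi0 s) (heat_avg (pd j phi0) s x).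
Proof.
have [C fC] := growth; have [D fD] := D1ex.
exact: is_derive_heat_avg cphi fC (dphi j) (cpd j) (fD j).
Qed.

Let pd_psi j s : pd j (heat_avg phi0 s) = heat_avg (pd j phi0) s.
Proof. by apply/funext => x; exact: is_derive_val (is_derive_psi _ _ _). Qed.

Let is_derive2_psi j k s x :
  is_derive x (dir R k) (heat_avg (pd j phi0) s) (heat_avg (pd k (pd j phi0)) s x).
Proof.
have [[cf [C fC]] /(_ k)[df [cdf [D fD]]]] := C2_bounded_C1 _ (C2f j).
exact: is_derive_heat_avg cf (bounded_linear_growth _ _ fC) df cdf fD.
Qed.

Let pd2_psi j k s : pd k (heat_avg (pd j phi0) s) = heat_avg (pd k (pd j phi0)) s.
Proof. by apply/funext => x; exact: is_derive_val (is_derive2_psi _ _ _ _). Qed.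

Let pd_psiE j s x : pd j (heat_avg phi0 s) x = heat_avg (pd j phi0) s x.
Proof. by rewrite pd_psi. Qed.

Let pd2_psiE j k s x : pd k (pd j (heat_avg phi0 s)) x = heat_avg (pd k (pd j phi0)) s x.
Proof. by rewrite pd_psi pd2_psi. Qed.

Let continuous_avg (f : R * R -> R) (s : R) : continuous_bounded f -> continuous (heat_avg f s).
Proof.
move=> [cf [C fC]] x; have c := continuous_heat_avg f C cf (bounded_linear_growth _ _ fC).
exact: continuous_section (c (s, x)).
Qed.

Let cb1 j : continuous_bounded (pd j phi0). Proof. by have [] := C2f j. Qed.

Let cb2 j k : continuous_bounded (pd k (pd j phi0)).
Proof. by have [_ H _] := C2f j; exact: (H k).2. Qed.

Let cpt0E : cpt heat_field 0 =
  fun t x => - 1 * heat_avg (pd 1 phi0) (Num.sqrt (4 * nu * t)) x.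
Proof. by apply/funext => t; apply/funext => x; rewrite /cpt !mxE /= pd_psi mulN1r. Qed.

Let cpt1E : cpt heat_field 1 =
  fun t x => 1 * heat_avg (pd 0 phi0) (Num.sqrt (4 * nu * t)) x.
Proof. by apply/funext => t; apply/funext => x; rewrite /cpt !mxE /= pd_psi mul1r. Qed.

Let cpt2E : cpt heat_field 2 =
  fun t x => 0 * heat_avg (pd 0 phi0) (Num.sqrt (4 * nu * t)) x.
Proof. by apply/funext => t; apply/funext => x; rewrite /cpt !mxE /= mul0r. Qed.

Let cptE i : exists (a : R) k, `|a| <= 1 /\ cpt heat_field i =
  fun t x => a * heat_avg (pd k phi0) (Num.sqrt (4 * nu * t)) x.
Proof.
move: i; apply: ord3_ind.
- by exists (- 1), 1; split; [rewrite normrN1|exact: cpt0E].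
- by exists 1, 0; split; [rewrite normr1|exact: cpt1E].
- by exists 0, 0; split; [rewrite normr0|exact: cpt2E].
Qed.

Let classical : classical_velocity heat_field.
Proof.
apply: classical_velocity_flow nu_gt0 _ => i; have [a [k [_ E]]] := cptE i.
by exists a, (pd k phi0); split.
Qed.

Let schwarz_phi : pd 0 (pd 1 phi0) = pd 1 (pd 0 phi0).
Proof.
apply: (schwarz phi0 (dphi 0) (dphi 1)).
- by move=> x; have [_ H _] := C2f 0; exact: (H 1).1.
- by move=> x; have [_ H _] := C2f 1; exact: (H 0).1.
- exact: (cb2 0 1).1.
- exact: (cb2 1 0).1.
Qed.

Let pd_cpt0 j t x : pd j (cpt heat_field 0 t) x =
  - 1 * heat_avg (pd j (pd 1 phi0)) (Num.sqrt (4 * nu * t)) x.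
Proof. by rewrite cpt0E (pd_flow _ _ _ _ (C2_bounded_C1 _ (C2f 1))). Qed.

Let pd_cpt1 j t x : pd j (cpt heat_field 1 t) x =
  1 * heat_avg (pd j (pd 0 phi0)) (Num.sqrt (4 * nu * t)) x.
Proof. by rewrite cpt1E (pd_flow _ _ _ _ (C2_bounded_C1 _ (C2f 0))). Qed.

Let divergence : divergence_free heat_field.
Proof.
move=> t x _; rewrite sum_ord3 pd2 addr0 pd_cpt0 pd_cpt1 schwarz_phi.
by rewrite mulN1r mul1r addNr.
Qed.

(** The linear part of the momentum equation vanishes by itself; what remains is the balance between
    convection and pressure, settled at each fixed time by radial symmetry. *)
Let heat_part i t x : 0 < t ->
  dt heat_field i t x - nu * laplacian (cpt heat_field i t) x = 0.
Proof.
move=> t0; have [a [k [_ E]]] := cptE i.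
have C1 := C2_bounded_C1 _ (C2f k); have C1p j := C2_bounded_pd _ j (C2f k).
rewrite /dt /laplacian E (is_derive_val _ _ _ _ _ _ (flow_heat_equation _ a _ _ x nu_gt0 t0 (C2f k))).
rewrite (pd_flow _ _ _ _ C1) (pd_flow _ _ _ _ C1) (pd_flow _ _ _ _ (C1p 0)) (pd_flow _ _ _ _ (C1p 1)).
by rewrite subrr.
Qed.

Let D1psi D j s x : (forall j x, `|pd j phi0 x| <= D) -> `|heat_avg (pd j phi0) s x| <= D.
Proof. by move=> fD; exact: heat_avg_le (cpd j) (fD j). Qed.

Let cpt_bound D i t x : (forall j x, `|pd j phi0 x| <= D) -> `|cpt heat_field i t x| <= D.
Proof.
move=> fD; have [a [k [a1 ->]]] := cptE i; rewrite normrM -[leRHS]mul1r.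
exact: ler_pM (normr_ge0 a) (normr_ge0 _) a1 (D1psi D k _ x fD).
Qed.

Let D2psi D j k s x : (forall j k x, `|pd k (pd j phi0) x| <= D) ->
  `|heat_avg (pd k (pd j phi0)) s x| <= D.
Proof. by move=> fD; exact: heat_avg_le (cb2 j k).1 (fD j k). Qed.

Let energy_psi s :
  (\int[@plane_measure R]_x (heat_avg (pd 0 phi0) s x ^+ 2 + heat_avg (pd 1 phi0) s x ^+ 2)%:E <=
   (fine (energy (symplectic_field phi0)))%:E)%E.
Proof.
have Elty : (energy (symplectic_field phi0) < +oo)%E by case: phi0_regular.
rewrite (fine_energyK _ Elty) energy_symplectic (integral_sqrD _ _ (cpd 0) (cpd 1)).
rewrite (integral_sqrD _ _ (continuous_avg _ s (cb1 0)) (continuous_avg _ s (cb1 1))).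
by apply: leeD; exact: energy_heat_avg.
Qed.

Let energy_field t :
  (energy (heat_field t) <= (fine (energy (symplectic_field phi0)))%:E)%E.
Proof.
have := energy_psi (Num.sqrt (4 * nu * t)); rewrite -!pd_psi.
by rewrite -energy_symplectic.
Qed.

Let pressure D s : (forall j k x, `|pd k (pd j phi0) x| <= D) ->
  let psi := heat_avg phi0 s in
  exists P0 : R * R -> R,
  [/\ Ck 1 P0,
      forall x, pd 1 psi x * pd 0 (pd 1 psi) x - pd 0 psi x * pd 1 (pd 1 psi) x +
        pd 0 P0 x = 0,
      forall x, - (pd 1 psi x * pd 0 (pd 0 psi) x) + pd 0 psi x * pd 1 (pd 0 psi) x +
        pd 1 P0 x = 0
    & forall x, `|P0 x| <= 4 * D ^+ 2 + fine (energy (symplectic_field phi0))].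
Proof.
move=> fD psi; apply: radial_pressure.
- exact: radial_heat_avg.
- by move=> j x; exact: is_derive_derivable (is_derive_psi j s x).
- by move=> j; rewrite /psi pd_psi; exact: continuous_avg (cb1 j).
- by move=> j k x; rewrite /psi pd_psi; exact: is_derive_derivable (is_derive2_psi j k s x).
- by move=> j k; rewrite /psi pd_psi pd2_psi; exact: continuous_avg (cb2 j k).
- by move=> x; rewrite /psi pd_psi pd2_psi; exact: D2psi.
- by rewrite /psi !pd_psi; exact: energy_psi.
Qed.

Let Ck_psi s : Ck 1 (heat_avg phi0 s).
Proof.
case=> [|j [|//]] _.
  split=> [x|_ j x]; last exact: is_derive_derivable (is_derive_psi j s x).
  have [C fC] := growth.
  exact: continuous_section (continuous_heat_avg phi0 C cphi fC (s, x)).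
split; last by move=> H; exact: False_ind (notF H).
suff : continuous (pd j (heat_avg phi0 s)) by exact: id.
rewrite (pd_psi j s); exact: continuous_avg (cb1 j).
Qed.

Lemma heat_field_solution : global_solution nu (symplectic_field phi0) heat_field.
Proof.
split; first by exists (fun t => heat_avg phi0 (Num.sqrt (4 * nu * t))) => t _;
  exact: conj (Ck_psi _) (fun=> erefl).
split; first exact: classical.
split.
  have E : heat_avg phi0 0 = phi0 by apply/funext => y; exact: heat_avg0.
  by move=> x; rewrite /heat_field mulr0 sqrtr0 E.
split; first exact: divergence.
have [D1 fD1] := D1ex; have [D2 fD2] := D2ex.
(* A pressure is chosen at each time separately. Its bound is uniform in time because the second
   derivatives and the energy of the flow are dominated by those of the initial data. *)
have [P HP] := choice (fun t => pressure D2 (Num.sqrt (4 * nu * t)) fD2).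
exists P; split.
- by move=> t _; have [] := HP t.
- move=> t x i t0; rewrite (heat_part i t x t0) add0r; have [_ e1 e2 _] := HP t.
  rewrite sum_ord3 pd2 mulr0 addr0.
  have c0 := congr1 (fun h => h t x) cpt0E; have c1 := congr1 (fun h => h t x) cpt1E.
  move: i; apply: ord3_ind.
  + exact: convection_component1 (pd_psiE 1 _ x) (pd_psiE 0 _ x) (pd2_psiE 1 0 _ x) (pd2_psiE 1 1 _ x)
      c0 c1 (pd_cpt0 0 t x) (pd_cpt0 1 t x) (e1 x).
  + exact: convection_component2 (pd_psiE 1 _ x) (pd_psiE 0 _ x) (pd2_psiE 0 0 _ x) (pd2_psiE 0 1 _ x)
      c0 c1 (pd_cpt1 0 t x) (pd_cpt1 1 t x) (e2 x).
  + have z j : pd j (cpt heat_field 2 t) x = 0.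
      by rewrite cpt2E (pd_flow _ 0 j _ (C2_bounded_C1 _ (C2f 0))) mul0r.
    by rewrite (z 0) (z 1) pd2 !mulr0 !addr0.
- move=> T; set E := fine (energy (symplectic_field phi0)).
  have D10 : 0 <= D1 by exact: le_trans (fD1 0 0).
  have E0 : 0 <= E by apply: fine_ge0; exact: energy_ge0.
  have Q0 : 0 <= 4 * D2 ^+ 2 := mulr_ge0 (ler0n _ 4) (sqr_ge0 D2).
  (* One constant must bound energy, velocity and pressure, hence the sum; it serves every [T]. *)
  exists (D1 + (4 * D2 ^+ 2 + E)) => t _; split.
  + apply: le_trans (energy_field t) _; rewrite lee_fin.
    exact: ler_wpDl D10 (ler_wpDl Q0 (lexx E)).
  + move=> x i; exact: ler_wpDr (addr_ge0 Q0 E0) (cpt_bound D1 i t x fD1).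
  + move=> t0 x; have [_ _ _ b] := HP t; exact: ler_wpDl D10 (b x).
Qed.

Lemma heat_field_gradient : exists K : R, forall t x i j, `|pd j (cpt heat_field i t) x| <= K.
Proof.
have [D2 fD2] := D2ex; exists D2 => t x i j; have [a [k [a1 ->]]] := cptE i.
rewrite (pd_flow _ _ _ _ (C2_bounded_C1 _ (C2f k))) normrM.
rewrite -[leRHS]mul1r; exact: ler_pM (normr_ge0 a) (normr_ge0 _) a1 (D2psi D2 k j _ x fD2).
Qed.

Lemma heat_field_potential t : 0 < t -> symplectic_rep (heat_field t) (heat_potential nu phi0 t).
Proof.
move=> t0; have [C fC] := growth.
rewrite (heat_potentialE phi0 nu t C nu_gt0 t0 cphi fC).
exact: conj (Ck_psi _) (fun=> erefl).
Qed.

Lemma heat_potential_radial t : 0 < t -> radially_symmetric (heat_potential nu phi0 t).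
Proof.
move=> t0; have [C fC] := growth.
by rewrite (heat_potentialE phi0 nu t C nu_gt0 t0 cphi fC); exact: radial_heat_avg.
Qed.

End existence.

Theorem theorem1p3 (R : realType) (nu : R) (phi0 : R * R -> R)
  (nu_gt0 : 0 < nu)
  (phi0_radial : radially_symmetric phi0)
  (phi0_regular : regular_enough phi0) :
  exists u : R -> R * R -> 'rV[R]_3,
    [/\ global_solution nu (symplectic_field phi0) u,
        forall v : R -> R * R -> 'rV[R]_3,
          global_solution nu (symplectic_field phi0) v ->
          forall (t : R) (x : R * R), 0 <= t -> v t x = u t x,
        forall t : R, 0 < t ->
          symplectic_rep (u t) (heat_potential nu phi0 t)
      & forall t : R, 0 < t -> radially_symmetric (heat_potential nu phi0 t)].
Proof.
have solution := heat_field_solution nu phi0 nu_gt0 phi0_radial phi0_regular.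
exists (heat_field nu phi0); split; first exact: solution.
(* The heat flow plays the part of the solution with bounded gradient, [K] being a bound for the
   second derivatives of [phi0]; nothing similar is asked of [v]. *)
- move=> v sv; have [K uK] := heat_field_gradient nu phi0 phi0_regular.
  apply: (global_solution_unique nu K _ (heat_field nu phi0) v nu_gt0 solution sv) => t x i j _.
  exact: uK.
- exact: heat_field_potential.
- exact: heat_potential_radial.
Qed.
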